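(* Let $d\geq 5$ and let $\Delta$ be a flag normal $(d-1)$-pseudomanifold. Then the following holds: (1) $g_2(\Delta)\geq (d-4)\,\alpha(\Delta)$, and $$g_2(\Delta)\ \geq\ \frac{\sqrt{4d^2+12d-31}-(2d+1)}{4}\, f_0(\Delta).$$ (2) If, furthermore, $\Delta\in S(1,d-1)$ (i.e. $\Delta$ is a flag $\mathbb{Z}/2\mathbb{Z}$-homology $(d-1)$-sphere), then $g_i(\Delta)\geq (d-2i)\,\alpha(\Delta)$ for all integers $i$ with $2\leq i\leq \frac{d-1}{2}$.
   Context: All simplicial complexes are finite. A face $\tau$ of a simplicial complex $\Delta$ has dimension $|\tau|-1$. A missing face of $\Delta$ is a set of vertices that is not a face but all of whose proper subsets are faces; its dimension is its cardinality minus $1$. $\Delta$ is flag if all its missing faces have dimension at most $1$. The link of a face $\tau$ is $\mathrm{lk}(\tau)=\{\sigma\in\Delta:\sigma\cup\tau\in\Delta,\ \sigma\cap\tau=\emptyset\}$. A normal $(d-1)$-pseudomanifold is a simplicial complex whose facets (maximal faces) all have dimension $d-1$, in which every $(d-2)$-face is contained in exactly two facets, and in which the link of each face (including $\emptyset$) of dimension at most $d-3$ is connected. A $(d-1)$-sphere means a $\mathbb{Z}/2\mathbb{Z}$-homology sphere: a pure $(d-1)$-dimensional simplicial complex such that for every face $\sigma$ (including $\emptyset$), $\mathrm{lk}(\sigma)$ has the $\mathbb{Z}/2\mathbb{Z}$-homology of a $(d-1-|\sigma|)$-dimensional sphere. $S(j,d-1)$ denotes the set of $(d-1)$-spheres all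 of whose missing faces have dimension at most $j$. For a $(d-1)$-dimensional complex, $f_i$ is the number of $i$-faces ($f_{-1}=1$); $\sum_{i=0}^d f_{i-1}(t-1)^{d-i}=\sum_{i=0}^d h_i t^{d-i}$ defines the $h$-numbers; $g_0=1$, $g_j=h_j-h_{j-1}$. In particular $g_2=f_1-df_0+\binom{d+1}{2}$. $\alpha(\Delta)$ is the independence number of the graph ($1$-skeleton) of $\Delta$, i.e. the maximum size of a set of pairwise non-adjacent vertices. *)

(* Defs.v *)
From HB Require Import structures.
From mathcomp Require Import all_boot all_order all_algebra.

Set Implicit Arguments.
Unset Strict Implicit.
Unset Printing Implicit Defensive.

Import Order.TTheory GRing.Theory Num.Theory.

(* A complex is a set of faces over an ambient finite type [T], whose elements
   need not all be vertices.  Dimensions are expressed through cardinalities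
   (a face of cardinality k has dimension k - 1), so that the empty face needs
   no negative index; below, the parameter [d] always stands for dimension
   d - 1. *)

Section Complexes.
Variable T : finType.
Implicit Types (D : {set {set T}}) (s t F M S : {set T}) (u v : T).

Definition simplicial_complex D : Prop :=
  set0 \in D /\ (forall s t, s \in D -> t \subset s -> t \in D).

Definition vertices D : {set T} := [set v | [set v] \in D].

Definition adjacent D : rel T :=
  fun u v => (u != v) && ([set u; v] \in D).

Definition facet D F : bool := maxset [in D] F.

Definition link D t : {set {set T}} :=
  [set s in D | (s :|: t \in D) && (s :&: t == set0)].

Definition missing_face D M : Prop :=
  [/\ M \subset vertices D, M \notin D
    & forall s, s \proper M -> s \in D].

Definition missing_faces_dim_le (j : nat) D : Prop :=
  forall M, missing_face D M -> #|M| <= j.+1.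

Definition flag D : Prop := missing_faces_dim_le 1 D.

Definition connected_complex D : Prop :=
  {in vertices D &, forall u v, connect (adjacent D) u v}.

Definition pure (d : nat) D : Prop := forall F, facet D F -> #|F| = d.

Definition normal_pseudomanifold (d : nat) D : Prop :=
  [/\ simplicial_complex D,
      pure d D,
      forall s, s \in D -> #|s|.+1 = d ->
        #|[set F | facet D F & s \subset F]| = 2
    & forall s, s \in D -> #|s|.+2 <= d -> connected_complex (link D s)].

Definition independent D S : bool :=
  (S \subset vertices D) &&
  [forall u in S, forall v in S, ~~ adjacent D u v].

Definition independence_number D : nat := \max_(S | independent D S) #|S|.

(* [fnum D k] is f_{k-1}. *)
Definition fnum D (k : nat) : nat := #|[set s in D | #|s| == k]|.

Section Homology.
Local Open Scope ring_scope.

(* All chains over Z/2, in all degrees at once.  The empty set is one of the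
   basis elements, so the chain complex is augmented and the homology below is
   reduced. *)
Local Notation chain := {ffun {set T} -> ('F_2)^o}.

Definition boundary_fun (c : chain) : chain :=
  [ffun s : {set T} =>
     \sum_(t : {set T} | (s \subset t) && (#|t| == #|s|.+1)) c t].

Fact boundary_fun_is_linear : linear boundary_fun.
Proof.
move=> a c c'; apply/ffunP=> s; rewrite !ffunE scaler_sumr -big_split /=.
by apply: eq_bigr => t _; rewrite !ffunE.
Qed.
HB.instance Definition _ :=
  GRing.isLinear.Build 'F_2 chain chain *:%R boundary_fun
    boundary_fun_is_linear.

Definition boundary : 'End(chain) := linfun boundary_fun.

Definition face_chain s : chain := [ffun t => (t == s)%:R].

(* Chains of [D] in dimension k - 1. *)
Definition chains D (k : nat) : {vspace chain} :=
  <<[seq face_chain s | s <- enum D & #|s| == k]>>%VS.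

Definition cycles D k : {vspace chain} := (chains D k :&: lker boundary)%VS.

Definition boundaries D k : {vspace chain} :=
  (boundary @: chains D k.+1)%VS.

(* Dimension of the reduced homology of [D] over Z/2 in degree k - 1. *)
Definition betti D k : nat := (\dim (cycles D k) - \dim (boundaries D k))%N.

End Homology.

(* [D] has the Z/2-homology of a sphere of dimension n - 1 (for n = 0, of the
   empty sphere, with reduced homology in degree -1 only). *)
Definition sphere_homology (n : nat) D : Prop :=
  forall k, betti D k = (k == n).

Definition homology_sphere (d : nat) D : Prop :=
  [/\ simplicial_complex D, pure d D
    & forall s, s \in D -> sphere_homology (d - #|s|) (link D s)].

(* The class S(j, d-1). *)
Definition sphere_class (j d : nat) D : Prop :=
  homology_sphere d D /\ missing_faces_dim_le j D.

Section HNumbers.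
Local Open Scope ring_scope.

Definition hpoly (d : nat) D : {poly int} :=
  \sum_(i < d.+1) (fnum D i)%:R *: ('X - 1) ^+ (d - i).

(* h_i is the coefficient of t^(d-i); meaningful for i <= d only. *)
Definition hnum (d : nat) D (i : nat) : int := (hpoly d D)`_(d - i).

Definition gnum (d : nat) D (i : nat) : int :=
  if i is i'.+1 then hnum d D i - hnum d D i' else 1.

End HNumbers.

End Complexes.

(* Main.v *)
(* Work in the face ring K[D] over a field K of characteristic 2, with the linear forms
   theta_j = sum_v (t v)^j x_v of the moment curve, for t generic in the sense that its
   squarefree monomials are independent over K^2.  Let A be the quotient of K[D] by
   theta_0, ..., theta_d.  The bounds on g_i come from two estimates of dim A_i.
   From above, theta_0, ..., theta_(d-1) are regular and theta_d is injective in the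
   relevant degrees, so that dim A_i = g_i.  For i = 2 this follows from strong
   connectivity; for spheres, from the exactness of the complex of face rings of the
   faces of each size; the injectivity of theta_d rests on the anisotropy of the
   degree map in characteristic 2, which is read off from Lee's formula by splitting
   Vandermonde determinants into squares.
   From below, let S be independent.  For v in S the ideal generated by x_v contributes
   at least d - 2i dimensions to A_i, seen along a chain of d - 2i faces containing v, and
   the contributions of different v are independent because x_v vanishes on the star of
   any other vertex of S.
   The bound by f_0 follows from Turan's theorem: with n = f_0 and g = g_2, one has
   alpha >= n^2 / (n + 2 f_1), and f_1 is expressed through g_2. *)

Require Import Defs.
From HB Require Import structures.
From mathcomp Require Import all_boot all_order all_algebra.
From mathcomp Require Import ring lra zify.
From mathcomp.multinomials Require Import mpoly.
From Stdlib Require Import Classical_Prop IndefiniteDescription.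

Set Implicit Arguments.
Unset Strict Implicit.
Unset Printing Implicit Defensive.

Import Order.TTheory GRing.Theory Num.Theory.
Local Open Scope ring_scope.

(** * Vandermonde products and Lagrange interpolation *)

(** A normal pseudomanifold need not be Cohen-Macaulay, so its Artinian reduction offers no Poincare
    duality. The lower bound therefore works modulo the kernel of the pairing given by the degree
    map; even incidence of ridges and facets is enough for anisotropy and the Lefschetz property
    there. The estimate in degree i is drawn from links whose facets have 2i vertices, where degree
    i is the middle one and flagness forces the quotient to be nonzero. To pass from such a link to
    a multiple of x_v on the star, two fields are used: K0 carries generic coordinates of all
    vertices, and K has fresh ones for the vertices of S, transcendental over K0. Independence of S
    keeps the rest of S out of the link of a face through v, so the ideal of the link is defined
    over K0, from which t v stays transcendental. Connectivity and homology enter only the upper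
    bound: gluing local solutions along facets takes strong connectivity, and solving in degrees
    above two takes exactness for all links. *)

Lemma setU1_ind (T : finType) (P : {set T} -> Prop) :
  P set0 -> (forall w (F : {set T}), w \notin F -> P F -> P (w |: F)) -> forall F, P F.
Proof.
move=> P0 PU F; have [n] := ubnP #|F|; elim: n F => // n IH F leF.
have [->//|[w wF]] := set_0Vmem F.
rewrite -(setD1K wF); apply: PU; first by rewrite !inE eqxx.
by apply: IH; move: leF; rewrite (cardsD1 w) wF add1n ltnS.
Qed.

Section Char2.
Variables (K : fieldType) (char2 : 2%N \in [pchar K]).
Implicit Types x y : K.

Lemma sqr_sum2 I (r : seq I) (P : pred I) (F : I -> K) :
  (\sum_(i <- r | P i) F i) ^+ 2 = \sum_(i <- r | P i) F i ^+ 2.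
Proof. by rewrite -(pFrobenius_autE char2) rmorph_sum. Qed.

Lemma add2_eq0 x y : (x + y == 0) = (x == y).
Proof. by rewrite addr_eq0 oppr_pchar2. Qed.

End Char2.

Section Vandermonde.
Variables (K : fieldType) (char2 : 2%N \in [pchar K]).
Variables (T : finType) (t : T -> K).
Implicit Types (F G J Q N : {set T}) (u v w : T).

(* In characteristic 2 the Vandermonde product needs no order on F. *)
Definition vand F : K :=
  \prod_(e : {set T} | (e \subset F) && (#|e| == 2)%N) \sum_(v in e) t v.

(** For v in F, the derivative at [t v] of the polynomial with roots [t u], u in F, written without
    signs: the Lagrange denominator. *)
Definition node F v : K := \prod_(u in F :\ v) (t v + t u).

Definition mono Q : K := \prod_(v in Q) t v.

Lemma vand0 : vand set0 = 1.
Proof.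
rewrite /vand big_pred0 // => e; apply/negP => /andP[/subset_leq_card].
by rewrite cards0 leqn0 => /eqP->.
Qed.

Lemma vandU1 w F : w \notin F ->
  vand (w |: F) = vand F * \prod_(u in F) (t w + t u).
Proof.
move=> wF; rewrite /vand (bigID (fun e : {set T} => w \in e)) /= mulrC.
congr (_ * _).
  apply: eq_bigl => e; rewrite -!andbA [_ && (w \notin e)]andbC andbA.
  congr (_ && _); apply/andP/idP => [[/subsetP eF we]|/subsetP eF].
    by apply/subsetP => x xe; move: (eF x xe); rewrite !inE => /orP[/eqP xw|//];
      rewrite -xw xe in we.
  split; last by apply/negP => /eF; apply/negP.
  by apply/subsetP => x /eF xF; rewrite !inE xF orbT.
have hin : {in F &, injective (fun u => [set w; u])}.
  move=> u u' uF u'F /setP /(_ u); rewrite !inE eqxx orbT => /esym/orP[]/eqP //.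
  by move=> uw; rewrite -uw uF in wF.
transitivity (\prod_(e in [set [set w; u] | u in F]) \sum_(v in e) t v).
  apply: eq_bigl => e; apply/idP/imsetP => [/andP[/andP[eF ce] we]|[u uF ->]].
    have : #|e :\ w| == 1%N by move: ce; rewrite (cardsD1 w) we.
    case/cards1P => u eu; exists u.
      have : u \in e :\ w by rewrite eu set11.
      by rewrite !inE => /andP[uw /(subsetP eF)]; rewrite !inE (negPf uw).
    by rewrite -eu setD1K.
  rewrite !inE eqxx andbT cards2 (_ : w != u); last first.
    by apply: contraNneq wF => ->.
  by rewrite andbT subUset !sub1set !inE eqxx uF orbT.
rewrite big_imset //=; apply: eq_bigr => u uF.
by rewrite big_setU1 ?big_set1 // inE; apply: contraNneq wF => ->.
Qed.

Lemma vandD1 w F : w \in F -> vand F = vand (F :\ w) * node F w.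
Proof. by move=> wF; rewrite -{1}(setD1K wF) vandU1 // !inE eqxx. Qed.

Lemma big_setU (R : Type) (idx : R) (op : Monoid.com_law idx) J G (f : T -> R) :
  [disjoint J & G] ->
  \big[op/idx]_(u in J :|: G) f u =
    op (\big[op/idx]_(u in J) f u) (\big[op/idx]_(u in G) f u).
Proof.
move=> dJG; rewrite -bigU //; apply: eq_bigl => u.
by rewrite !inE.
Qed.

Definition cross J G : K := \prod_(u in J) \prod_(v in G) (t u + t v).

Lemma vandU J G : [disjoint J & G] -> vand (J :|: G) = vand J * vand G * cross J G.
Proof.
elim/setU1_ind: J => [|w J wJ IH] dJG.
  by rewrite set0U vand0 /cross big_set0 mulr1 mul1r.
move: dJG; rewrite -setI_eq0 setIUl setU_eq0 !setI_eq0 disjoints1 => /andP[wG dJG].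
rewrite -setUA vandU1 ?inE ?negb_or ?wJ // IH // vandU1 //.
rewrite /cross big_setU1 //= big_setU //=; ring.
Qed.

Lemma disjointDs J F : [disjoint J & F :\: J].
Proof. by rewrite disjoints_subset setCD subsetUr. Qed.

Lemma vandDs J F : J \subset F ->
  vand F = vand J * vand (F :\: J) * cross J (F :\: J).
Proof.
move=> JF; rewrite -vandU ?disjointDs //; congr vand.
apply/setP => x; rewrite !inE; case: (boolP (x \in J)) => //= xJ.
exact: (subsetP JF).
Qed.

(** A pair inside J occurs in the nodes of both of its elements, hence the square. *)
Lemma node_prod J F : J \subset F ->
  \prod_(v in J) node F v = vand J ^+ 2 * cross J (F :\: J).
Proof.
elim/setU1_ind: J => [|w J wJ IH] JF.
  by rewrite big_set0 vand0 /cross big_set0 expr1n mulr1.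
move: JF; rewrite subUset sub1set => /andP[wF JF].
rewrite big_setU1 //= IH // vandU1 // /cross big_setU1 //=.
have wFJ : w \in F :\: J by rewrite !inE wJ.
have -> : F :\: (w |: J) = F :\: J :\ w by rewrite setUC -setDDl.
have -> : node F w = \prod_(u in J) (t w + t u) *
    \prod_(u in F :\: J :\ w) (t w + t u).
  rewrite /node (bigID (mem J)) /=; congr (_ * _); apply: eq_bigl => u.
    rewrite !inE; have [uJ|] := boolP (u \in J); last by rewrite andbF.
    by rewrite (subsetP JF _ uJ) !andbT; apply: contraNneq wJ => <-.
  by rewrite !inE andbC andbCA.
have -> : \prod_(u in J) \prod_(v in F :\: J) (t u + t v) =
    \prod_(u in J) (t w + t u) * \prod_(u in J) \prod_(v in F :\: J :\ w) (t u + t v).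
  rewrite -big_split /=; apply: eq_bigr => u uJ.
  by rewrite (big_setD1 w wFJ) /= [t u + _]addrC.
ring.
Qed.

Hypothesis tI : injective t.

Lemma dt_neq0 u v : u != v -> t u + t v != 0.
Proof. by move=> uv; rewrite add2_eq0 // (inj_eq tI). Qed.

Lemma node_neq0 F v : node F v != 0.
Proof.
by apply/prodf_neq0 => u; rewrite !inE => /andP[uv _]; rewrite dt_neq0 // eq_sym.
Qed.

Lemma vand_neq0 F : vand F != 0.
Proof.
elim/setU1_ind: F => [|w F wF IH]; first by rewrite vand0 oner_eq0.
rewrite vandU1 // mulf_neq0 //; apply/prodf_neq0 => u uF.
by apply: dt_neq0; apply: contraNneq wF => ->.
Qed.

Lemma cross_neq0 J G : [disjoint J & G] -> cross J G != 0.
Proof.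
move=> dJG; apply/prodf_neq0 => u uJ; apply/prodf_neq0 => v vG.
apply: dt_neq0; apply: contraTneq uJ => ->; apply: contraTN vG => vJ.
by rewrite (disjointFr dJG vJ).
Qed.

(** The barycentric interpolation weights, extended by 0 to a point of the whole affine space. There
    the thetas of index below [#|F|.-1] vanish and the next one is 1. *)
Definition lam F v : K := if v \in F then (node F v)^-1 else 0.

Lemma vand_lam_prod J F : J \subset F ->
  vand F * \prod_(v in J) lam F v = vand (F :\: J) / vand J.
Proof.
move=> JF; rewrite (eq_bigr (fun v => (node F v)^-1)); last first.
  by move=> v vJ; rewrite /lam (subsetP JF).
rewrite prodfV node_prod // (vandDs JF).
have ? := vand_neq0 J.
have ? : cross J (F :\: J) != 0.
  by apply: cross_neq0; apply: disjointDs.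
by field; apply/andP.
Qed.

Lemma lamD1 F w v : w \in F -> lam (F :\ w) v = (t v + t w) * lam F v.
Proof.
move=> wF; rewrite /lam !inE; have [->|vw] /= := eqVneq v w.
  by rewrite addrr_pchar2 ?mul0r.
case: ifP => vF; last by rewrite mulr0.
rewrite /node [in RHS](big_setD1 w) /=; last by rewrite !inE eq_sym vw.
rewrite invfM mulVKf; last exact: dt_neq0.
by congr (_^-1); apply: eq_bigl => x; rewrite !inE andbCA.
Qed.

Lemma vand_lam F w : w \in F -> vand (F :\ w) = vand F * lam F w.
Proof. by move=> wF; rewrite (vandD1 wF) /lam wF mulfK ?node_neq0. Qed.

(** Interpolation at the nodes of F reproduces p; compare coefficients in degree [#|F|.-1]. *)
Lemma lagrange F (p : {poly K}) : (0 < #|F|)%N -> (size p <= #|F|)%N ->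
  \sum_(v in F) p.[t v] * lam F v = p`_(#|F|.-1).
Proof.
move=> F0 szp.
pose L v : {poly K} := \prod_(u <- enum (F :\ v)) ('X - (t u)%:P).
have szL v : v \in F -> size (L v) = #|F|.
  by move=> vF; rewrite size_prod_XsubC -cardE (cardsD1 v F) vF.
have cL v : v \in F -> (L v)`_(#|F|.-1) = 1.
  by move=> vF; rewrite -(szL v vF); apply/monicP/monic_prod_XsubC.
have evL v x : (L v).[x] = \prod_(u in F :\ v) (x + t u).
  rewrite horner_prod big_enum; apply: eq_bigr => u _.
  by rewrite hornerXsubC oppr_pchar2.
pose r := \sum_(v in F) (p.[t v] * lam F v) *: L v.
have rE w : w \in F -> r.[t w] = p.[t w].
  move=> wF; rewrite horner_sum (bigD1 w) //= big1 ?addr0.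
    by rewrite hornerZ evL -mulrA /lam wF mulVf ?mulr1 // node_neq0.
  move=> v /andP[vF vw]; rewrite hornerZ evL (big_setD1 w) /=.
    by rewrite addrr_pchar2 // mul0r mulr0.
  by rewrite !inE eq_sym vw.
have szr : (size r <= #|F|)%N.
  apply: leq_trans (size_sum _ _ _) _; apply/bigmax_leqP => v vF.
  by apply: leq_trans (size_scale_leq _ _) _; rewrite szL.
have -> : p = r.
  apply/eqP; rewrite -subr_eq0; apply/eqP.
  apply: (@roots_geq_poly_eq0 _ _ [seq t v | v <- enum F]).
  - apply/allP => _ /mapP[v vF ->]; rewrite rootE hornerD hornerN rE ?subrr //.
    by rewrite mem_enum in vF.
  - by rewrite map_inj_uniq ?enum_uniq.
  rewrite size_map -cardE; apply: leq_trans (size_polyD _ _) _.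
  by rewrite size_polyN geq_max szp szr.
rewrite coef_sum; apply: eq_bigr => v vF.
by rewrite coefZ cL // mulr1 -/r rE.
Qed.

Lemma lagrangeX F j : (j < #|F|)%N ->
  \sum_(v in F) t v ^+ j * lam F v = (j == #|F|.-1)%:R.
Proof.
move=> jF; have F0 : (0 < #|F|)%N by apply: leq_ltn_trans jF.
have := @lagrange F 'X^j F0; rewrite size_polyXn coefXn eq_sym => <- //.
by apply: eq_bigr => v _; rewrite hornerXn.
Qed.

(** Subtracting the root polynomial of F from the power keeps the values on F and lowers the degree,
    so [lagrange] reads off the first elementary symmetric function. *)
Lemma lagrange_e1 F : (0 < #|F|)%N ->
  \sum_(v in F) t v ^+ #|F| * lam F v = \sum_(v in F) t v.
Proof.
move=> F0; pose s := [seq t v | v <- enum F].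
pose p : {poly K} := 'X^#|F| - \prod_(c <- s) ('X - c%:P).
have szs : size s = #|F| by rewrite size_map -cardE.
have szp : (size p <= #|F|)%N.
  apply/leq_sizeP => j; rewrite leq_eqVlt coefB coefXn => /predU1P[<-|jF].
    have /monicP : \prod_(c <- s) ('X - c%:P) \is monic by apply: monic_prod_XsubC.
    by rewrite lead_coefE size_prod_XsubC /= szs eqxx => ->; rewrite subrr.
  rewrite (gtn_eqF jF) nth_default ?subrr // size_prod_XsubC szs //.
have := lagrange F0 szp.
rewrite coefB coefXn -[X in _ == X](prednK F0) (ltn_eqF (ltnSn _)) sub0r.
have -> : - (\prod_(c <- s) ('X - c%:P))`_#|F|.-1 = \sum_(v in F) t v.
  have := @coefPn_prod_XsubC _ s; rewrite szs => -> //; last by rewrite -lt0n.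
  by rewrite opprK big_map big_enum.
move=> <-; apply: eq_bigr => v vF; rewrite /p hornerD hornerN hornerXn.
suff -> : (\prod_(c <- s) ('X - c%:P)).[t v] = 0 by rewrite subr0.
by apply/rootP; rewrite root_prod_XsubC; apply: map_f; rewrite mem_enum.
Qed.

(* Splitting the Leibniz expansion of the Vandermonde determinant according to
   the parity of the exponents; in characteristic 2 the two remaining
   alternants are squares. *)
Definition splitsum k N : K :=
  \sum_(Q : {set T} | (Q \subset N) && (#|Q| == k))
    mono Q * (vand Q * vand (N :\: Q)) ^+ 2.

End Vandermonde.

Section Split.
Variables (K : fieldType) (char2 : 2%N \in [pchar K]).
Variables (T : finType) (t : T -> K) (tI : injective t).
Implicit Types (F G J Q N : {set T}) (u v w : T).

Local Notation mono := (mono t).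
Local Notation vand := (vand t).

Definition rootpoly Q : {poly K} := \prod_(c <- [seq t v | v <- enum Q]) ('X - c%:P).

Lemma horner_rootpoly Q x : (rootpoly Q).[x] = \prod_(u in Q) (x + t u).
Proof.
rewrite /rootpoly horner_prod big_map big_enum; apply: eq_bigr => u _.
by rewrite hornerXsubC oppr_pchar2.
Qed.

Lemma size_rootpoly Q : size (rootpoly Q) = #|Q|.+1.
Proof. by rewrite size_prod_XsubC size_map -cardE. Qed.

Lemma rootpoly_monic Q : rootpoly Q \is monic.
Proof. exact: monic_prod_XsubC. Qed.

Lemma rootpoly_e1 Q k : #|Q| = k.+1 -> (rootpoly Q)`_k = \sum_(v in Q) t v.
Proof.
move=> cQ; have := @coefPn_prod_XsubC _ [seq t v | v <- enum Q].
rewrite size_map -cardE cQ => -> //=.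
by rewrite big_map big_enum oppr_pchar2.
Qed.

(** The derivative of a square vanishes in characteristic 2. *)
Lemma coef_sqr_odd (p : {poly K}) j : (p ^+ 2)`_j.*2.+1 = 0.
Proof.
have := coef_deriv (p ^+ 2) j.*2.
rewrite expr2 derivM [p^`() * p]mulrC coefD addrr_pchar2 //.
rewrite -mulr_natr -natr1 -mul2n natrM (pcharf0 char2) mul0r add0r mulr1.
by move=> <-.
Qed.

Lemma size_sqr_rootpoly Q : size (rootpoly Q ^+ 2) = (#|Q|.*2).+1.
Proof.
rewrite expr2 size_monicM ?rootpoly_monic ?monic_neq0 ?rootpoly_monic //.
by rewrite size_rootpoly addnS addSn /= addnn.
Qed.

Lemma lead_sqr_rootpoly Q k : #|Q| = k -> (rootpoly Q ^+ 2)`_k.*2 = 1.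
Proof.
move=> cQ; have /monicP : rootpoly Q ^+ 2 \is monic by rewrite monic_exp ?rootpoly_monic.
by rewrite lead_coefE size_sqr_rootpoly cQ.
Qed.

Let cf N Q : K := mono Q * (vand Q * vand (N :\: Q)) ^+ 2.

(** [splitsum t k.+1] of N with one more vertex, as a polynomial in its coordinate: the first sum
    collects the Q that avoid the new vertex, the second those that contain it. *)
Definition splitpoly k N : {poly K} :=
  \sum_(Q : {set T} | (Q \subset N) && (#|Q| == k.+1)) cf N Q *: rootpoly (N :\: Q) ^+ 2
  + \sum_(Q : {set T} | (Q \subset N) && (#|Q| == k)) cf N Q *: ('X * rootpoly Q ^+ 2).

Lemma monoU1 w Q : w \notin Q -> mono (w |: Q) = t w * mono Q.
Proof. by move=> wQ; rewrite /mono big_setU1. Qed.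

Lemma sub_setU1_notin w N Q : w \notin N ->
  (Q \subset w |: N) && (w \notin Q) = (Q \subset N).
Proof.
move=> wN; apply/andP/idP => [[/subsetP QN wQ]|QN].
  apply/subsetP => x xQ; move: (QN x xQ); rewrite !inE => /orP[/eqP xw|//].
  by rewrite -xw xQ in wQ.
split; first by apply: subset_trans QN _; apply: subsetUr.
by apply: contra wN => /(subsetP QN).
Qed.

Lemma reindex_setU1 (R : nmodType) w N k (f : {set T} -> R) : w \notin N ->
  \sum_(Q : {set T} | [&& Q \subset w |: N, #|Q| == k.+1 & w \in Q]) f Q =
  \sum_(Q : {set T} | (Q \subset N) && (#|Q| == k)) f (w |: Q).
Proof.
move=> wN; rewrite (reindex_onto (fun Q => w |: Q) (fun Q => Q :\ w)) /=; last first.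
  by move=> Q /and3P[_ _ wQ]; rewrite setD1K.
apply: eq_bigl => Q; rewrite setU11 andbT.
have [wQ|wQ] := boolP (w \in Q).
  transitivity false.
    apply/negbTE; rewrite negb_and orbC; apply/orP; left.
    by apply: contraTneq wQ => <-; rewrite !inE eqxx.
  apply/esym/negbTE; rewrite negb_and; apply/orP; left.
  by apply: contra wN => /subsetP /(_ w wQ).
rewrite setU1K // eqxx andbT cardsU1 wQ add1n eqSS; congr (_ && _).
rewrite -(sub_setU1_notin Q wN) wQ andbT subUset sub1set setU11 //.
Qed.

Lemma splitsumU1 k N w : w \notin N ->
  splitsum t k.+1 (w |: N) = (splitpoly k N).[t w].
Proof.
move=> wN; rewrite /splitsum (bigID (fun Q : {set T} => w \in Q)) /= addrC.
rewrite hornerD !horner_sum; congr (_ + _).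
  apply: eq_big => [Q|Q /andP[/andP[QN _] wQ]].
    by rewrite andbAC sub_setU1_notin.
  have -> : (w |: N) :\: Q = w |: (N :\: Q).
    by apply/setP => x; rewrite !inE; case: eqVneq => [->|]; rewrite ?wQ.
  rewrite vandU1; last by rewrite !inE (negPf wN) andbF.
  by rewrite hornerZ horner_exp horner_rootpoly /cf; ring.
under eq_bigl => Q do rewrite -andbA.
rewrite reindex_setU1 //; apply: eq_bigr => Q /andP[QN _].
have wQ : w \notin Q by apply: contra wN => /(subsetP QN).
have -> : (w |: N) :\: (w |: Q) = N :\: Q.
  by apply/setP => x; rewrite !inE; case: eqVneq => [->|]; rewrite ?(negPf wN) ?andbF.
rewrite vandU1 // monoU1 // hornerZ hornerM hornerX horner_exp horner_rootpoly /cf; ring.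
Qed.

(** The surviving terms have u in Q in the first sum and u outside Q in the second; moving u across
    the partition matches them in equal pairs. *)
Lemma splitpoly_root k N u : u \in N -> (splitpoly k N).[t u] = 0.
Proof.
move=> uN; rewrite hornerD !horner_sum.
rewrite (bigID (fun Q : {set T} => u \in Q)) /= [X in _ + X + _]big1 ?addr0; last first.
  move=> Q /andP[/andP[QN _] uQ]; rewrite hornerZ horner_exp horner_rootpoly.
  rewrite (bigD1 u) /=; last by rewrite !inE uQ.
  by rewrite addrr_pchar2 // mul0r expr0n mulr0.
rewrite [X in _ + X](bigID (fun Q : {set T} => u \in Q)) /= [X in _ + (X + _)]big1 ?add0r; last first.
  move=> Q /andP[_ uQ]; rewrite hornerZ hornerM horner_exp horner_rootpoly.
  by rewrite (bigD1 u) //= addrr_pchar2 // mul0r expr0n !mulr0.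
rewrite -{1 2}(setD1K uN); under eq_bigl => Q do rewrite -andbA.
rewrite reindex_setU1 ?setD11 //.
rewrite [X in _ + X](eq_bigl (fun Q : {set T} => (Q \subset N :\ u) && (#|Q| == k))); last first.
  by move=> Q; rewrite -[N in LHS](setD1K uN) andbAC sub_setU1_notin ?setD11.
rewrite -big_split big1 //= => Q /andP[QN _].
have uQ : u \notin Q by apply/negP => /(subsetP QN); rewrite setD11.
have e1 : N :\: Q = u |: (N :\: (u |: Q)).
  by apply/setP => x; rewrite !inE; case: eqVneq => [->|]; rewrite ?uQ ?uN.
rewrite !hornerZ [('X * _).[_]]hornerM hornerX !horner_exp !horner_rootpoly /cf e1.
rewrite vandU1 // monoU1 // vandU1; last by rewrite !inE eqxx.
rewrite setD1K // -[X in _ = X](addrr_pchar2 char2 0) ?addr0.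
set a := \prod_(_ in Q) _; set b := \prod_(_ in N :\: _) _.
apply/eqP; rewrite add2_eq0 //; apply/eqP; ring.
Qed.

Lemma splitpolyE k N c : (size (splitpoly k N) <= #|N|.+1)%N ->
  (splitpoly k N)`_#|N| = c -> splitpoly k N = c *: rootpoly N.
Proof.
move=> szs cs; apply/eqP; rewrite -subr_eq0; apply/eqP.
apply: (@roots_geq_poly_eq0 _ _ [seq t v | v <- enum N]).
- apply/allP => _ /mapP[u uN ->]; rewrite mem_enum in uN.
  rewrite rootE hornerD hornerN splitpoly_root // hornerZ horner_rootpoly.
  by rewrite (bigD1 u) //= addrr_pchar2 // mul0r mulr0 subrr.
- by rewrite map_inj_uniq ?enum_uniq.
rewrite size_map -cardE; apply/leq_sizeP => j.
rewrite leq_eqVlt coefB coefZ => /predU1P[<-|jN].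
  have /monicP := rootpoly_monic N; rewrite lead_coefE size_rootpoly /= => ->.
  by rewrite cs mulr1 subrr.
by rewrite !nth_default ?size_rootpoly ?mulr0 ?subrr // (leq_trans szs).
Qed.

Lemma size_splitpoly k N m : (#|N| <= k.+1 + m)%N -> (m.*2 <= #|N|)%N -> (k.*2.+1 <= #|N|)%N ->
  (size (splitpoly k N) <= #|N|.+1)%N.
Proof.
move=> cN mN kN; apply: leq_trans (size_polyD _ _) _; rewrite geq_max; apply/andP; split;
  apply: leq_trans (size_sum _ _ _) _; apply/bigmax_leqP => Q /andP[QN /eqP cQ];
  apply: leq_trans (size_scale_leq _ _) _.
  rewrite size_sqr_rootpoly cardsD (setIidPr QN) cQ ltnS.
  by apply: leq_trans mN; rewrite leq_double leq_subLR.
apply: leq_trans (size_polyMleq _ _) _.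
by rewrite size_polyX size_sqr_rootpoly cQ /=.
Qed.

(** Squares have no odd coefficients, so for odd [#|N|] only the second sum reaches the leading
    coefficient, which is [splitsum t k N]; for even [#|N|] the two sums exchange roles. *)
Lemma split_odd_step k N : #|N| = k.*2.+1 -> splitsum t k N = vand N ->
  splitpoly k N = vand N *: rootpoly N.
Proof.
move=> cN sN; apply: splitpolyE.
  apply: (@size_splitpoly _ _ k); rewrite ?cN //; last by rewrite -addnn addSn.
rewrite coefD !coef_sum cN big1 ?add0r; last first.
  move=> Q _; by rewrite coefZ coef_sqr_odd mulr0.
rewrite -sN; apply: eq_bigr => Q /andP[_ /eqP cQ].
by rewrite coefZ coefXM /= lead_sqr_rootpoly // mulr1.
Qed.

Lemma split_even_step k N : #|N| = k.+1.*2 -> splitsum t k.+1 N = vand N ->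
  splitpoly k N = vand N *: rootpoly N.
Proof.
move=> cN sN; apply: splitpolyE.
  apply: (@size_splitpoly _ _ k.+1); rewrite ?cN //; first by rewrite -addnn.
rewrite coefD !coef_sum cN [X in _ + X]big1 ?addr0; last first.
  by move=> Q _; rewrite coefZ coefXM /= ?doubleS /= coef_sqr_odd mulr0.
rewrite -sN; apply: eq_bigr => Q /andP[QN /eqP cQ].
rewrite coefZ lead_sqr_rootpoly ?mulr1 //.
by rewrite cardsD (setIidPr QN) cQ cN -addnn addnK.
Qed.

Lemma split_vand k N : (#|N| = k.*2 \/ #|N| = k.*2.+1) -> splitsum t k N = vand N.
Proof.
have [m] := ubnP #|N|; elim: m N k => // m IH N k; rewrite ltnS => leN.
(* With k = 0 only the empty Q occurs, and the square is harmless as N then has at most one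
   element. *)
have base : k = 0%N -> splitsum t k N = vand N ^+ 2.
  move=> ->; rewrite /splitsum (big_pred1 set0).
    by rewrite /mono big_set0 vand0 !mul1r setD0.
  by move=> Q /=; rewrite cards_eq0 andbC; case: (Q =P set0) => [->|_]; rewrite ?sub0set ?eqxx.
case=> cN.
  case: k cN base => [|k] cN base.
    by rewrite base //; move/eqP: cN; rewrite cards_eq0 => /eqP->; rewrite vand0 expr1n.
  have /card_gt0P[w wN] : (0 < #|N|)%N by rewrite cN doubleS.
  have cN' : #|N :\ w| = k.*2.+1 by move: cN; rewrite (cardsD1 w) wN add1n doubleS => -[].
  rewrite -(setD1K wN) splitsumU1 ?setD11 // split_odd_step //.
    by rewrite hornerZ horner_rootpoly vandU1 ?setD11.
  apply: IH; last by right.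
  by apply: leq_trans leN; rewrite [X in (_ < X)%N](cardsD1 w) wN.
have /card_gt0P[w wN] : (0 < #|N|)%N by rewrite cN.
have cN' : #|N :\ w| = k.*2 by move: cN; rewrite (cardsD1 w) wN add1n => -[].
case: k cN cN' base => [|k] cN cN' base.
  have N1 : N = w |: set0.
    by move/eqP: cN'; rewrite cards_eq0 => /eqP N0; rewrite -(setD1K wN) N0.
  by rewrite base // N1 vandU1 ?inE // vand0 big_set0 mulr1 expr1n.
rewrite -(setD1K wN) splitsumU1 ?setD11 // split_even_step //.
  by rewrite hornerZ horner_rootpoly vandU1 ?setD11.
apply: IH; last by left.
by apply: leq_trans leN; rewrite [X in (_ < X)%N](cardsD1 w) wN.
Qed.

(** In [split_odd_step], compare the coefficients just below the top: the degree 2k is even, so only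
    the first sum contributes. *)
Lemma split_e1_vand k N : #|N| = k.*2.+1 ->
  splitsum t k.+1 N = (\sum_(v in N) t v) * vand N.
Proof.
move=> cN; have sN : splitsum t k N = vand N by apply: split_vand; right.
have := congr1 (fun p : {poly K} => p`_k.*2) (split_odd_step cN sN).
rewrite /= coefZ (rootpoly_e1 cN) coefD !coef_sum [X in _ + X]big1 ?addr0; last first.
  move=> Q _; rewrite coefZ coefXM; case: (k) => [|k']; first by rewrite mulr0.
  by rewrite doubleS /= coef_sqr_odd mulr0.
rewrite mulrC => <-; apply: eq_bigr => Q /andP[QN /eqP cQ].
rewrite coefZ lead_sqr_rootpoly ?mulr1 //.
by rewrite cardsD (setIidPr QN) cQ cN -addnn subSS addnK.
Qed.

End Split.

(** * The degree map and anisotropy *)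

Section Poly.
Variables (K : fieldType) (T : finType).
Local Notation P := {mpoly K[#|T|]}.
Implicit Types (p q f g : P) (F G : {set T}) (u v w : T) (m : 'X_{1..#|T|}).

Definition xv v : P := 'X_(enum_rank v).

Definition psubst (h : T -> P) p : P := p \mPo [tuple h (enum_val i) | i < #|T|].

HB.instance Definition _ h := GRing.RMorphism.copy (psubst h) (comp_mpoly [tuple h (enum_val i) | i < #|T|]).
HB.instance Definition _ h := GRing.Linear.copy (psubst h) (comp_mpoly [tuple h (enum_val i) | i < #|T|]).

Definition peval (l : T -> K) p : K := p.@[fun i => l (enum_val i)].

HB.instance Definition _ l := GRing.RMorphism.copy (peval l) (meval (fun i => l (enum_val i))).
HB.instance Definition _ l := GRing.Linear.copy (peval l) (meval (fun i => l (enum_val i))).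

Lemma peval_xv l v : peval l (xv v) = l v.
Proof. by rewrite /peval mevalXU enum_rankK. Qed.

Lemma pevalZ l c p : peval l (c *: p) = c * peval l p.
Proof. exact: mevalZ. Qed.

Lemma peval_ext l1 l2 p : l1 =1 l2 -> peval l1 p = peval l2 p.
Proof. by move=> e; apply: meval_eq => i; apply: e. Qed.

Lemma psubst_xv h v : psubst h (xv v) = h v.
Proof. by rewrite /psubst comp_mpolyXU -tnth_nth tnth_mktuple enum_rankK. Qed.

Lemma psubstZ h c p : psubst h (c *: p) = c *: psubst h p.
Proof. exact: comp_mpolyZ. Qed.

Lemma peval_subst l h p : peval l (psubst h p) = peval (fun v => peval l (h v)) p.
Proof. by rewrite /peval /psubst comp_mpoly_meval; apply: meval_eq => i; rewrite tnth_mktuple. Qed.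

Definition mexp m v : nat := m (enum_rank v).
Definition msup m : {set T} := [set v | mexp m v != 0%N].

Lemma mpolyX_xv m : 'X_[m] = \prod_v xv v ^+ mexp m v :> P.
Proof.
rewrite mpolyXE_id (reindex (@enum_rank T)) //=.
by exists enum_val => i _; rewrite ?enum_rankK ?enum_valK.
Qed.

Lemma mdeg_mexp m : mdeg m = (\sum_v mexp m v)%N.
Proof.
rewrite mdegE (reindex (@enum_rank T)) //=.
by exists enum_val => i _; rewrite ?enum_rankK ?enum_valK.
Qed.

Lemma peval_X l m : peval l 'X_[m] = \prod_v l v ^+ mexp m v.
Proof.
rewrite mpolyX_xv rmorph_prod; apply: eq_bigr => v _.
by rewrite rmorphXn /= peval_xv.
Qed.

Lemma psubst_X h m : psubst h 'X_[m] = \prod_v h v ^+ mexp m v.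
Proof.
rewrite mpolyX_xv rmorph_prod; apply: eq_bigr => v _.
by rewrite rmorphXn /= psubst_xv.
Qed.

Lemma mpoly_lin_ind (Q : P -> Prop) :
  (forall p q, Q p -> Q q -> Q (p + q)) -> (forall c p, Q p -> Q (c *: p)) -> Q 0 ->
  forall p, (forall m, m \in msupp p -> Q 'X_[m]) -> Q p.
Proof.
move=> QD QZ Q0 p Qm; rewrite (mpolyE p) big_seq; elim/big_ind: _ => // m mp.
by apply: QZ; apply: Qm.
Qed.

Lemma homog_ind n (Q : P -> Prop) :
  (forall p q, Q p -> Q q -> Q (p + q)) -> (forall c p, Q p -> Q (c *: p)) -> Q 0 ->
  (forall m, mdeg m = n -> Q 'X_[m]) ->
  forall p, p \is n.-homog -> Q p.
Proof.
move=> QD QZ Q0 Qm p /dhomogP hp; apply: mpoly_lin_ind => // m /hp; exact: Qm.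
Qed.

Lemma psubst_comp h1 h2 p : psubst h1 (psubst h2 p) = psubst (fun v => psubst h1 (h2 v)) p.
Proof.
apply: (@mpoly_lin_ind (fun p => psubst h1 (psubst h2 p) = psubst (fun v => psubst h1 (h2 v)) p)).
- by move=> a b ea eb; rewrite !rmorphD /= ea eb.
- by move=> c a ea; rewrite !psubstZ ea.
- by rewrite !rmorph0.
move=> m _; rewrite !psubst_X rmorph_prod; apply: eq_bigr => v _.
by rewrite rmorphXn.
Qed.

Lemma psubst_ext h1 h2 p : h1 =1 h2 -> psubst h1 p = psubst h2 p.
Proof.
move=> e; rewrite /psubst; congr comp_mpoly.
by apply/eq_from_tnth => i; rewrite !tnth_mktuple e.
Qed.

Lemma xv_homog v : xv v \is 1.-homog.
Proof. by rewrite /xv dhomogX /= mdeg1. Qed.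

Lemma psubst_homog h n p : (forall v, h v \is 1.-homog) -> p \is n.-homog ->
  psubst h p \is n.-homog.
Proof.
move=> hh; apply: (@homog_ind n (fun p => psubst h p \is n.-homog)).
- by move=> a b ea eb; rewrite rmorphD rpredD.
- by move=> c a ea; rewrite psubstZ rpredZ.
- by rewrite rmorph0 rpred0.
move=> m <-; rewrite psubst_X mdeg_mexp.
elim/big_rec2: _ => [|v k a _ ha]; first exact: dhomog1.
by apply: dhomogM => //; rewrite -[X in X.-homog]mul1n; apply: dhomogMn.
Qed.

Definition restr F : P -> P := psubst (fun v => if v \in F then xv v else 0).

HB.instance Definition _ F := GRing.RMorphism.copy (restr F) (psubst (fun v => if v \in F then xv v else 0)).
HB.instance Definition _ F := GRing.Linear.copy (restr F) (psubst (fun v => if v \in F then xv v else 0)).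

Lemma restr_xv F v : restr F (xv v) = if v \in F then xv v else 0.
Proof. exact: psubst_xv. Qed.

Lemma restrZ F c p : restr F (c *: p) = c *: restr F p.
Proof. exact: psubstZ. Qed.

Lemma restrX F m : restr F 'X_[m] = if msup m \subset F then 'X_[m] else 0.
Proof.
rewrite /restr psubst_X; case: ifP => [/subsetP sF|/negbT/subsetPn[v vm vF]].
  rewrite mpolyX_xv; apply: eq_bigr => v _.
  case: ifP => // /negbT vF; have : v \notin msup m by apply: contra vF; apply: sF.
  by rewrite inE negbK => /eqP->; rewrite !expr0.
by rewrite (bigD1 v) //= (negPf vF) expr0n; move: vm; rewrite inE => /negPf->; rewrite mul0r.
Qed.

Lemma restrE F p m : (restr F p)@_m = if msup m \subset F then p@_m else 0.
Proof.
apply: (@mpoly_lin_ind (fun p => (restr F p)@_m = if msup m \subset F then p@_m else 0)).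
- by move=> a b ea eb; rewrite rmorphD !mcoeffD ea eb; case: ifP; rewrite ?addr0.
- by move=> c a ea; rewrite restrZ !mcoeffZ ea; case: ifP; rewrite ?mulr0.
- by rewrite rmorph0 mcoeff0 if_same.
move=> m' _; rewrite restrX mcoeffX; have [->|ne] := eqVneq m' m.
  by case: ifP; rewrite ?mcoeffX ?eqxx ?mcoeff0.
by case: ifP => _; rewrite ?if_same // ?mcoeffX ?(negPf ne) ?mcoeff0 ?if_same.
Qed.

Lemma restr_sub F G p : F \subset G -> restr F (restr G p) = restr F p.
Proof.
move=> FG; apply/mpolyP => m; rewrite !restrE; case: ifP => // mF.
by rewrite (subset_trans mF FG).
Qed.

Lemma restr_eq_sub F G p q : F \subset G -> restr G p = restr G q -> restr F p = restr F q.
Proof. by move=> FG e; rewrite -(restr_sub p FG) e restr_sub. Qed.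

Lemma peval_restr F l p : (forall v, v \notin F -> l v = 0) ->
  peval l (restr F p) = peval l p.
Proof.
move=> l0; rewrite /restr peval_subst; apply: peval_ext => v.
by case: ifP => [|/negbT vF]; rewrite ?peval_xv // rmorph0 l0.
Qed.

Definition xset G : P := \prod_(v in G) xv v.

Lemma xset_homog G : xset G \is #|G|.-homog.
Proof.
rewrite /xset -sum1_card; elim/big_rec2: _ => [|v k a _ ha]; first exact: dhomog1.
by apply: dhomogM => //; apply: xv_homog.
Qed.

Lemma peval_xset l G : peval l (xset G) = \prod_(v in G) l v.
Proof. by rewrite rmorph_prod; apply: eq_bigr => v _ /=; rewrite peval_xv. Qed.

Variable t : T -> K.

Definition theta j : P := \sum_v t v ^+ j *: xv v.

Lemma theta_homog j : theta j \is 1.-homog.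
Proof. by apply: rpred_sum => v _; apply: rpredZ; apply: xv_homog. Qed.

Lemma peval_theta l j : peval l (theta j) = \sum_v t v ^+ j * l v.
Proof. by rewrite rmorph_sum; apply: eq_bigr => v _ /=; rewrite pevalZ peval_xv. Qed.

End Poly.

(* Linear independence over K ^+ 2 of the squarefree monomials in t. *)
Definition ind2 (K : fieldType) (T : finType) (t : T -> K) : Prop :=
  forall c : {set T} -> K, \sum_Q c Q ^+ 2 * mono t Q = 0 -> forall Q, c Q = 0.

Section Degree.
Variables (K : fieldType) (char2 : 2%N \in [pchar K]).
Variables (T : finType) (t : T -> K).
Local Notation P := {mpoly K[#|T|]}.
Local Notation vand := (vand t).
Local Notation lam := (lam t).
Implicit Types (p q f : P) (F G J Q : {set T}) (D : {set {set T}}) (c : {set T} -> P).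

Lemma ind2_inj : ind2 t -> injective t.
Proof.
move=> t2 u v tuv; apply/eqP/negPn/negP => uv.
pose c (Q : {set T}) : K := ((Q == [set u]) || (Q == [set v]))%:R.
have uv1 : [set u] != [set v].
  by apply: contraNneq uv => /setP /(_ u); rewrite !inE eqxx => /esym/eqP->.
have : c [set u] = 0.
  apply: t2; rewrite (bigD1 [set u]) //= (bigD1 [set v]) 1?eq_sym //= big1.
    rewrite /c !eqxx orbT expr1n !mul1r /mono !big_set1 tuv addr0 addrr_pchar2 //.
  by move=> Q /andP[/negPf Qu /negPf Qv]; rewrite /c Qu Qv expr0n mul0r.
by rewrite /c eqxx => /eqP; rewrite oner_eq0.
Qed.

Hypothesis tI : injective t.

Lemma lam_out F v : v \notin F -> lam F v = 0.
Proof. by rewrite /lam => /negPf->. Qed.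

Lemma theta_lam F j : (j < #|F|)%N ->
  peval (lam F) (theta t j) = (j == #|F|.-1)%:R.
Proof.
move=> jF; rewrite peval_theta -(lagrangeX char2 tI jF) [RHS]big_mkcond /=.
by apply: eq_bigr => v _; case: ifP => // /negbT vF; rewrite lam_out ?mulr0.
Qed.

Lemma theta_lam_e1 F : (0 < #|F|)%N ->
  peval (lam F) (theta t #|F|) = \sum_(v in F) t v.
Proof.
move=> F0; rewrite peval_theta -(lagrange_e1 char2 tI F0) [RHS]big_mkcond /=.
by apply: eq_bigr => v _; case: ifP => // /negbT vF; rewrite lam_out ?mulr0.
Qed.

(* Both sides are Lagrange interpolation sums because
   [lam (F :\ w) = (t + t w) lam F] and [vand (F :\ w) = vand F * lam F w]. *)
Lemma vand_boundary F p : (0 < #|F|)%N -> p \is #|F|.-1.-homog ->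
  vand F * peval (lam F) p = \sum_(w in F) vand (F :\ w) * peval (lam (F :\ w)) p.
Proof.
move=> F0; apply: (@homog_ind _ _ _ (fun p => vand F * peval (lam F) p =
  \sum_(w in F) vand (F :\ w) * peval (lam (F :\ w)) p)).
- by move=> a b ea eb; rewrite rmorphD mulrDr ea eb -big_split;
    apply: eq_bigr => w _; rewrite rmorphD mulrDr.
- by move=> c a ea; rewrite pevalZ mulrCA ea mulr_sumr;
    apply: eq_bigr => w _; rewrite pevalZ mulrCA.
- by rewrite rmorph0 mulr0 big1 // => w _; rewrite rmorph0 mulr0.
move=> m dm; pose phi : {poly K} := \prod_v ('X - (t v)%:P) ^+ mexp m v.
have [phim sphi] : phi \is monic /\ size phi = #|F|.
  rewrite -(prednK F0) -dm mdeg_mexp /phi.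
  elim/big_rec2: _ => [|v q k _ [mq sq]]; first by rewrite monic1 size_poly1.
  rewrite monicMl ?monic_exp ?monicXsubC // size_monicM ?monic_exp ?monicXsubC ?monic_neq0 //.
  by rewrite size_exp_XsubC sq; split=> //; rewrite addnS.
transitivity (vand F * peval (lam F) 'X_[m] * \sum_(w in F) phi.[t w] * lam F w).
  rewrite lagrange ?sphi // -[in X in _`_X]sphi -lead_coefE (monicP phim).
  by rewrite mulr1.
rewrite mulr_sumr; apply: eq_bigr => w wF.
rewrite vand_lam // !peval_X /phi horner_prod.
under [X in _ = _ * X]eq_bigr do rewrite lamD1 // exprMn.
rewrite big_split /=.
have -> : \prod_v (('X - (t v)%:P) ^+ mexp m v).[t w] = \prod_v (t v + t w) ^+ mexp m v.
  by apply: eq_bigr => v _; rewrite horner_exp hornerXsubC oppr_pchar2 // addrC.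
ring.
Qed.

(* Lee's formula for the fundamental class of the quotient of the face ring by
   theta_0, ..., theta_(s-1): in the moment-curve coordinates a facet F contributes
   the value at [lam F].  A chain c allows a different polynomial on every face. *)
Definition dg D s c : K :=
  \sum_(F in D | #|F| == s) vand F * peval (lam F) (c F).

(** The boundary of the complex whose terms are the sums of the rings K[F] over the faces F of a
    given size, without signs in characteristic 2; the projection to K[G] is left to [restr G]. *)
Definition bd D s c : {set T} -> P := fun G =>
  \sum_(F in D | (#|F| == s) && (G \subset F)) c F.

Definition downset D : Prop := forall F G, F \in D -> G \subset F -> G \in D.

Lemma dg_bd D s c : downset D -> (0 < s)%N ->
  (forall F, F \in D -> #|F| = s -> c F \is s.-1.-homog) ->
  dg D s c = dg D s.-1 (bd D s c).
Proof.
move=> dD s0 hc; rewrite /dg.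
pose g F G := vand G * peval (lam G) (c F).
transitivity (\sum_(F in D | #|F| == s) \sum_(G in D | (#|G| == s.-1) && (G \subset F)) g F G).
  apply: eq_bigr => F /andP[FD /eqP cF].
  rewrite vand_boundary ?cF ?hc // -[LHS](big_imset (fun G => g F G) (h := fun w => F :\ w)).
    apply: eq_bigl => G; apply/imsetP/andP => [[w wF ->]|[GD /andP[/eqP cG GF]]].
      split; first by apply: dD FD _; apply: subsetDl.
      by rewrite subsetDl andbT -cF (cardsD1 w F) wF.
    have /cards1P[w Gw] : #|F :\: G| == 1%N.
      rewrite cardsD (setIidPr GF) cF cG -[s in X in X == _]prednK //.
      by rewrite subSn // subnn.
    have wG : w \in F :\: G by rewrite Gw set11.
    exists w; first by move: wG; rewrite inE => /andP[].
    by rewrite -Gw setDDr setDv set0U (setIidPr GF).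
  move=> w w' wF w'F /setP /(_ w); rewrite !inE eqxx wF andbT /=.
  by rewrite andbT => e; apply/eqP/negbNE; rewrite -e.
rewrite (exchange_big_dep (fun G => (G \in D) && (#|G| == s.-1))) /=; last first.
  by move=> F G _ /and3P[-> ->].
apply: eq_bigr => G /andP[GD cG]; rewrite rmorph_sum mulr_sumr.
by apply: eq_bigl => F; rewrite GD cG /= andbA.
Qed.

Definition even_ridges d D : Prop :=
  forall G, G \in D -> #|G|.+1 = d -> ~~ odd #|[set F in D | (#|F| == d) && (G \subset F)]|.

(** At a ridge the boundary of the constant chain p is an even multiple of p. *)
Lemma dg_low d D p : downset D -> even_ridges d D -> (0 < d)%N -> p \is d.-1.-homog ->
  dg D d (fun _ => p) = 0.
Proof.
move=> dD eD d0 hp; rewrite dg_bd // /dg big1 // => G /andP[GD /eqP cG].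
have -> : bd D d (fun _ => p) G = p *+ #|[set F in D | (#|F| == d) && (G \subset F)]|.
  by rewrite -sumr_const; apply: eq_bigl => F; rewrite inE.
rewrite rmorphMn /= -(odd_double_half #|_|) (negPf (eD G GD _)) ?cG ?prednK // add0n.
by rewrite -mul2n mulrnA mulr2n addrr_pchar2 // mul0rn mulr0.
Qed.

(** The value of [theta t j] at [lam F] is the same constant for all facets F, so it factors out and
    [dg_low] applies. *)
Lemma dg_theta d D p j : downset D -> even_ridges d D -> (j < d)%N -> p \is d.-1.-homog ->
  dg D d (fun _ => theta t j * p) = 0.
Proof.
move=> dD eD jd hp; rewrite -[RHS](mulr0 (j == d.-1)%:R).
have d0 : (0 < d)%N by apply: leq_ltn_trans jd.
rewrite -[in RHS](dg_low dD eD d0 hp) /dg mulr_sumr.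
apply: eq_bigr => F /andP[_ /eqP cF]; rewrite rmorphM /= theta_lam ?cF //.
by rewrite mulrCA.
Qed.

Lemma dgD D s c c' : dg D s (fun F => c F + c' F) = dg D s c + dg D s c'.
Proof.
rewrite /dg -big_split; apply: eq_bigr => F _; by rewrite rmorphD mulrDr.
Qed.

Lemma dgZ D s a c : dg D s (fun F => a *: c F) = a * dg D s c.
Proof.
by rewrite /dg mulr_sumr; apply: eq_bigr => F _; rewrite pevalZ mulrCA.
Qed.

Lemma dg_xset D s p J : dg D s (fun _ => p * xset K J) =
  \sum_(F in D | (#|F| == s) && (J \subset F)) vand (F :\: J) / vand J * peval (lam F) p.
Proof.
rewrite /dg [LHS](bigID (fun F : {set T} => J \subset F)) /= [X in _ + X]big1 ?addr0.
  apply: eq_big => [F|F /andP[_ JF]]; first by rewrite andbA.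
  rewrite rmorphM /= peval_xset mulrCA mulrC -vand_lam_prod //; ring.
move=> F /andP[_ /subsetPn[v vJ vF]].
by rewrite rmorphM /= peval_xset (bigD1 v vJ) /= lam_out // mul0r !mulr0.
Qed.

Hypothesis t2 : ind2 t.

(** The weight om is kept general: it is [vand (F :\: J)] for anisotropy, and this times the sum of
    the nodes for the Lefschetz property. *)
Lemma square_split D d k J (om : {set T} -> K) p :
  (forall F, F \in D -> #|F| = d -> J \subset F -> om F = splitsum t k (F :\: J)) ->
  \sum_(F in D | (#|F| == d) && (J \subset F)) om F * peval (lam F) p ^+ 2 = 0 ->
  forall Q, [disjoint Q & J] -> #|Q| = k -> dg D d (fun _ => p * xset K (J :|: Q)) = 0.
Proof.
move=> omE S0.
pose c (Q : {set T}) := if [disjoint Q & J] && (#|Q| == k) then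
  \sum_(F in D | (#|F| == d) && (J :|: Q \subset F))
     vand Q * vand (F :\: (J :|: Q)) * peval (lam F) p else 0.
have c0 : forall Q, c Q = 0.
  apply: t2; rewrite -[RHS]S0.
  transitivity (\sum_(Q : {set T}) \sum_(F in D | (#|F| == d) && (J \subset F))
     if (Q \subset F :\: J) && (#|Q| == k) then
     mono t Q * (vand Q * vand (F :\: J :\: Q)) ^+ 2 * peval (lam F) p ^+ 2 else 0).
    apply: eq_bigr => Q _; rewrite /c; case: ifP => [/andP[dQJ ->]|/negbT]; last first.
      rewrite negb_and expr0n mul0r => dQ; rewrite big1 // => F _; case: ifP => //.
      rewrite subsetD -andbA => /and3P[_ dQJ cQ].
      by move: dQ; rewrite dQJ cQ.
    rewrite (sqr_sum2 char2) mulr_suml [LHS]big_mkcond [RHS]big_mkcond /=.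
    apply: eq_bigr => F _; rewrite subUset subsetD dQJ !andbT andbA.
    case: (F \in D) => //=; case: (_ == d) => //=; case: (J \subset F) => //=.
    case: (Q \subset F) => //=; rewrite setDDl; ring.
  rewrite exchange_big; apply: eq_bigr => F /and3P[FD /eqP cF JF].
  rewrite omE // /splitsum mulr_suml -big_mkcond /=.
  by apply: eq_bigr => Q _.
move=> Q dQJ cQ; have := c0 Q; rewrite /c dQJ cQ eqxx /= => S1.
rewrite dg_xset -[RHS](mulr0 (vand (J :|: Q) * vand Q)^-1) -[in RHS]S1 mulr_sumr.
apply: eq_bigr => F _.
have ? := vand_neq0 char2 tI Q; have ? := vand_neq0 char2 tI (J :|: Q).
by field; apply/andP.
Qed.

Lemma exists_subset (A : {set T}) k : (k <= #|A|)%N ->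
  exists2 Q : {set T}, Q \subset A & #|Q| = k.
Proof.
move=> kA; have /card_gt0P[Q] : (0 < #|[set Q : {set T} | (Q \subset A) && (#|Q| == k)]|)%N.
  by rewrite cards_draws bin_gt0.
by rewrite inE => /andP[QA /eqP cQ]; exists Q.
Qed.

Lemma split_subset (G : {set T}) m e : (#|G| = m + e)%N ->
  exists J Q : {set T}, [/\ G = J :|: Q, [disjoint Q & J], #|Q| = m & #|J| = e].
Proof.
move=> cG; have [|Q QG cQ] := @exists_subset G m; first by rewrite cG leq_addr.
exists (G :\: Q), Q; split=> //; last first.
- by rewrite cardsD (setIidPr QG) cG cQ addKn.
- exact: disjointDs.
by apply/setP => x; rewrite !inE; case: (boolP (x \in Q)) => [/(subsetP QG)->|]; rewrite ?orbT ?orbF.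
Qed.

(* In characteristic 2, [p ^+ 2] evaluates to squares, while [vand (F :\: J)]
   splits along the independent monomials [mono t Q]; each coefficient is the
   square of the degree of [p * xset K (J :|: Q)], up to a unit. *)
Lemma anisotropy D d m p : (m.*2 <= d)%N ->
  (forall J, (#|J| + m.*2)%N = d -> dg D d (fun _ => p ^+ 2 * xset K J) = 0) ->
  forall G, (#|G| + m)%N = d -> dg D d (fun _ => p * xset K G) = 0.
Proof.
move=> md H G cG.
have cG' : #|G| = (m + (d - m.*2))%N.
  by apply: (@addIn m); rewrite cG addnAC addnn subnKC.
have [J [Q [-> dQJ cQ cJ]]] := split_subset cG'.
have cJd : (#|J| + m.*2)%N = d by rewrite cJ subnK.
apply: (@square_split _ _ m _ (fun F => vand (F :\: J))) => //.
  move=> F FD cF JF; apply/esym/split_vand => //; left.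
  by rewrite cardsD (setIidPr JF) cF cJ subKn.
have := H J cJd; rewrite dg_xset => S0.
rewrite -[RHS](mulr0 (vand J)) -[in RHS]S0 mulr_sumr; apply: eq_bigr => F _.
have ? := vand_neq0 char2 tI J; rewrite rmorphXn /=; by field.
Qed.

(* theta_d is a Lefschetz element: the odd case of the splitting turns
   theta_d * p ^+ 2 into squares in the same way. *)
Lemma lefschetz D d m p : downset D -> even_ridges d D -> (m.*2 < d)%N ->
  p \is m.-homog ->
  (forall J, (#|J| + m.*2).+1%N = d -> dg D d (fun _ => theta t d * p ^+ 2 * xset K J) = 0) ->
  forall G, (#|G| + m)%N = d -> dg D d (fun _ => p * xset K G) = 0.
Proof.
move=> dD eD md hp H G cG.
have d0 : (0 < d)%N by apply: leq_ltn_trans md.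
have cG' : #|G| = (m.+1 + (d - m.*2.+1))%N.
  by apply: (@addIn m); rewrite cG addSnnS addnAC addnn -addSnnS addnC subnK.
have [J [Q [-> dQJ cQ cJ]]] := split_subset cG'.
have cJd : (#|J| + m.*2).+1%N = d by rewrite -addnS cJ subnK.
have hJ : p ^+ 2 * xset K J \is d.-1.-homog.
  rewrite -cJd /= addnC; apply: dhomogM; last exact: xset_homog.
  by rewrite -muln2; apply: dhomogMn.
apply: (@square_split _ _ m.+1 _ (fun F => (\sum_(v in F :\: J) t v) * vand (F :\: J))) => //.
  move=> F FD cF JF; apply/esym/split_e1_vand => //.
  by rewrite cardsD (setIidPr JF) cF cJ subKn.
have := H J cJd; rewrite dg_xset => S0.
(* [theta t d] evaluates to the sum over F rather than over [F :\: J]; the excess depends on J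
   alone, and [dg_low] removes it. *)
have := dg_low dD eD d0 hJ; rewrite dg_xset => S1.
rewrite -[RHS](mulr0 (vand J)) -[in RHS](addr0 0) -[X in X + _]S0.
rewrite -[X in _ + X](mulr0 (\sum_(v in J) t v)) -[X in _ * (_ + _ * X)]S1.
rewrite mulr_sumr -big_split mulr_sumr; apply: eq_bigr => F /and3P[_ /eqP cF JF].
have ? := vand_neq0 char2 tI J; rewrite !rmorphM /= ?rmorphXn /= ?expr2.
have -> : peval (lam F) (theta t d) = \sum_(v in F) t v.
  by rewrite -cF theta_lam_e1 ?cF.
have -> : \sum_(v in F) t v = \sum_(v in J) t v + \sum_(v in F :\: J) t v.
  by rewrite (big_setID J) /= (setIidPr JF).
set a := \sum_(v in J) _; set b := \sum_(v in _) _.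
transitivity (vand J * (vand (F :\: J) / vand J * peval (lam F) p ^+ 2) * (b + (a + a))).
  by rewrite addrr_pchar2 //; field.
by field.
Qed.
End Degree.

(** * Ideals of the face ring and the Poincare pairing *)

Section Ideal.
Variables (K : fieldType) (T : finType) (t : T -> K).
Local Notation P := {mpoly K[#|T|]}.
Local Notation theta := (theta t).
Implicit Types (p q f : P) (F G J Q : {set T}) (D : {set {set T}}).

(* Equality in the face ring of D: a polynomial lies in the ideal of nonfaces iff
   its restrictions to all faces vanish. *)
Definition eqD D p q : Prop := forall F, F \in D -> restr F p = restr F q.

Definition inJ D r p : Prop := exists g : nat -> P, eqD D p (\sum_(j < r) theta j * g j).

Lemma eqD_sub D D' p q : D \subset D' -> eqD D' p q -> eqD D p q.
Proof. by move=> /subsetP DD e F /DD; apply: e. Qed.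

Lemma inJ_sub D D' r p : D \subset D' -> inJ D' r p -> inJ D r p.
Proof. by move=> DD [g eg]; exists g; apply: eqD_sub eg. Qed.

Lemma inJ0 D r p : eqD D p 0 -> inJ D r p.
Proof.
move=> e; exists (fun _ => 0) => F FD; rewrite e //; congr restr.
by rewrite big1 // => j _; rewrite mulr0.
Qed.

Lemma inJD D r p q : inJ D r p -> inJ D r q -> inJ D r (p + q).
Proof.
move=> [g eg] [h eh]; exists (fun j => g j + h j) => F FD.
rewrite rmorphD /= eg // eh // -rmorphD -big_split; congr restr.
by apply: eq_bigr => j _; rewrite mulrDr.
Qed.

Lemma inJM D r p q : inJ D r p -> inJ D r (q * p).
Proof.
move=> [g eg]; exists (fun j => q * g j) => F FD.
rewrite rmorphM /= eg // -rmorphM mulr_sumr; congr restr.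
by apply: eq_bigr => j _; rewrite mulrCA.
Qed.

Lemma inJZ D r c p : inJ D r p -> inJ D r (c *: p).
Proof. by rewrite -mul_mpolyC; apply: inJM. Qed.

Lemma inJ_theta D r j p : (j < r)%N -> inJ D r (theta j * p).
Proof.
move=> jr; exists (fun j' => if j' == j then p else 0) => F FD.
congr restr; rewrite (bigD1 (Ordinal jr)) //= eqxx big1 ?addr0 // => j' jj.
by case: ifP => [/eqP e|_]; rewrite ?mulr0 //; case/eqP: jj; apply: val_inj.
Qed.

Lemma pihomog_restr F n p : pihomog mdeg n (restr F p) = restr F (pihomog mdeg n p).
Proof.
apply: (@mpoly_lin_ind _ _ (fun p => pihomog mdeg n (restr F p) = restr F (pihomog mdeg n p))).
- by move=> a b ea eb; rewrite !(rmorphD, pihomogD) /= ea eb.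
- by move=> c a ea; rewrite restrZ !linearZ /= ea.
- by rewrite !(rmorph0, pihomog0).
move=> m _; rewrite restrX pihomogX; case: ifP; rewrite ?pihomogX ?pihomog0.
  by move=> mF; case: ifP; rewrite ?rmorph0 // restrX mF.
by move=> mF; case: ifP; rewrite ?rmorph0 // restrX mF.
Qed.

Lemma pihomog_theta n j p : pihomog mdeg n.+1 (theta j * p) = theta j * pihomog mdeg n p.
Proof.
apply: (@mpoly_lin_ind _ _ (fun p => pihomog mdeg n.+1 (theta j * p) = theta j * pihomog mdeg n p)).
- by move=> a b ea eb; rewrite mulrDr !pihomogD mulrDr ea eb.
- by move=> c a ea; rewrite -scalerAr !linearZ /= -scalerAr ea.
- by rewrite mulr0 !pihomog0 mulr0.
move=> m _; rewrite pihomogX.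
have hm : theta j * 'X_[m] \is (mdeg m).+1.-homog.
  by apply: (@dhomogM _ _ _ 1); rewrite ?theta_homog // dhomogX.
case: eqP => [e|ne]; first by rewrite pihomog_dE // -e.
by rewrite mulr0; apply: pihomog_ne0 hm; apply/eqP => -[].
Qed.

Lemma pihomog0_theta j p : pihomog mdeg 0 (theta j * p) = 0.
Proof.
apply: (@mpoly_lin_ind _ _ (fun p => pihomog mdeg 0 (theta j * p) = 0)).
- by move=> a b ea eb; rewrite mulrDr !pihomogD ea eb addr0.
- by move=> c a ea; rewrite -scalerAr !linearZ /= ea scaler0.
- by rewrite mulr0 !pihomog0.
move=> m _.
have hm : theta j * 'X_[m] \is (mdeg m).+1.-homog.
  by apply: (@dhomogM _ _ _ 1); rewrite ?theta_homog // dhomogX.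
exact: pihomog_ne0 hm.
Qed.

Lemma inJ_homog D r n p : p \is n.+1.-homog -> inJ D r p ->
  exists g : nat -> P, (forall j, g j \is n.-homog) /\ eqD D p (\sum_(j < r) theta j * g j).
Proof.
move=> hp [g eg]; exists (fun j => pihomog mdeg n (g j)); split=> [j|F FD].
  exact: pihomogP.
rewrite -[p in LHS](pihomog_dE hp) -pihomog_restr eg // pihomog_restr [pihomog _ _ _]raddf_sum /=.
by congr (restr F _); apply: eq_bigr => j _; rewrite -pihomog_theta.
Qed.

Lemma inJ_homog0 D r p : p \is 0.-homog -> inJ D r p -> eqD D p 0.
Proof.
move=> hp [g eg] F FD; rewrite -[p in LHS](pihomog_dE hp) -pihomog_restr eg //.
rewrite pihomog_restr [pihomog _ _ _]raddf_sum /= big1 // => j _; exact: pihomog0_theta.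
Qed.

End Ideal.

Section Lefschetz.
Variables (K : fieldType) (char2 : 2%N \in [pchar K]).
Variables (T : finType) (t : T -> K) (t2 : ind2 t).
Local Notation P := {mpoly K[#|T|]}.
Local Notation theta := (theta t).
Implicit Types (p q f g : P) (F G J Q : {set T}).
Variables (d : nat) (D : {set {set T}}).
Hypotheses (dD : downset D) (eD : even_ridges d D).

Let tI : injective t := ind2_inj char2 t2.
Local Notation deg p := (dg t D d (fun _ => p)).

(* The kernel of the Poincare pairing in degree n. *)
Definition nul n p : Prop := forall g, g \is (d - n).-homog -> deg (p * g) = 0.

Lemma degD p q : deg (p + q) = deg p + deg q. Proof. exact: dgD. Qed.
Lemma degZ c p : deg (c *: p) = c * deg p. Proof. exact: dgZ. Qed.

Lemma deg0 : deg 0 = 0.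
Proof. by rewrite -(scale0r 0) degZ mul0r. Qed.

Lemma deg_sum I (r : seq I) (A : pred I) (p : I -> P) :
  deg (\sum_(i <- r | A i) p i) = \sum_(i <- r | A i) deg (p i).
Proof. by elim/big_rec2: _ => [|i x y _ <-]; rewrite ?deg0 ?degD. Qed.

Lemma deg_eqD p q : eqD D p q -> deg p = deg q.
Proof.
move=> e; apply: eq_bigr => F /andP[FD _]; congr (_ * _).
by rewrite -(@peval_restr _ _ F _ p) -?(@peval_restr _ _ F _ q) ?e // => v vF;
  rewrite lam_out.
Qed.

Lemma nulD n p q : nul n p -> nul n q -> nul n (p + q).
Proof. by move=> np nq g hg; rewrite mulrDl degD np // nq // addr0. Qed.

Lemma nulZ n c p : nul n p -> nul n (c *: p).
Proof. by move=> np g hg; rewrite -scalerAl degZ np // mulr0. Qed.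

Lemma nulB n p q : nul n p -> nul n q -> nul n (p - q).
Proof. by move=> np nq; apply: nulD; rewrite // -scaleN1r; apply: nulZ. Qed.

Lemma nul_sum n I (r : seq I) (A : pred I) (p : I -> P) :
  (forall i, A i -> nul n (p i)) -> nul n (\sum_(i <- r | A i) p i).
Proof.
move=> np; elim/big_ind: _ => //; last exact: nulD.
by move=> g _; rewrite mul0r deg0.
Qed.

Lemma nulM n k p h : (n + k <= d)%N -> h \is k.-homog -> nul n p -> nul (n + k) (h * p).
Proof.
move=> nkd hh np g hg; rewrite -mulrA mulrCA; apply: np.
have -> : (d - n)%N = (k + (d - (n + k)))%N by rewrite subnDA subnKC // leq_subRL // (leq_trans _ nkd) ?leq_addr.
exact: dhomogM.
Qed.

Lemma nul_theta n j p : (j < d)%N -> (n < d)%N -> p \is n.-homog -> nul n.+1 (theta j * p).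
Proof.
move=> jd nd hp g hg; rewrite -mulrA dg_theta //.
have -> : d.-1 = (n + (d - n.+1))%N by rewrite -[in LHS](subnKC nd).
exact: dhomogM.
Qed.

(* A linear relation among the [theta j] replaces a repeated variable by
   variables outside the support, so squarefree test monomials suffice. *)
Lemma nul_sqfree n p : (n <= d)%N -> p \is n.-homog ->
  (forall G, (#|G| + n)%N = d -> deg (p * xset K G) = 0) -> nul n p.
Proof.
move=> nd hp H g; apply: (@homog_ind _ _ _ (fun g => deg (p * g) = 0)).
- by move=> a b ea eb; rewrite mulrDr degD ea eb addr0.
- by move=> c a ea; rewrite -scalerAr degZ ea mulr0.
- by rewrite mulr0 deg0.
move=> m; have [e] := ubnP (#|T| - #|msup m|); elim: e m => // e IH m lte dm.
have [/forallP sq|] := boolP [forall v, mexp m v <= 1]%N.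
  have mE : 'X_[m] = xset K (msup m).
    rewrite mpolyX_xv /xset [RHS]big_mkcond; apply: eq_bigr => v _; rewrite inE.
    by have := sq v; case: (mexp m v) => [|[]].
  rewrite mE; apply: H; rewrite -[RHS](subnK nd) -dm; congr (_ + _)%N.
  rewrite mdeg_mexp -sum1_card big_mkcond; apply: eq_bigr => v _; rewrite inE.
  by have := sq v; case: (mexp m v) => [|[]].
rewrite negb_forall => /existsP[v]; rewrite -ltnNge => mv.
pose m' := (m - U_(enum_rank v))%MM.
have Um : (U_(enum_rank v) <= m)%MM by rewrite lep1mP -/(mexp m v); case: (mexp m v) mv.
have mE : m = (m' + U_(enum_rank v))%MM by rewrite submK.
have m'E u : mexp m' u = (mexp m u - (u == v))%N.
  by rewrite /mexp mnmBE mnm1E (inj_eq enum_rank_inj) eq_sym.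
have sm' : msup m' = msup m.
  apply/setP => u; rewrite !inE m'E; case: (eqVneq u v) => [->|_]; last by rewrite subn0.
  by case: (mexp m v) mv => [|[]].
have dm' : (mdeg m').+1 = (d - n)%N by rewrite -dm mE mdegD mdeg1 addn1.
have md : (#|msup m| < d)%N.
  apply: leq_trans (leq_subr n d); rewrite -dm mdeg_mexp -sum1_card big_mkcond /=.
  rewrite (bigD1 v) //= [X in (_ < X)%N](bigD1 v) //= -addSn leq_add //.
    by rewrite inE; case: (mexp m v) mv => [|[]].
  by apply: leq_sum => u _; rewrite inE; case: (mexp m u).
have vm : v \in msup m by rewrite inE; case: (mexp m v) mv.
pose phi := rootpoly t (msup m :\ v).
have szphi : (size phi <= d)%N.
  by rewrite size_rootpoly; move: md; rewrite (cardsD1 v) vm add1n => /ltnW.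
have rel : deg (p * ((\sum_w phi.[t w] *: xv K w) * 'X_[m'])) = 0.
  have -> : \sum_w phi.[t w] *: xv K w = \sum_(j < d) phi`_j *: theta j.
    rewrite (eq_bigr (fun w => \sum_(j < d) phi`_j *: (t w ^+ j *: xv K w))); last first.
      move=> w _; rewrite (horner_coef_wide _ szphi) scaler_suml.
      by apply: eq_bigr => j _; rewrite scalerA.
    by rewrite exchange_big; apply: eq_bigr => j _; rewrite scaler_sumr.
  rewrite mulr_suml mulr_sumr deg_sum big1 // => j _.
  rewrite -scalerAl -scalerAr degZ mulrCA dg_theta ?mulr0 //.
  have -> : d.-1 = (n + mdeg m')%N by rewrite -(subnKC nd) -dm' addnS.
  by apply: dhomogM => //; rewrite dhomogX.
move: rel; rewrite mulr_suml mulr_sumr deg_sum (bigD1 v) //= big1 ?addr0.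
  rewrite -scalerAl -scalerAr degZ => /eqP; rewrite mulf_eq0 => /orP[|/eqP].
    rewrite horner_rootpoly // => /prodf_eq0[u]; rewrite !inE => /andP[uv _].
    by rewrite (negPf (dt_neq0 char2 tI _)) // eq_sym.
  by have -> : 'X_[m] = xv K v * 'X_[m'] :> P by rewrite {1}mE mpolyXD mulrC.
move=> w wv; rewrite -scalerAl -scalerAr degZ.
have [wm|wm] := boolP (w \in msup m).
  have wmv : w \in msup m :\ v by rewrite in_setD1 wv.
  rewrite horner_rootpoly // (bigD1 w wmv) /= addrr_pchar2 // mul0r mul0r //.
have -> : xv K w * 'X_[m'] = 'X_[U_(enum_rank w) + m'] by rewrite mpolyXD.
rewrite IH ?mulr0 //; last by rewrite mdegD mdeg1 add1n.
have -> : msup (U_(enum_rank w) + m') = w |: msup m.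
  apply/setP => u; rewrite -sm' in_setU1 !inE /mexp mnmDE mnm1E (inj_eq enum_rank_inj).
  by case: (eqVneq u w).
rewrite cardsU1 wm; rewrite -ltnS; apply: leq_trans lte; rewrite add1n ltnS ltn_sub2l //.
have -> : #|T| = #|[set: T]| by rewrite cardsT.
by apply: proper_card; apply/properP; split; [exact: subsetT|exists w].
Qed.

Lemma nul_sqr m p : (m.*2 <= d)%N -> p \is m.-homog -> nul m.*2 (p ^+ 2) -> nul m p.
Proof.
move=> md hp np; apply: nul_sqfree => //.
  by apply: leq_trans md; rewrite -addnn leq_addr.
apply: (@anisotropy _ char2 _ _ tI t2) => // J cJ; apply: np.
by rewrite -cJ addnK; apply: xset_homog.
Qed.

Lemma nul_theta_inj m p : (m.*2 < d)%N -> p \is m.-homog -> nul m.+1 (theta d * p) -> nul m p.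
Proof.
move=> md hp np; apply: nul_sqfree => //.
  by apply: leq_trans (ltnW md); rewrite -addnn leq_addr.
apply: (@lefschetz _ char2 _ _ tI t2) => // J cJ.
rewrite expr2 mulrA -mulrA; apply: np.
have -> : (d - m.+1)%N = (m + #|J|)%N by rewrite -cJ -addnn subSS addnA addnK addnC.
by apply: dhomogM => //; apply: xset_homog.
Qed.

(** Degree m + 1 may be the middle, out of reach of [nul_theta_inj]. But the square of theta_d p is
    theta_d^2 p times p, hence null, and anisotropy removes the square. *)
Lemma nul_theta2_inj m p : (m.+1.*2 <= d)%N -> p \is m.-homog ->
  nul m.+2 (theta d * (theta d * p)) -> nul m p.
Proof.
move=> md hp np; have md' : (m.*2 < d)%N by apply: leq_trans md; rewrite doubleS.
apply: nul_theta_inj => //; apply: nul_sqr => //.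
  by apply: (@dhomogM _ _ _ 1); rewrite ?theta_homog.
move=> g hg; have -> : (theta d * p) ^+ 2 * g = theta d * (theta d * p) * (p * g).
  by rewrite expr2 !mulrA; congr (_ * _); rewrite -!mulrA; congr (_ * _); rewrite mulrCA.
apply: np; have -> : (d - m.+2)%N = (m + (d - m.+1.*2))%N.
  rewrite -{1}(subnKC md) doubleS -addnn !addSn !subSS -addnA addKn //.
exact: dhomogM.
Qed.

Lemma deg_facet F : F \in D -> #|F| = d -> deg (xset K F) != 0.
Proof.
move=> FD cF; rewrite -[xset K F]mul1r dg_xset // (big_pred1 F).
  by rewrite setDv vand0 rmorph1 mulr1 div1r invr_neq0 // vand_neq0.
move=> G /=; apply/and3P/eqP => [[GD /eqP cG FG]|->]; last by rewrite FD cF.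
by apply/esym/eqP; rewrite eqEcard FG cF cG leqnn.
Qed.

Lemma deg_nonface u w p : [set u; w] \notin D -> deg (xv K u * xv K w * p) = 0.
Proof.
move=> uwD; rewrite /dg big1 // => F /andP[FD _]; rewrite !rmorphM /= !peval_xv.
have : ~~ ((u \in F) && (w \in F)).
  by apply: contra uwD => uwF; apply: dD FD _; rewrite subUset !sub1set.
by rewrite negb_and => /orP[] vF; rewrite (lam_out t vF) ?(mul0r, mulr0).
Qed.

End Lefschetz.

(** * Nonvanishing of the middle degree for flag complexes *)

Section Nonvanishing.
Variables (K : fieldType) (char2 : 2%N \in [pchar K]).
Variables (T : finType) (t : T -> K) (t2 : ind2 t).
Local Notation P := {mpoly K[#|T|]}.
Local Notation theta := (theta t).
Implicit Types (p q f g : P) (F G J Q : {set T}) (u v w : T).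
Variables (k d : nat) (dE : d = k.+1.*2) (D : {set {set T}}).
Hypotheses (dD : downset D) (eD : even_ridges d D).
Hypothesis (Dle : forall F, F \in D -> (#|F| <= d)%N).
Hypothesis (Dd : exists2 F, F \in D & #|F| = d).
Hypothesis Dflag : forall G, G \notin D ->
  exists u w, [/\ u \in G, w \in G & [set u; w] \notin D].

Local Notation deg p := (dg t D d (fun _ => p)).
Local Notation nul := (nul t d D).
Let tI : injective t := ind2_inj char2 t2.

Lemma nul_eqD n p q : eqD D p q -> nul n q -> nul n p.
Proof.
move=> e nq g hg; rewrite -(nq g hg); apply: deg_eqD => F FD.
by rewrite !rmorphM /= e.
Qed.

(* Otherwise dividing xv w * q by theta_d gives commuting operators S w on degree k
   modulo [nul], with S u S w = 0 on nonedges and, for deg phi <= d,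
   sum_w phi(t w) S w = phi_d id.  By descending induction on G the product of the
   S w, w in G, then vanishes, and so does the identity. *)
Lemma top_not_ideal : ~ (forall p, p \is k.+1.-homog -> inJ t D d.+1 p).
Proof.
move=> H.
have kd : (k.*2 < d)%N by rewrite dE doubleS ltnW.
have kd1 : (k.+1 <= d)%N by rewrite dE -addnn leq_addr.
have kd2 : (k.+2 <= d)%N by rewrite dE doubleS !ltnS -addnn leq_addr.
have kd3 : (k.+1.*2 <= d)%N by rewrite dE.
have [X hX] : exists X : T * P -> P, forall wq, wq.2 \is k.-homog ->
    X wq \is k.-homog /\ nul k.+1 (xv K wq.1 * wq.2 - theta d * X wq).
  apply: (@functional_choice (T * P) P (fun wq y => wq.2 \is k.-homog ->
    y \is k.-homog /\ nul k.+1 (xv K wq.1 * wq.2 - theta d * y))) => -[w q] /=.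
  have [hq|hq] := boolP (q \is k.-homog); last by exists 0.
  have hwq : xv K w * q \is k.+1.-homog by apply: (@dhomogM _ _ _ 1); rewrite ?xv_homog.
  have [g [hg eg]] := inJ_homog hwq (H _ hwq).
  (* The lower thetas contribute null terms, so the coefficient of theta_d is a quotient by theta_d
     modulo [nul]. *)
  exists (g d) => _; split=> //.
  apply: (@nul_eqD _ _ (\sum_(j < d) theta j * g j)).
    move=> F FD; rewrite rmorphB /= eg // big_ord_recr /= rmorphD /=.
    by rewrite addrK.
  by apply: nul_sum => j _; apply: nul_theta => //; apply: leq_trans kd2.
pose S w q := X (w, q).
have Sh w q : q \is k.-homog -> S w q \is k.-homog by move=> hq; have [] := hX (w, q) hq.
have SN w q : q \is k.-homog -> nul k.+1 (xv K w * q - theta d * S w q).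
  by move=> hq; have [] := hX (w, q) hq.
have th j : theta j \is 1.-homog by apply: theta_homog.
have linj a b : a \is k.-homog -> b \is k.-homog ->
    nul k.+1 (theta d * a - theta d * b) -> nul k (a - b).
  move=> ha hb; rewrite -mulrBr; apply: (nul_theta_inj char2 t2) => //.
  by rewrite rpredB.
have nulX n w p : (n < d)%N -> nul n p -> nul n.+1 (xv K w * p).
  move=> nd np; have := @nulM _ _ t _ D n 1 p (xv K w); rewrite addn1; apply => //.
  exact: xv_homog.
have nulTh n j p : (n < d)%N -> nul n p -> nul n.+1 (theta j * p).
  move=> nd np; have := @nulM _ _ t _ D n 1 p (theta j); rewrite addn1; apply => //.
have Scong w a b : a \is k.-homog -> b \is k.-homog -> nul k (a - b) ->
    nul k (S w a - S w b).
  move=> ha hb nab; apply: linj; rewrite ?Sh //.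
  have -> : theta d * S w a - theta d * S w b =
    - (xv K w * a - theta d * S w a) + (xv K w * b - theta d * S w b) + xv K w * (a - b).
    by ring.
  apply: nulD; last exact: nulX.
  apply: nulD; last exact: SN.
  by rewrite -scaleN1r; apply: nulZ; apply: SN.
have nul0 n : nul n 0 by move=> g _; rewrite mul0r deg0.
have nulC n a b : nul n (a - b) -> nul n (b - a).
  by move=> nab; rewrite -opprB -scaleN1r; apply: nulZ.
have nul_tr n a b c : nul n (a - b) -> nul n (b - c) -> nul n (a - c).
  by move=> nab nbc; have -> : a - c = (a - b) + (b - c) by [ring]; apply: nulD.
have Snul w a : a \is k.-homog -> nul k a -> nul k (S w a).
  move=> ha na; apply: (nul_theta_inj char2 t2) => //; first exact: Sh.
  have -> : theta d * S w a = xv K w * a - (xv K w * a - theta d * S w a) by ring.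
  apply: nulB; last exact: SN.
  exact: nulX.
(* A product of two operators becomes a product of variables after multiplication by theta_d twice;
   [nul_theta2_inj] cancels these two factors. *)
have S2 u w q : q \is k.-homog ->
    nul k.+2 (theta d * (theta d * S u (S w q)) - xv K u * (xv K w * q)).
  move=> hq; have hwq := Sh w q hq.
  have -> : theta d * (theta d * S u (S w q)) - xv K u * (xv K w * q) =
    - (theta d * (xv K u * S w q - theta d * S u (S w q)))
    - (xv K u * (xv K w * q - theta d * S w q)) by ring.
  apply: nulB; last by apply: nulX => //; apply: SN.
  by rewrite -scaleN1r; apply: nulZ; apply: nulTh => //; apply: SN; apply: Sh.
have Scomm u w q : q \is k.-homog -> nul k (S u (S w q) - S w (S u q)).
  move=> hq; apply: (nul_theta2_inj char2 t2) => //; first by rewrite rpredB ?Sh.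
  rewrite !mulrBr; apply: (nul_tr _ _ _ _ (S2 u w q hq) _).
  by apply: nulC; rewrite [xv K u * _]mulrCA; exact: (S2 w u q hq).
have Snonface u w q : [set u; w] \notin D -> q \is k.-homog -> nul k (S u (S w q)).
  move=> uw hq; apply: (nul_theta2_inj char2 t2) => //; first by rewrite ?Sh.
  rewrite -[X in nul _ X]subr0; apply: (nul_tr _ _ _ _ (S2 u w q hq) _); rewrite subr0.
  by move=> g _; rewrite mulrA -mulrA deg_nonface.
pose SS l q := foldr S q l.
have SSh l q : q \is k.-homog -> SS l q \is k.-homog.
  by move=> hq; elim: l => //= x l IH; apply: Sh.
have SSnul l q : q \is k.-homog -> nul k q -> nul k (SS l q).
  by move=> hq nq; elim: l => //= x l IH; apply: Snul => //; apply: SSh.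
have SScong l a b : a \is k.-homog -> b \is k.-homog -> nul k (a - b) -> nul k (SS l a - SS l b).
  by move=> ha hb nab; elim: l => //= x l IH; apply: Scong => //; apply: SSh.
have SScomm w l q : q \is k.-homog -> nul k (S w (SS l q) - SS l (S w q)).
  move=> hq; elim: l => [|x l IH] /=; first by rewrite subrr.
  apply: (nul_tr _ _ (S x (S w (SS l q)))); first by apply: Scomm; apply: SSh.
  by apply: Scong; rewrite ?Sh ?SSh ?Sh.
have front w l q : q \is k.-homog -> w \in l -> nul k (SS l q - SS (rem w l) (S w q)).
  move=> hq; elim: l => //= x l IH; case: (eqVneq x w) => [->|xw] wl.
    by have := SScomm w l q hq.
  apply: Scong; rewrite ?SSh ?Sh //; apply: IH.
  by move: wl; rewrite inE eq_sym (negPf xw).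
have all_nul l q : uniq l -> q \is k.-homog -> nul k (SS l q).
  have [n] := ubnP (#|T| - size l); elim: n l q => // n IH l q ltn ul hq.
  pose G := [set x in l].
  have cG : #|G| = size l by rewrite cardsE; apply/card_uniqP.
  have [GD|GD] := boolP (G \in D); last first.
    have [u [w [uG wG uwD]]] := Dflag GD; rewrite !inE in uG wG.
    (* If u = w, then w is not a vertex of D, and every multiple of its variable has degree 0. *)
    have [uw|uw] := eqVneq u w.
      rewrite -[SS l q]subr0; apply: (nul_tr _ _ _ _ (front w l q hq wG) _); rewrite subr0.
      apply: SSnul; first exact: Sh.
      move: (uwD); rewrite uw => wwD.
      apply: (nul_theta_inj char2 t2) => //; first exact: Sh.
      rewrite -[X in nul _ X]subr0; apply: nulC; rewrite sub0r.
      have -> : - (theta d * S w q) = (xv K w * q - theta d * S w q) - xv K w * q by ring.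
      apply: nulB; first exact: SN.
      move=> g _; rewrite /dg big1 // => F /andP[FD _].
      rewrite !rmorphM /= peval_xv lam_out ?(mul0r, mulr0) //.
      by apply: contra wwD => wF; apply: dD FD _; rewrite setUid sub1set.
    have uG' : u \in rem w l by rewrite (rem_filter w ul) mem_filter /= uw.
    rewrite -[SS l q]subr0; apply: (nul_tr _ _ _ _ (front w l q hq wG) _).
    apply: (nul_tr _ _ _ _ (front u _ _ (Sh w q hq) uG') _); rewrite subr0.
    by apply: SSnul; [rewrite !Sh|apply: Snonface].
  set a := SS l q; have ha : a \is k.-homog by apply: SSh.
  have out w : w \notin l -> nul k (S w a).
    move=> wl; apply: (IH (w :: l)); rewrite /= ?wl //.
    rewrite -ltnS; apply: leq_trans ltn; rewrite ltnS ltn_sub2l // -cG.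
    rewrite -cardsT; apply: proper_card; apply/properP; split; first exact: subsetT.
    by exists w; rewrite // inE.
  have rel (phi : {poly K}) : (size phi <= d.+1)%N ->
      nul k (\sum_w phi.[t w] *: S w a - phi`_d *: a).
    move=> szphi; apply: linj.
    - by apply: rpred_sum => w _; rewrite rpredZ ?Sh.
    - by rewrite rpredZ.
    have e : \sum_w phi.[t w] *: xv K w = \sum_(j < d.+1) phi`_j *: theta j.
      rewrite (eq_bigr (fun w => \sum_(j < d.+1) phi`_j *: (t w ^+ j *: xv K w))); last first.
        move=> w _; rewrite (horner_coef_wide _ szphi) scaler_suml.
        by apply: eq_bigr => j _; rewrite scalerA.
      by rewrite exchange_big; apply: eq_bigr => j _; rewrite scaler_sumr.
    have -> : theta d * (\sum_w phi.[t w] *: S w a) - theta d * (phi`_d *: a) =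
       - (\sum_w phi.[t w] *: (xv K w * a - theta d * S w a))
       + \sum_(j < d) phi`_j *: (theta j * a).
      have -> : \sum_(j < d) phi`_j *: (theta j * a) =
          (\sum_w phi.[t w] *: xv K w) * a - phi`_d *: (theta d * a).
        rewrite e mulr_suml big_ord_recr /= scalerAl addrK.
        by apply: eq_bigr => j _; rewrite scalerAl.
      have -> : \sum_w phi.[t w] *: (xv K w * a - theta d * S w a) =
          \sum_w phi.[t w] *: (xv K w * a) - \sum_w phi.[t w] *: (theta d * S w a).
        by rewrite -sumrB; apply: eq_bigr => w _; rewrite scalerBr.
      have -> : (\sum_w phi.[t w] *: xv K w) * a = \sum_w phi.[t w] *: (xv K w * a).
        by rewrite mulr_suml; apply: eq_bigr => w _; rewrite scalerAl.
      have -> : theta d * (\sum_w phi.[t w] *: S w a) = \sum_w phi.[t w] *: (theta d * S w a).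
        by rewrite mulr_sumr; apply: eq_bigr => w _; rewrite scalerAr.
      by rewrite -[theta d * (_ *: a)]scalerAr opprB addrA subrK.
    apply: nulD.
      rewrite -scaleN1r; apply: nulZ; apply: nul_sum => w _; apply: nulZ; exact: SN.
    apply: nul_sum => j _; apply: nulZ; apply: nul_theta => //; exact: leq_trans kd2.
  (* The polynomial with roots at G minus v has degree below d, so its relation has no identity term
     and expresses [S v a] through elements outside l. *)
  have ins v : v \in l -> nul k (S v a).
    move=> vl; pose phi := rootpoly t (G :\ v).
    have szphi : (size phi <= d)%N.
      by rewrite size_rootpoly; have := Dle GD; rewrite (cardsD1 v) inE vl.
    have := rel phi (leqW szphi); rewrite (nth_default _ szphi) scale0r subr0.
    rewrite (bigD1 v) //= => ns.
    have nz : phi.[t v] != 0.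
      rewrite horner_rootpoly //; apply/prodf_neq0 => u; rewrite !inE => /andP[uv _].
      by rewrite (dt_neq0 char2 tI) // eq_sym.
    rewrite -[S v a](scalerK nz); apply: nulZ.
    rewrite -[_ *: _](addrK (\sum_(i | i != v) phi.[t i] *: S i a)); apply: nulB => //.
    apply: nul_sum => w wv; have [wl|wl] := boolP (w \in l).
      have wG : w \in G :\ v by rewrite !inE wv.
      by rewrite horner_rootpoly // (bigD1 w wG) /= addrr_pchar2 // mul0r scale0r.
    by apply: nulZ; apply: out.
  (* Here the d-th coefficient is 1, so the relation expresses a itself through the null elements
     [S w a]. *)
  have := rel 'X^d; rewrite size_polyXn coefXn eqxx scale1r => /(_ (leqnn _)) na.
  rewrite -[a](subKr (\sum_w ('X^d).[t w] *: S w a)); apply: nulB => //.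
  apply: nul_sum => w _; apply: nulZ; have [wl|wl] := boolP (w \in l); [exact: ins|exact: out].
have [F FD cF] := Dd.
have [G GF cG] := @exists_subset _ F k (leq_trans (ltnW kd1) (eq_leq (esym cF))).
have hG : xset K G \is k.-homog by rewrite -cG xset_homog.
have hFG : xset K (F :\: G) \is (d - k).-homog.
  have -> : (d - k)%N = #|F :\: G| by rewrite cardsD (setIidPr GF) cF cG.
  exact: xset_homog.
have := all_nul [::] _ isT hG _ hFG.
have -> : xset K G * xset K (F :\: G) = xset K F.
  by rewrite /xset [RHS](big_setID G) /= (setIidPr GF).
by move/eqP; apply/negP; apply: deg_facet.
Qed.

End Nonvanishing.

(** * Generic points over field extensions *)

Definition ind2_on (K : fieldType) (T : finType) (A : {set T}) (t : T -> K) : Prop :=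
  forall c : {set T} -> K, \sum_(Q : {set T} | Q \subset A) c Q ^+ 2 * mono t Q = 0 ->
  forall Q : {set T}, Q \subset A -> c Q = 0.

Definition transc (F K : fieldType) (i : {rmorphism F -> K}) (x : K) : Prop :=
  forall p : {poly F}, p != 0 -> (map_poly i p).[x] != 0.

Section Extension.
Variables (F : fieldType) (char2 : 2%N \in [pchar F]) (T : finType).
Local Notation FX := {fraction {poly F}}.
Local Notation tofrac := (@FracField.tofrac {poly F}).

Lemma coef_sqr_double (p : {poly F}) j : (p ^+ 2)`_j.*2 = p`_j ^+ 2.
Proof.
have c2 : 2%N \in [pchar {poly F}] by rewrite pchar_poly.
rewrite -{1}[p]coefK poly_def -(pFrobenius_autE c2) rmorph_sum /= coef_sum.
have coefE (i : 'I_(size p)) : (pFrobenius_aut c2 (p`_i *: 'X^i))`_j.*2 = p`_i ^+ 2 * (j == i)%:R.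
  rewrite pFrobenius_autE exprZn -exprM coefZ coefXn muln2.
  by rewrite -!muln2 eqn_pmul2r.
rewrite (eq_bigr _ (fun i _ => coefE i)).
have [lt|ge] := ltnP j (size p).
  rewrite (bigD1 (Ordinal lt)) //= eqxx mulr1 big1 ?addr0 // => i ne.
  rewrite eq_sym; case: eqP => [e|_]; last by rewrite mulr0.
  by case/eqP: ne; apply: val_inj.
rewrite big1 ?nth_default ?expr0n // => i _.
by rewrite gtn_eqF ?mulr0 // (leq_trans (ltn_ord i)).
Qed.

Lemma frac_rep (x : FX) : exists n d : {poly F}, d != 0 /\ x * tofrac d = tofrac n.
Proof.
elim/quotW: x => r; exists (frac r).1, (frac r).2; split; first exact: denom_ratioP.
rewrite /GRing.mul /=; unlock FracField.tofrac; rewrite -[LHS]FracField.pi_mul.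
apply/eqmodP; rewrite /= FracField.equivfE /FracField.mulf.
by rewrite !numden_Ratio ?mulr1 ?oner_neq0 ?denom_ratioP // mulrC.
Qed.

Lemma common_denominator (I : finType) (c : I -> FX) :
  exists (n : I -> {poly F}) (e : FX), e != 0 /\ forall i, c i * e = tofrac (n i).
Proof.
have /fin_all_exists[n /fin_all_exists[d nd]] := fun i => frac_rep (c i).
exists (fun i => n i * \prod_(j | j != i) d j), (tofrac (\prod_j d j)); split.
  by rewrite tofrac_eq0; apply/prodf_neq0 => j _; have [] := nd j.
move=> i; have [_ e] := nd i.
by rewrite (bigD1 i) //= !tofracM mulrA e.
Qed.

Definition frac_const : F -> FX := fun a => tofrac a%:P.

HB.instance Definition _ := GRing.RMorphism.copy frac_const (tofrac \o polyC).

Lemma transc_frac : transc (frac_const : {rmorphism F -> FX}) (tofrac 'X).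
Proof.
move=> p; have -> : (map_poly frac_const p).[tofrac 'X] = tofrac p.
  rewrite -{2}[p]coefK poly_def rmorph_sum /= (@horner_coef_wide _ (size p)) ?size_map_poly //.
  apply: eq_bigr => i _; rewrite coef_map -mul_polyC rmorphM rmorphXn /= //.
by rewrite tofrac_eq0.
Qed.

(** Clear denominators in a relation. Squares of polynomials live in even degrees, so the terms
    without v and those with v, which carry an extra ['X], separate by parity; each coefficient is
    then a relation over F. *)
Lemma ind2_frac (A : {set T}) (t : T -> F) (v : T) : ind2_on A t ->
  ind2_on (v |: A) (fun w => if w == v then tofrac 'X else frac_const (t w)).
Proof.
pose t' (w : T) : FX := if w == v then tofrac 'X else frac_const (t w).
move=> At; rewrite -/t' => c S0.
pose B := A :\ v.
have vB : v \notin B by rewrite !inE eqxx.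
have BA : v |: A = v |: B by apply/setP => x; rewrite !inE; case: eqP.
have monoB (Q : {set T}) : Q \subset B -> mono t' Q = tofrac (mono t Q)%:P.
  move=> /subsetP QB; rewrite /mono !rmorph_prod; apply: eq_bigr => u uQ.
  by rewrite /t'; case: eqP (QB u uQ) => // ->; rewrite (negPf vB).
have [n [e [e0 ne]]] := common_denominator c.
have n2 Q : tofrac (n Q ^+ 2) = e ^+ 2 * c Q ^+ 2.
  by rewrite !expr2 tofracM -ne mulrACA mulrC.
have S1 : \sum_(Q : {set T} | Q \subset B) (n Q ^+ 2 * (mono t Q)%:P +
    'X * (n (v |: Q) ^+ 2 * (mono t Q)%:P)) = 0 :> {poly F}.
  apply/eqP; rewrite -tofrac_eq0 rmorph_sum /=; apply/eqP.
  transitivity (e ^+ 2 * \sum_(Q : {set T} | Q \subset v |: B) c Q ^+ 2 * mono t' Q); last by rewrite -BA S0 mulr0.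
  rewrite [X in _ = _ * X](bigID (fun Q : {set T} => v \in Q)) /= addrC mulrDr !mulr_sumr.
  have -> : \sum_(Q : {set T} | (Q \subset v |: B) && (v \notin Q)) e ^+ 2 * (c Q ^+ 2 * mono t' Q) =
     \sum_(Q : {set T} | Q \subset B) tofrac (n Q ^+ 2 * (mono t Q)%:P).
    apply: eq_big => [Q|Q]; rewrite ?sub_setU1_notin // => QB.
    by rewrite monoB // tofracM n2 mulrA.
  have -> : \sum_(Q : {set T} | (Q \subset v |: B) && (v \in Q)) e ^+ 2 * (c Q ^+ 2 * mono t' Q) =
     \sum_(Q : {set T} | Q \subset B) tofrac ('X * (n (v |: Q) ^+ 2 * (mono t Q)%:P)).
    rewrite (reindex_onto (fun Q => v |: Q) (fun Q => Q :\ v)) /=; last first.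
      by move=> Q /andP[_ vQ]; rewrite setD1K.
    apply: eq_big => [Q|Q /andP[/andP[QB _] /eqP e']].
      rewrite setU11 andbT; have [vQ|vQ] := boolP (v \in Q).
        transitivity false; last by apply/esym/negbTE; apply: contra vB => /subsetP ->.
        apply/negbTE; rewrite negb_and orbC; apply/orP; left.
        by apply: contraTneq vQ => <-; rewrite !inE eqxx.
      by rewrite setU1K // eqxx andbT -(sub_setU1_notin Q vB) vQ andbT subUset sub1set setU11.
    have vQ : v \notin Q by rewrite -e' !inE eqxx.
    have QB' : Q \subset B by rewrite -(sub_setU1_notin Q vB) vQ andbT (subset_trans _ QB) ?subsetUr.
    rewrite monoU1 // monoB // /t' eqxx tofracM tofracM n2; ring.
  by rewrite -big_split /=; apply: eq_bigr => Q _; rewrite tofracD.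
have Bt : ind2_on B t.
  move=> c' S' Q QB; have QA := subset_trans QB (subsetDl A [set v]).
  pose c'' (Q : {set T}) := if Q \subset B then c' Q else 0.
  have := At c'' _ Q QA; rewrite /c'' QB; apply.
  rewrite -[RHS]S' [RHS]big_mkcond [LHS]big_mkcond /=; apply: eq_bigr => R _.
  case: ifP => RA; case: ifP => RB //; first by rewrite expr0n mul0r.
  by move: RA; rewrite (subset_trans RB (subsetDl A _)).
have n0 (Q : {set T}) : Q \subset B -> n Q = 0 /\ n (v |: Q) = 0.
  move=> QB; split; apply/polyP => j; rewrite coef0.
    apply: (Bt (fun Q => (n Q)`_j)) => //.
    have /= := congr1 (fun p : {poly F} => p`_j.*2) S1; rewrite coef0 coef_sum => S2; rewrite -[RHS]S2.
    apply: eq_bigr => R _; rewrite coefD coefXM coefMC coef_sqr_double.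
    case: (j) => [|j'] /=; first by rewrite addr0.
    by rewrite coefMC coef_sqr_odd // mul0r addr0.
  apply: (Bt (fun Q => (n (v |: Q))`_j)) => //.
  have /= := congr1 (fun p : {poly F} => p`_j.*2.+1) S1; rewrite coef0 coef_sum => S2; rewrite -[RHS]S2.
  apply: eq_bigr => R _; rewrite coefD coefXM !coefMC /= coef_sqr_double.
  by rewrite coef_sqr_odd // mul0r add0r.
have c0 Q : n Q = 0 -> c Q = 0.
  move=> nQ; apply/eqP; have /eqP := ne Q; rewrite nQ tofrac0 mulf_eq0.
  by rewrite (negPf e0) orbF.
move=> Q; rewrite BA => QB; apply: c0; have [vQ|vQ] := boolP (v \in Q).
  have [|_ e'] := n0 (Q :\ v); last by rewrite setD1K in e'.
  by rewrite subDset.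
by have [|//] := n0 Q; rewrite -(sub_setU1_notin Q vB) QB.
Qed.

End Extension.

Lemma extension_exists (F : fieldType) (T : finType) (A : {set T}) (t : T -> F) (v : T) :
  2%N \in [pchar F] -> ind2_on A t ->
  exists (K : fieldType) (i : {rmorphism F -> K}) (t' : T -> K),
    [/\ ind2_on (v |: A) t', forall w, w != v -> t' w = i (t w) & transc i (t' v)].
Proof.
move=> c2 At; exists {fraction {poly F}}, (@frac_const F).
exists (fun w => if w == v then FracField.tofrac 'X else frac_const (t w)).
split; first exact: ind2_frac.
  by move=> w /negPf->.
by rewrite eqxx; apply: transc_frac.
Qed.

Lemma tower_exists (F : fieldType) (T : finType) (A : {set T}) (t : T -> F) (s : seq T) :
  2%N \in [pchar F] -> ind2_on A t ->
  exists (K : fieldType) (i : {rmorphism F -> K}) (t' : T -> K),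
    [/\ ind2_on ([set x in s] :|: A) t', forall w, w \notin s -> t' w = i (t w)
      & forall v, v \in s -> transc i (t' v)].
Proof.
move=> c2 At; elim: s => [|v s [K [i [t' [t2 tE tr]]]]].
  by exists F, idfun, t; split=> //; rewrite set_nil set0U.
have c2K : 2%N \in [pchar K] by rewrite (fmorph_pchar i).
have [K' [i' [t'' [t2' tE' tr']]]] := extension_exists v c2K t2.
exists K', (i' \o i), t''; split.
- by rewrite set_cons -setUA.
- move=> w; rewrite inE negb_or => /andP[wv ws].
  by rewrite tE' // tE.
move=> w; rewrite inE; have [->|wv] /= := eqVneq w v => [_|ws] p p0; rewrite map_poly_comp.
  by apply: tr'; rewrite map_poly_eq0.
by rewrite tE' // horner_map fmorph_eq0; apply: tr.
Qed.

(** Coordinates for all of T are adjoined first; those of S are then replaced by fresh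
    transcendentals. Thus [t0] is generic even on S, and anisotropy is available over both
    fields. *)
Lemma fields_exist (T : finType) (S : {set T}) :
  exists (K0 K : fieldType) (i0 : {rmorphism 'F_2 -> K0}) (i : {rmorphism K0 -> K})
    (t0 : T -> K0) (t : T -> K),
    [/\ ind2 t0, ind2 t, forall w, w \notin S -> t w = i (t0 w)
      & forall v, v \in S -> transc i (t v)].
Proof.
have c2 : 2%N \in [pchar 'F_2] by rewrite pchar_Fp.
have base : ind2_on set0 (fun _ : T => 0 : 'F_2).
  move=> c; rewrite (big_pred1 set0); last by move=> Q; rewrite subset0.
  rewrite /mono big_set0 mulr1 => /eqP; rewrite expf_eq0 /= => /eqP c0 Q.
  by rewrite subset0 => /eqP->.
have [K0 [i0 [t0 [t02 _ _]]]] := tower_exists (enum T) c2 base.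
have c2' : 2%N \in [pchar K0] by rewrite (fmorph_pchar i0).
have [K [i [t [t2 tE tr]]]] := tower_exists (enum S) c2' t02.
have toT (F : fieldType) (A : {set T}) (u : T -> F) : A = setT -> ind2_on A u -> ind2 u.
  move=> -> Au c c0 Q; apply: Au; rewrite ?subsetT //.
  by rewrite -[RHS]c0; apply: eq_bigl => R; rewrite subsetT.
exists K0, K, i0, i, t0, t; split.
- by apply: toT t02; apply/setP => x; rewrite !inE mem_enum.
- by apply: toT t2; apply/setP => x; rewrite !inE !mem_enum orbT.
- by move=> w wS; apply: tE; rewrite mem_enum.
by move=> v vS; apply: tr; rewrite mem_enum.
Qed.

(** * Functionals on stars *)

(** Membership in an ideal is a bare proposition, so the subspace is found classically: one inside Q
    is enlarged until nothing is missing, and the dimension bounds the number of steps. *)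
Lemma subspace_exists (K : fieldType) (vT : vectType K) (Q : vT -> Prop) :
  Q 0 -> (forall a u v, Q u -> Q v -> Q (a *: u + v)) ->
  exists U : {vspace vT}, forall v, v \in U <-> Q v.
Proof.
move=> Q0 QL.
suff H n (U : {vspace vT}) : (\dim {:vT} - \dim U < n)%N -> (forall v, v \in U -> Q v) ->
    exists U : {vspace vT}, forall v, v \in U <-> Q v.
  by apply: (H (\dim {:vT}).+1 0%VS); rewrite ?ltnS ?leq_subr // => v; rewrite memv0 => /eqP->.
elim: n U => // n IH U; rewrite ltnS => dU UQ.
have [[v [Qv vU]]|no] := Classical_Prop.classic (exists v, Q v /\ v \notin U); last first.
  exists U => v; split; first exact: UQ.
  by move=> Qv; apply/negPn/negP => vU; apply: no; exists v.
apply: (IH (U + <[v]>)%VS) => [|w /memv_addP[u uU [_ /vlineP[a ->] ->]]]; last first.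
  by rewrite addrC; apply: QL => //; apply: UQ.
apply: leq_trans dU; apply: ltn_sub2l.
  apply: leq_trans (dimvS (subvf (U + <[v]>)%VS)).
  rewrite ltnNge; apply: contra vU => le.
  have /eqP-> : (U == U + <[v]>)%VS by rewrite eqEdim addvSl.
  by apply: (subvP (addvSr U <[v]>%VS)); apply: memv_line.
rewrite ltnNge; apply: contra vU => le.
have /eqP-> : (U == U + <[v]>)%VS by rewrite eqEdim addvSl.
by apply: (subvP (addvSr U <[v]>%VS)); apply: memv_line.
Qed.

Section Truncation.
Variables (K : fieldType) (n N : nat).
Local Notation P := {mpoly K[n]}.
(** A finite-dimensional model of the polynomials of degree below N, in which [\dim] makes sense. *)
Definition trunc := {ffun 'X_{1..n < N} -> K^o}.

Definition tproj (p : P) : trunc := [ffun m : 'X_{1..n < N} => p@_m : K^o].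
Definition temb (e : trunc) : P := \sum_m e m *: 'X_[m].

Fact tproj_linear : linear tproj.
Proof. by move=> a p q; apply/ffunP => m; rewrite !ffunE mcoeffD mcoeffZ. Qed.
HB.instance Definition _ := GRing.isLinear.Build K P trunc *:%R tproj tproj_linear.

Fact temb_linear : linear temb.
Proof.
move=> a e f; rewrite /temb scaler_sumr -big_split; apply: eq_bigr => m _.
by rewrite !ffunE scalerDl scalerA.
Qed.
HB.instance Definition _ := GRing.isLinear.Build K trunc P *:%R temb temb_linear.

Lemma tprojK p : (msize p <= N)%N -> temb (tproj p) = p.
Proof.
by move=> sp; rewrite [RHS](mpolywE sp); apply: eq_bigr => m _; rewrite ffunE.
Qed.

Lemma coef_temb e (m : 'X_{1..n < N}) : (temb e)@_m = e m.
Proof.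
rewrite /temb raddf_sum (bigD1 m) //= mcoeffZ mcoeffX eqxx mulr1 big1 ?addr0 //.
by move=> m' ne; rewrite mcoeffZ mcoeffX -bmeqP (negPf ne) mulr0.
Qed.

(** Subtract the projection to the subspace cut out by Q, and take a coordinate in which p
    survives. *)
Lemma functional_exists (Q : P -> Prop) p :
  Q 0 -> (forall a u v, Q u -> Q v -> Q (a *: u + v)) ->
  (msize p <= N)%N -> ~ Q p ->
  exists lam : {linear P -> K^o},
    lam p != 0 /\ forall q, (msize q <= N)%N -> Q q -> lam q = 0.
Proof.
move=> Q0 QL sp nQ.
have [U UQ] : exists U : {vspace trunc}, forall e, e \in U <-> Q (temb e).
  apply: (@subspace_exists _ _ (fun e => Q (temb e))); first by rewrite linear0.
  by move=> a u v Qu Qv; rewrite linearP; apply: QL.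
pose f (q : P) : trunc := tproj q - projv U (tproj q).
have f0 : f p != 0.
  rewrite subr_eq0; apply/eqP => e; apply: nQ; rewrite -(tprojK sp).
  by apply/UQ; rewrite e memv_proj.
have [m fm] : exists m, f p m != 0.
  apply/existsP; apply: contraNT f0; rewrite negb_exists => /forallP h.
  by apply/eqP/ffunP => m; have := h m; rewrite negbK !ffunE => /eqP.
pose g (q : P) : K^o := f q m.
have fl : linear f.
  by move=> a q r; rewrite /f !linearP /= scalerBr scalerN addrACA.
have gl : linear g by move=> a q r; rewrite /g fl !ffunE.
pose g' : {linear P -> K^o} := HB.pack g (GRing.isLinear.Build _ _ _ _ g gl).
exists g'; split=> // q sq Qq.
have /projv_id e : tproj q \in U by apply/UQ; rewrite tprojK.
by rewrite /= /g /f e subrr ffunE.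
Qed.

End Truncation.

Lemma msup_exists (T : finType) (m : 'X_{1..#|T|}) k : mdeg m = k.+1 ->
  exists u m', [/\ u \in msup m, m = (U_(enum_rank u) + m')%MM & mdeg m' = k].
Proof.
move=> dm; have [u um] : exists u, u \in msup m.
  apply/existsP; apply: contra_eqT dm; rewrite negb_exists => /forallP h.
  by rewrite mdeg_mexp big1 // => v _; have := h v; rewrite inE negbK => /eqP.
have Um : (U_(enum_rank u) <= m)%MM by move: um; rewrite lep1mP inE.
set m' := (m - U_(enum_rank u))%MM.
have e : m = (U_(enum_rank u) + m')%MM by rewrite addmC submK.
by exists u, m'; split=> //; move: dm; rewrite e mdegD mdeg1 add1n => -[].
Qed.

Lemma msup_add (T : finType) (u : T) m : msup (U_(enum_rank u) + m)%MM = u |: msup m.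
Proof.
apply/setP => v; rewrite in_setU1 !inE /mexp mnmDE mnm1E (inj_eq enum_rank_inj).
by case: (eqVneq v u).
Qed.

Lemma homog_msize_le (R : idomainType) n (p : {mpoly R[n]}) k :
  p \is k.-homog -> (msize p <= k.+1)%N.
Proof.
move=> hp; have [->|nz] := eqVneq p 0; first by rewrite msize0.
by have := dhomog_uniq nz hp (dhomog_msize hp); case: (msize p) => //= s ->.
Qed.

(** * From the link of a face to its star *)

Section Cauchy.
Variables (K : fieldType) (char2 : 2%N \in [pchar K]).
Variables (T : finType) (t : T -> K) (tI : injective t).

(** Divide ['X^j] by the root polynomial of tau. The remainder is too short to contribute to an
    interpolation sum over [#|tau|.+1] nodes, and the multiple of the root polynomial survives only
    at w, where it yields the quotient. *)
Lemma lagrange_extend (tau : {set T}) j : exists2 phi : {poly K},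
  (size phi <= (j - #|tau|).+1)%N &
  forall w, w \notin tau ->
    \sum_(u in w |: tau) t u ^+ j * lam t (w |: tau) u = phi.[t w].
Proof.
pose rho := rootpoly t tau; pose phi := 'X^j %/ rho; pose r := 'X^j %% rho.
have rho0 : rho != 0 by apply: monic_neq0; apply: rootpoly_monic.
exists phi.
  rewrite size_divp // size_polyXn size_rootpoly /=; case: (leqP #|tau| j) => h.
    by rewrite subSn.
  by rewrite (eqnP h).
move=> w wt; have cw : #|w |: tau| = #|tau|.+1 by rewrite cardsU1 wt.
have szr : (size r <= #|tau|)%N by rewrite -ltnS -(size_rootpoly t tau) ltn_modp.
transitivity (\sum_(u in w |: tau) (phi.[t u] * rho.[t u]) * lam t (w |: tau) u
    + \sum_(u in w |: tau) r.[t u] * lam t (w |: tau) u).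
  rewrite -big_split; apply: eq_bigr => u _ /=; rewrite -mulrDl; congr (_ * _).
  by rewrite -hornerM -hornerD -divp_eq hornerXn.
rewrite lagrange ?cw //; last exact: leqW.
rewrite [r`__]nth_default ?cw // addr0 big_setU1 //= big1 ?addr0; last first.
  by move=> u ut; rewrite horner_rootpoly // (bigD1 u ut) /= addrr_pchar2 // mul0r mulr0 mul0r.
have -> : lam t (w |: tau) w = (rho.[t w])^-1.
  by rewrite /lam setU11 horner_rootpoly // /node setU1K.
rewrite mulfK // horner_rootpoly //; apply/prodf_neq0 => u ut.
by apply: (dt_neq0 char2 tI); apply: contraNneq wt => ->.
Qed.

End Cauchy.

Definition star (T : finType) (D : {set {set T}}) (tau : {set T}) : {set {set T}} :=
  [set F in D | F :|: tau \in D].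

Section KeyLemma.
Variables (K0 K : fieldType) (char2 : 2%N \in [pchar K0]) (i : {rmorphism K0 -> K}).
Variables (T : finType) (t0 : T -> K0) (t : T -> K) (t02 : ind2 t0) (t2 : ind2 t).
Variables (D : {set {set T}}) (tau : {set T}) (v : T) (d d' k : nat).
Local Notation L := (link D tau).
Local Notation P0 := {mpoly K0[#|T|]}.
Local Notation P := {mpoly K[#|T|]}.
Hypotheses (dD : downset D) (vtau : v \in tau).
Hypotheses (d'E : d' = k.+2.*2) (dE : (#|tau| + d')%N = d).
Hypotheses (tE : forall w, [set w] \in L -> t w = i (t0 w)) (tv : transc i (t v)).
Hypotheses (dL : downset L) (eL : even_ridges d' L).
Hypothesis (Lle : forall F, F \in L -> (#|F| <= d')%N).
Hypothesis (Ld : exists2 F, F \in L & #|F| = d').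
Hypothesis Lflag : forall G, G \notin L ->
  exists u w, [/\ u \in G, w \in G & [set u; w] \notin L].

Let c2K : 2%N \in [pchar K]. Proof. by rewrite (fmorph_pchar i). Qed.
Let tI : injective t := ind2_inj c2K t2.
Let t0I : injective t0 := ind2_inj char2 t02.
Local Notation VL := [set w | [set w] \in L].

Lemma linkP w : w \in VL -> w \notin tau.
Proof.
rewrite !inE => /and3P[_ _ /eqP/setP/(_ w)]; rewrite !inE eqxx /=.
by move=> ->.
Qed.

(* Substituting [psi] eliminates the variables of tau from the ideal of its star and
   leaves the one of its link, whose theta's are defined over K0; the image of
   [xv v] has the coefficients 1 / (t v + t w), up to a common factor. *)
Definition psi u : P := \sum_(w in VL) lam t (w |: tau) u *: xv K w.

Lemma psi_homog u : psi u \is 1.-homog.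
Proof. by apply: rpred_sum => w _; apply: rpredZ; apply: xv_homog. Qed.

Lemma psi_VL w : w \in VL -> psi w = lam t (w |: tau) w *: xv K w.
Proof.
move=> wL; rewrite /psi (bigD1 w wL) /= big1 ?addr0 // => u /andP[uL uw].
rewrite lam_out ?scale0r // !inE negb_or eq_sym uw /=; exact: linkP.
Qed.

Lemma psi_out u : u \notin tau -> u \notin VL -> psi u = 0.
Proof.
move=> ut uL; rewrite /psi big1 // => w wL; rewrite lam_out ?scale0r //.
by rewrite inE negb_or ut andbT inE; apply: contraNneq uL => ->.
Qed.

Definition thetaL l : P := \sum_(w in VL) i (t0 w) ^+ l *: xv K w.

(** By [lagrange_extend] the coefficient of x_w is a polynomial in [t w] of degree at most d'; its
    coefficients are the a l. *)
Lemma psi_theta j : (j <= d)%N ->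
  exists a : nat -> K, psubst psi (theta t j) = \sum_(l < d'.+1) a l *: thetaL l.
Proof.
move=> jd; have [phi szphi phiE] := lagrange_extend c2K tI tau j.
have szphi' : (size phi <= d'.+1)%N.
  by apply: leq_trans szphi _; rewrite ltnS leq_subLR dE.
exists (fun l => phi`_l); rewrite /theta rmorph_sum /=.
under eq_bigr do rewrite psubstZ psubst_xv /psi scaler_sumr.
rewrite exchange_big /=.
transitivity (\sum_(w in VL) phi.[t w] *: xv K w).
  apply: eq_bigr => w wL; rewrite -phiE ?linkP // scaler_suml [RHS]big_mkcond /=.
  apply: eq_bigr => u _; rewrite scalerA; case: ifP => // /negbT uw.
  by rewrite lam_out // mulr0 scale0r.
rewrite /thetaL; under [RHS]eq_bigr do rewrite scaler_sumr.
rewrite exchange_big /=; apply: eq_bigr => w wL.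
rewrite (horner_coef_wide _ szphi') scaler_suml; apply: eq_bigr => l _.
rewrite scalerA tE //; by move: wL; rewrite inE.
Qed.

Variable lam0 : {linear P0 -> K0^o}.
Hypothesis lam0J : forall q, (msize q <= k.+3)%N -> inJ t0 L d'.+1 q -> lam0 q = 0.

(** The extension of scalars of [lam0] from K0 to K, cut off above degree k + 2. *)
Definition lamK (p : P) : K := \sum_(m : 'X_{1..#|T| < k.+3}) p@_m * i (lam0 'X_[m]).

Lemma lamKD p q : lamK (p + q) = lamK p + lamK q.
Proof. by rewrite /lamK -big_split; apply: eq_bigr => m _; rewrite mcoeffD mulrDl. Qed.

Lemma lamKZ a p : lamK (a *: p) = a * lamK p.
Proof. by rewrite /lamK mulr_sumr; apply: eq_bigr => m _; rewrite mcoeffZ mulrA. Qed.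

Lemma lamK0 : lamK 0 = 0.
Proof. by rewrite -(scale0r 0) lamKZ mul0r. Qed.

Lemma lamK_sum I (r : seq I) (A : pred I) (p : I -> P) :
  lamK (\sum_(j <- r | A j) p j) = \sum_(j <- r | A j) lamK (p j).
Proof. by elim/big_rec2: _ => [|j x y _ <-]; rewrite ?lamK0 ?lamKD. Qed.

Lemma lamK_X m : (mdeg m < k.+3)%N -> lamK 'X_[m] = i (lam0 'X_[m]).
Proof.
move=> dm; rewrite /lamK (bigD1 (BMultinom dm)) //= mcoeffX eqxx mul1r big1 ?addr0 //.
by move=> m'; rewrite bmeqP /= => /negPf ne; rewrite mcoeffX eq_sym ne mul0r.
Qed.

Lemma eqD_X (F' : fieldType) m : msup m \notin L -> eqD L ('X_[m] : {mpoly F'[#|T|]}) 0.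
Proof.
move=> mL F FL; rewrite rmorph0 restrX; case: ifP => // mF.
by case/negP: mL; apply: dL FL mF.
Qed.

Lemma lam0_X m : (mdeg m < k.+3)%N -> msup m \notin L -> lam0 'X_[m] = 0.
Proof.
by move=> dm mL; apply: lam0J; [rewrite msizeX|apply: inJ0; apply: eqD_X].
Qed.

Lemma lamK_eqD p : p \is k.+2.-homog -> eqD L p 0 -> lamK p = 0.
Proof.
move=> hp e; rewrite /lamK big1 // => m _.
have [pm|pm] := eqVneq p@_m 0; first by rewrite pm mul0r.
rewrite lam0_X ?rmorph0 ?mulr0 ?bmdeg //; apply: contra pm => mL.
have := congr1 (mcoeff m) (e _ mL); rewrite restrE subxx rmorph0 mcoeff0.
by move/eqP.
Qed.

(** On a monomial g this is the image of [lam0] at an element of the ideal over K0; variables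
    outside the link drop out as nonfaces. *)
Lemma lamK_thetaL l g : (l <= d')%N -> g \is k.+1.-homog -> lamK (thetaL l * g) = 0.
Proof.
move=> ld; apply: (@homog_ind _ _ _ (fun g => lamK (thetaL l * g) = 0)).
- by move=> a b ea eb; rewrite mulrDr lamKD ea eb addr0.
- by move=> c a ea; rewrite -scalerAr lamKZ ea mulr0.
- by rewrite mulr0 lamK0.
move=> m dm; have dw w : (mdeg (U_(enum_rank w) + m)%MM < k.+3)%N by rewrite mdegD mdeg1 dm.
have th0 : lam0 (theta t0 l * 'X_[m]) = 0.
  apply: lam0J; last by apply: inJ_theta.
  apply: homog_msize_le; apply: (@dhomogM _ _ _ 1); rewrite ?theta_homog //.
  by rewrite dhomogX /= dm.
rewrite /thetaL mulr_suml lamK_sum.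
transitivity (i (lam0 (theta t0 l * 'X_[m]))); last by rewrite th0 rmorph0.
rewrite /theta mulr_suml linear_sum rmorph_sum /=.
rewrite [RHS](bigID (fun w => w \in VL)) /= [X in _ + X]big1 ?addr0.
  apply: eq_bigr => w _; rewrite -!scalerAl lamKZ linearZ /= -!mpolyXD lamK_X //.
  by rewrite rmorphM rmorphXn.
move=> w wL; rewrite -scalerAl linearZ /= -mpolyXD lam0_X ?dw ?rmorph0 //.
  by rewrite scaler0 rmorph0.
rewrite msup_add; apply: contra wL => wL; rewrite inE.
by apply: dL wL _; rewrite sub1set setU11.
Qed.

Lemma psi_nonface m : msup m \notin star D tau -> eqD L (psubst psi 'X_[m] : P) 0.
Proof.
move=> mst F FL; rewrite rmorph0 psubst_X rmorph_prod /=.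
have [u um uF] : exists2 u, u \in msup m & restr F (psi u) = 0.
  have /subsetPn[u um] : ~~ (msup m \subset F :|: tau).
    apply: contra mst => mF; move: FL; rewrite !inE => /and3P[FD Ft _].
    rewrite (dD Ft mF) /=; apply: dD Ft _.
    by rewrite subUset mF subsetUr.
  rewrite inE negb_or => /andP[uF ut]; exists u => //.
  have [uL|uL] := boolP (u \in VL); last by rewrite psi_out // rmorph0.
  by rewrite psi_VL // restrZ restr_xv (negPf uF) scaler0.
rewrite (bigD1 u) //= rmorphXn /= uF expr0n; move: um; rewrite inE => /negPf->.
by rewrite mul0r.
Qed.

(** [psubst psi] carries thetas and nonfaces of the star into the K-span of the ideal of the link,
    where [lamK] vanishes. *)
Lemma star_functional f : f \is k.+2.-homog -> inJ t (star D tau) d.+1 f ->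
  lamK (psubst psi f) = 0.
Proof.
move=> hf /(inJ_homog hf)[g [hg e]].
have [h hdef] : exists h, h = f - \sum_(j < d.+1) theta t j * g j by eexists.
have hh : h \is k.+2.-homog.
  rewrite hdef rpredB // rpred_sum // => j _.
  by apply: (@dhomogM _ _ _ 1); rewrite ?theta_homog.
have -> : f = h + \sum_(j < d.+1) theta t j * g j by rewrite hdef subrK.
rewrite rmorphD lamKD rmorph_sum [X in _ + X]lamK_sum [X in _ + X]big1 ?addr0; last first.
  move=> j _ /=; rewrite rmorphM /=; have [a ->] := @psi_theta j (leq_ord j).
  rewrite mulr_suml lamK_sum big1 // => l _; rewrite -scalerAl lamKZ.
  rewrite lamK_thetaL ?mulr0 ?leq_ord //; apply: psubst_homog => //; exact: psi_homog.
apply: lamK_eqD; first by apply: psubst_homog => //; exact: psi_homog.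
move=> F FL; rewrite rmorph0.
apply: (@mpoly_lin_ind _ _ (fun h => restr F (psubst psi h) = 0)).
- by move=> a b ea eb; rewrite !rmorphD /= ea eb addr0.
- by move=> c a ea; rewrite psubstZ restrZ ea scaler0.
- by rewrite !rmorph0.
move=> m mh; rewrite (@psi_nonface m) ?rmorph0 //; apply: contraL mh => mst.
rewrite -mcoeff_eq0 hdef mcoeffB; have /(congr1 (mcoeff m)) := e _ mst.
by rewrite !restrE subxx => ->; rewrite subrr.
Qed.

Lemma functional_key m0 : mdeg m0 = k.+2 -> lam0 'X_[m0] != 0 ->
  exists u c, [/\ u \in VL, c \is k.-homog & ~ inJ t (star D tau) d.+1 (xv K v * xv K u * c)].
Proof.
move=> dm0 lm0; have m0L : msup m0 \in L.
  by apply: contraNT lm0 => nL; rewrite lam0_X // dm0.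
have [u [m1 [um0 m0E dm1]]] := msup_exists dm0.
have [w1 [c [wm1 m1E dc]]] := msup_exists dm1.
have inVL w : w \in msup m0 -> w \in VL.
  by move=> wm; rewrite inE; apply: dL m0L _; rewrite sub1set.
have sm1 : msup m1 \subset msup m0 by rewrite m0E msup_add subsetUr.
have sc : msup c \subset msup m0 by apply: subset_trans sm1; rewrite m1E msup_add subsetUr.
exists u, 'X_[c]; split; [exact: inVL|by rewrite dhomogX /= dc|move=> inj].
have uL := inVL _ um0.
have hf : xv K v * xv K u * 'X_[c] \is k.+2.-homog.
  apply: (@dhomogM _ _ _ 2); last by rewrite dhomogX /= dc.
  by apply: (@dhomogM _ _ _ 1); apply: xv_homog.
have := star_functional hf inj.
have lamn0 w : lam t (w |: tau) w != 0.
  by rewrite /lam setU11 invr_neq0 // node_neq0.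
pose C := \prod_w lam t (w |: tau) w ^+ mexp c w.
have C0 : C != 0 by apply/prodf_neq0 => w _; rewrite expf_neq0.
have psiC : psubst psi 'X_[c] = C *: 'X_[c].
  rewrite psubst_X mpolyX_xv -mul_mpolyC rmorph_prod -big_split /=.
  apply: eq_bigr => w _; have [wc|wc] := boolP (w \in msup c).
    by rewrite psi_VL ?inVL ?(subsetP sc) // exprZn mul_mpolyC.
  by move: wc; rewrite inE negbK => /eqP->; rewrite !expr0 mulr1 rmorph1.
rewrite !rmorphM /= !psubst_xv psiC (psi_VL uL) -[_ * (C *: _)]scalerAr lamKZ.
rewrite /psi [(\sum_(w in VL) _) * _]mulr_suml mulr_suml lamK_sum => /eqP; rewrite mulf_eq0 (negPf C0) /= => /eqP S0.
pose beta w := lam0 (xv K0 w * xv K0 u * 'X_[c]).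
have S1 : \sum_(w in VL) i (beta w) / (t v + i (t0 w)) = 0.
  (* The factor [lam t (w |: tau) v] is the inverse of [t v + t w] times [node t tau v]; A clears
     what does not depend on w. *)
  pose A := node t tau v / lam t (u |: tau) u.
  rewrite -[RHS](mulr0 A) -[in RHS]S0 mulr_sumr; apply: eq_bigr => w wL.
  rewrite -!(scalerAl, scalerAr) !lamKZ /xv -!mpolyXD lamK_X; last first.
    by rewrite !mdegD !mdeg1 dc.
  rewrite !mpolyXD -/(xv _ w) -/(xv _ u) -/(beta w).
  have wt := linkP wL; have vw : w != v by apply: contraNneq wt => ->.
  have -> : lam t (w |: tau) v = (t v + i (t0 w))^-1 / node t tau v.
    rewrite /lam !inE vtau orbT /node -invfM; congr (_^-1).
    rewrite (big_setD1 w) /=; last by rewrite !inE vw eqxx.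
    congr (_ * _); first by rewrite (@tE w) //; move: wL; rewrite inE.
    by apply: eq_bigl => x; rewrite !inE; case: (eqVneq x w) => [->|//]; rewrite (negPf wt) andbF.
  have ? := node_neq0 c2K tI tau v; have ? := lamn0 u.
  have ? : t v + i (t0 w) != 0.
    by rewrite -tE ?(dt_neq0 c2K tI) 1?eq_sym //; move: wL; rewrite inE.
  by rewrite /A; field; do ! (apply/andP; split).
pose q : {poly K0} := \sum_(w in VL) beta w *: rootpoly t0 (VL :\ w).
have w1L : w1 \in VL by rewrite inVL ?(subsetP sm1).
(* At [t0 w1] only the term of w1 survives, with coefficient [lam0 'X_[m0]]; this is why w1 was
   split off m0 as a second factor. *)
have q0 : q != 0.
  apply/eqP => q0; have := congr1 (fun q : {poly K0} => q.[t0 w1]) q0.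
  rewrite /= horner0 horner_sum (bigD1 w1 w1L) /= big1 ?addr0.
    rewrite hornerZ horner_rootpoly // => /eqP; rewrite mulf_eq0 => /orP[].
      have -> : beta w1 = lam0 'X_[m0].
        by rewrite /beta m0E m1E !mpolyXD mulrCA mulrA.
      exact/negP.
    move=> /prodf_eq0[x]; rewrite !inE => /andP[xw _].
    by rewrite (negPf (dt_neq0 char2 t0I _)) // eq_sym.
  move=> w /andP[wL ww]; rewrite hornerZ horner_rootpoly // (bigD1 w1) /=.
    by rewrite addrr_pchar2 // mul0r mulr0.
  by rewrite in_setD1 eq_sym ww.
case/negP: (tv q0); apply/eqP.
have tvw w : w \in VL -> t v + i (t0 w) != 0.
  move=> wL; rewrite -tE ?(dt_neq0 c2K tI) //; last by move: wL; rewrite inE.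
  by apply: contraTneq vtau => ->; apply: linkP.
rewrite -[RHS](mulr0 (\prod_(w in VL) (t v + i (t0 w)))) -[in RHS]S1 mulr_sumr.
rewrite /q rmorph_sum horner_sum; apply: eq_bigr => w wL.
rewrite /= map_polyZ hornerZ (big_setD1 w wL) /=.
have -> : (map_poly i (rootpoly t0 (VL :\ w))).[t v] = \prod_(x in VL :\ w) (t v + i (t0 x)).
  rewrite /rootpoly rmorph_prod horner_prod big_map big_enum; apply: eq_bigr => x _.
  by rewrite /= map_polyXsubC hornerXsubC oppr_pchar2.
by have ? := tvw w wL; field.
Qed.

End KeyLemma.

(* If all these products lay in the ideal, a nonzero functional on the quotient for
   the link would give a relation over K0 between the fractions 1 / (t v + t w),
   impossible for t v transcendental over K0. *)
Lemma key_lemma (K0 K : fieldType) (i : {rmorphism K0 -> K}) (T : finType)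
    (t0 : T -> K0) (t : T -> K) (D : {set {set T}}) (tau : {set T}) (v : T) (d d' k : nat) :
  2%N \in [pchar K0] -> ind2 t0 -> ind2 t ->
  downset D -> v \in tau -> d' = k.+2.*2 -> (#|tau| + d')%N = d ->
  (forall w, [set w] \in link D tau -> t w = i (t0 w)) -> transc i (t v) ->
  downset (link D tau) -> even_ridges d' (link D tau) ->
  (forall F, F \in link D tau -> (#|F| <= d')%N) ->
  (exists2 F, F \in link D tau & #|F| = d') ->
  (forall G, G \notin link D tau ->
    exists u w, [/\ u \in G, w \in G & [set u; w] \notin link D tau]) ->
  exists u c, [/\ [set u] \in link D tau, c \is k.-homog
    & ~ inJ t (star D tau) d.+1 (xv K v * xv K u * c)].
Proof.
move=> char2 t02 t2 dD vtau d'E dE tE tv dL eL Lle Ld Lflag.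
have [p [hp np]] : exists p : {mpoly K0[#|T|]},
    p \is k.+2.-homog /\ ~ inJ t0 (link D tau) d'.+1 p.
  apply: NNPP => no; apply: (top_not_ideal char2 t02 d'E dL eL Lle Ld Lflag).
  by move=> p hp; apply: NNPP => np; apply: no; exists p.
have [lam0 [lp lJ]] := @functional_exists K0 #|T| k.+3 (inJ t0 (link D tau) d'.+1) p
  (inJ0 _ _ (fun F _ => erefl)) (fun a u v Ju Jv => inJD (inJZ a Ju) Jv) (homog_msize_le hp) np.
have [m0 dm0 lm0] : exists2 m0, mdeg m0 = k.+2 & lam0 'X_[m0] != 0.
  apply: NNPP => no; case/negP: lp; apply/eqP.
  apply: (@homog_ind _ _ k.+2 (fun p => lam0 p = 0)) hp.
  - by move=> a b ea eb; rewrite linearD ea eb addr0.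
  - by move=> c a ea; rewrite linearZ ea /= scaler0.
  - exact: linear0.
  by move=> m dm; apply/eqP/negPn/negP => lm; apply: no; exists m.
have [u [c [uL hc nJ]]] := functional_key char2 t02 t2 dD vtau dE tE tv dL lJ dm0 lm0.
by exists u, c; split=> //; move: uL; rewrite inE.
Qed.

(** * Independent sets and the lower bound *)

Section Pseudo.
Variable T : finType.
Implicit Types (D : {set {set T}}) (s F G tau : {set T}) (u v w : T).

(** The incidence properties alone, which pass to links; facets become faces of size d, so that
    maximality need not be traced through links. *)
Definition pseudo d D : Prop :=
  [/\ downset D, set0 \in D,
      forall s, s \in D -> exists F, [/\ F \in D, s \subset F & #|F| = d],
      forall F, F \in D -> (#|F| <= d)%N
    & forall s, s \in D -> #|s|.+1 = d ->
        #|[set F in D | (#|F| == d) && (s \subset F)]| = 2%N].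

(** The case u = w is allowed, so that an element that is not a vertex counts as a nonedge. *)
Definition flagp D : Prop := forall G, G \notin D ->
  exists u w, [/\ u \in G, w \in G & [set u; w] \notin D].

Lemma npm_facet d D F : normal_pseudomanifold d D -> facet D F = (F \in D) && (#|F| == d).
Proof.
case=> [[_ dD] pD _ _].
have cover s : s \in D -> exists2 G, facet D G & s \subset G.
  by move=> sD; have [G mG sG] := maxset_exists (P := fun s : {set T} => s \in D) sD; exists G.
apply/idP/andP => [fF|[FD /eqP cF]].
  by split; [case/maxsetP: (fF)|rewrite (pD _ fF)].
have [G fG FG] := cover _ FD; suff -> : F = G by [].
by apply/eqP; rewrite eqEcard FG (pD _ fG) cF leqnn.
Qed.

Lemma npm_pseudo d D : normal_pseudomanifold d D -> pseudo d D.
Proof.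
move=> pm; case: (pm) => [[D0 dD] pD rD _].
have cover s : s \in D -> exists2 G, facet D G & s \subset G.
  by move=> sD; have [G mG sG] := maxset_exists (P := fun s : {set T} => s \in D) sD; exists G.
split=> //.
- move=> s /cover[G fG sG]; exists G; split=> //; last exact: pD.
  by case/maxsetP: fG.
- by move=> F /cover[G fG FG]; rewrite -(pD _ fG) subset_leq_card.
move=> s sD cs; rewrite -(rD s sD cs); apply: eq_card => F.
by rewrite !inE (npm_facet _ pm) andbA.
Qed.

Lemma flag_flagp D : set0 \in D -> flag D -> flagp D.
Proof.
move=> D0 fD G GD.
have [M /minsetP[MD minM] MG] := minset_exists (P := fun s : {set T} => s \notin D) GD.
rewrite /= in MD minM.
have [MV|/subsetPn[u uM uV]] := boolP (M \subset vertices D); last first.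
  by exists u, u; rewrite setUid (subsetP MG) //; split=> //; rewrite inE in uV.
have mf : missing_face D M.
  split=> // s /properP[sM [x xM xs]]; apply/negPn/negP => sD.
  by move: xs; rewrite (minM s sD sM) xM.
have := fD M mf; rewrite leq_eqVlt => /orP[/cards2P[u [w [uw ME]]]|].
  exists u, w; rewrite !(subsetP MG) ?ME ?set21 ?set22 //; split=> //.
  by rewrite -ME.
rewrite ltnS leq_eqVlt => /orP[/cards1P[u ME]|].
  by exists u, u; rewrite setUid (subsetP MG) ?ME ?set11 //; split=> //; rewrite -ME.
by rewrite ltnS leqn0 cards_eq0 => /eqP M0; rewrite M0 D0 in MD.
Qed.

Lemma in_link D tau F : (F \in link D tau) = [&& F \in D, F :|: tau \in D & [disjoint F & tau]].
Proof. by rewrite !inE setI_eq0. Qed.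

Lemma in_linkd D tau F : downset D ->
  (F \in link D tau) = (F :|: tau \in D) && [disjoint F & tau].
Proof.
move=> dD; rewrite in_link; case: (boolP (_ :|: _ \in D)) => [FD|]; rewrite ?andbF //=.
by rewrite (dD _ _ FD (subsetUl _ _)).
Qed.

Lemma cardsU_disjoint (A B : {set T}) : [disjoint A & B] -> #|A :|: B| = (#|A| + #|B|)%N.
Proof. by move=> dAB; rewrite cardsU disjoint_setI0 // cards0 subn0. Qed.

Lemma setUDK (A B : {set T}) : [disjoint A & B] -> (A :|: B) :\: B = A.
Proof. by move=> dAB; rewrite setDUl setDv setU0; apply/setDidPl. Qed.

Lemma setDUsub (A B : {set T}) : B \subset A -> A :\: B :|: B = A.
Proof.
move=> BA; apply/setP => x; rewrite !inE; case: (boolP (x \in B)) => [/(subsetP BA)->|].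
  by rewrite orbT.
by rewrite orbF.
Qed.

Lemma link_pseudo d D tau : pseudo d D -> tau \in D -> pseudo (d - #|tau|) (link D tau).
Proof.
case=> dD D0 cD leD rD tD; split.
- move=> F G; rewrite !in_linkd // => /andP[FD dF] GF; apply/andP; split.
    by apply: dD FD _; apply: setSU.
  exact: disjointWl dF.
- by rewrite in_linkd // set0U tD disjoints_subset sub0set.
- move=> s; rewrite in_linkd // => /andP[sD ds]; have [F [FD sF cF]] := cD _ sD.
  move: sF; rewrite subUset => /andP[sF tF]; exists (F :\: tau); split.
  + rewrite in_linkd // setDUsub // FD.
    by rewrite disjoint_sym disjointDs.
  + by rewrite subsetD sF.
  by rewrite cardsD (setIidPr tF) cF.
- move=> F; rewrite in_linkd // => /andP[FD dF].
  by rewrite leq_subRL ?subset_leq_card // ?leD // addnC -cardsU_disjoint // leD.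
move=> s; rewrite in_linkd // => /andP[sD ds] cs.
have td : (#|tau| < d)%N by rewrite -subn_gt0 -cs.
have cs' : #|s :|: tau|.+1 = d by rewrite cardsU_disjoint // -addSn cs subnK // ltnW.
rewrite -(rD _ sD cs') -[LHS](card_in_imset (f := fun F => F :|: tau)); last first.
  move=> F G /setIdP[+ _] /setIdP[+ _]; rewrite !in_linkd // => /andP[_ dF] /andP[_ dG] e.
  by rewrite -(setUDK dF) e setUDK.
apply: eq_card => F; apply/imsetP/idP => [[G + ->]|].
  rewrite inE in_linkd // => /and3P[/andP[GD dG] /eqP cG sG].
  rewrite inE GD cardsU_disjoint // cG subnK ?(ltnW td) // eqxx /=.
  exact: setSU.
rewrite inE => /and3P[FD /eqP cF]; rewrite subUset => /andP[sF tF].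
have FE := setDUsub tF.
exists (F :\: tau); last by rewrite FE.
rewrite inE in_linkd // FE FD disjoint_sym disjointDs /= cardsD (setIidPr tF) cF eqxx /=.
by rewrite subsetD sF.
Qed.

Lemma link_flagp D tau : downset D -> flagp D -> tau \in D -> flagp (link D tau).
Proof.
move=> dD fD tD G; rewrite in_linkd // negb_and => GD.
have [dG|] := boolP [disjoint G & tau]; last first.
  rewrite -setI_eq0 => /set0Pn[u]; rewrite inE => /andP[uG ut].
  exists u, u; split=> //; rewrite setUid in_linkd // negb_and -setI_eq0 orbC.
  by apply/orP; left; apply/set0Pn; exists u; rewrite !inE eqxx.
rewrite dG orbF in GD; have [u [w [uG wG uw]]] := fD _ GD.
have notin x y : [set x; y] \notin D -> x \in G -> y \in G :|: tau ->
    exists u w, [/\ u \in G, w \in G & [set u; w] \notin link D tau].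
  move=> xy xG; rewrite inE => /orP[yG|yt].
    exists x, y; split=> //; rewrite in_linkd // negb_and; apply/orP; left.
    by apply: contra xy => xy; apply: dD xy (subsetUl _ _).
  exists x, x; split=> //; rewrite setUid in_linkd // negb_and; apply/orP; left.
  apply: contra xy => xy; apply: dD xy _.
  by rewrite subUset !sub1set !inE eqxx yt orbT.
case/setUP: (uG) => [uG'|ut]; first exact: (notin u w).
case/setUP: (wG) => [wG'|wt]; first by apply: (notin w u) => //; rewrite setUC.
by case/negP: uw; apply: dD tD _; rewrite subUset !sub1set ut.
Qed.

(** Exchange u for w across the ridge opposite to u in a facet F containing [u |: tau]. Were u and w
    adjacent, flagness would make [w |: F] a face with d + 1 vertices. *)
Lemma nonadjacent_exists d D tau u : pseudo d D -> flagp D -> u \notin tau -> u |: tau \in D ->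
  exists w, [/\ w \notin tau, w |: tau \in D & [set u; w] \notin D].
Proof.
case=> dD D0 cD leD rD fD ut uD.
have [F [FD uF cF]] := cD _ uD; move: uF; rewrite subUset sub1set => /andP[uF tF].
have cFu : #|F :\ u|.+1 = d by rewrite -cF (cardsD1 u F) uF.
have := rD _ (dD _ _ FD (subsetDl _ _)) cFu.
rewrite (cardsD1 F) !inE FD cF eqxx subsetDl /= add1n => -[] /eqP/cards1P[F' FE].
have : F' \in [set F'] by rewrite set11.
rewrite -FE !inE => /and4P[F'F F'D /eqP cF' sF'].
have cD1 : #|F' :\: (F :\ u)| == 1%N.
  by rewrite cardsD (setIidPr sF') cF' -cFu subSn // subnn.
have [w wE] := cards1P cD1.
have : w \in F' :\: (F :\ u) by rewrite wE set11.
rewrite !inE negb_and negbK => /andP[/orP wF wF'].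
have F'E : F' = w |: (F :\ u).
  by rewrite -wE setDUsub.
have uw : u != w.
  apply: contraNneq F'F => uw; by rewrite F'E -uw setD1K.
have wF2 : w \notin F by case: wF => // /eqP e; rewrite e eqxx in uw.
exists w; split.
- by apply: contra wF2; apply: (subsetP tF).
- apply: dD F'D _; rewrite F'E; apply: setUS; rewrite subsetD1 tF //.
apply/negP => uwD; have FwD : w |: F \in D.
  apply/negPn/negP => /fD[x [y [xF yF]]]; case/negP.
  have key a : a \in F -> [set a; w] \in D.
    move=> aF; have [->//|au] := eqVneq a u.
    by apply: dD F'D _; rewrite F'E subUset !sub1set !inE eqxx aF au orbT.
  have wwD : [set w; w] \in D by apply: dD uwD _; rewrite setUid sub1set set22.
  case/setU1P: xF => [->|xF]; case/setU1P: yF => [->|yF].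
  - exact: wwD.
  - by rewrite setUC; apply: key.
  - exact: key.
  by apply: dD FD _; rewrite subUset !sub1set xF.
by have := leD _ FwD; rewrite cardsU1 wF2 cF add1n ltnn.
Qed.

End Pseudo.

Section LowerBound.
Variables (K0 K : fieldType) (char2 : 2%N \in [pchar K0]) (i : {rmorphism K0 -> K}).
Variables (T : finType) (t0 : T -> K0) (t : T -> K) (t02 : ind2 t0) (t2 : ind2 t).
Variables (D : {set {set T}}) (S : {set T}) (d k : nat).
Local Notation P := {mpoly K[#|T|]}.
Local Notation E := (trunc K #|T| k.+3).
Hypotheses (pD : pseudo d D) (fD : flagp D) (kd : (k.+2.*2 < d)%N).
Hypothesis Sind : forall u v, u \in S -> v \in S -> u != v -> [set u; v] \notin D.
Hypothesis SV : forall v, v \in S -> [set v] \in D.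
Hypothesis tE : forall w, w \notin S -> t w = i (t0 w).
Hypothesis tv : forall v, v \in S -> transc i (t v).

Let dD : downset D. Proof. by case: pD. Qed.

Definition Jpred (A : {set {set T}}) (e : E) : Prop :=
  temb e \is k.+2.-homog /\ inJ t A d.+1 (temb e).
Definition Xpred v (e : E) : Prop := exists2 q : P, q \is k.+1.-homog & temb e = xv K v * q.

Definition vs_spec (Q : E -> Prop) (U : {vspace E}) : Prop := forall e, e \in U <-> Q e.

Lemma Jspace A : exists U, vs_spec (Jpred A) U.
Proof.
apply: subspace_exists; first by rewrite /Jpred linear0; split; [exact: rpred0|exact: inJ0].
move=> a u v [hu Ju] [hv Jv]; rewrite /Jpred linearP; split.
  by rewrite rpredD // rpredZ.
by apply: inJD => //; apply: inJZ.
Qed.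

Lemma Xspace v : exists U, vs_spec (Xpred v) U.
Proof.
apply: subspace_exists; first by exists 0; rewrite ?rpred0 // linear0 mulr0.
move=> a u w [p hp pE] [q hq qE]; exists (a *: p + q); first by rewrite rpredD // rpredZ.
by rewrite linearP /= pE qE mulrDr scalerAr.
Qed.

Lemma star_sub (A B : {set T}) : A \subset B -> star D B \subset star D A.
Proof.
move=> AB; apply/subsetP => F; rewrite !inE => /andP[-> FB] /=.
by apply: dD FB _; apply: setUS.
Qed.

Lemma eqD_star_nonadj (A : {set T}) u w q : w \in A -> [set u; w] \notin D ->
  eqD (star D A) (xv K u * q) 0.
Proof.
move=> wA uw F; rewrite inE => /andP[_ FA]; rewrite rmorphM /= restr_xv rmorph0.
case: ifP => [uF|_]; last by rewrite mul0r.
by case/negP: uw; apply: dD FA _; rewrite subUset !sub1set !inE uF wA orbT.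
Qed.

Lemma tproj_homogK (p : P) : p \is k.+2.-homog -> temb (tproj k.+3 p) = p.
Proof. by move=> hp; apply: tprojK; apply: homog_msize_le. Qed.

(** [key_lemma] takes a link with facets of size 2(k + 2), so tau is enlarged inside a facet; what
    is outside the ideal of the smaller star is outside that of the larger one. *)
Lemma key_face (tau : {set T}) v : v \in S -> v \in tau -> tau \in D -> (#|tau| + k.+2.*2 <= d)%N ->
  exists u c, [/\ u \notin tau, u |: tau \in D, c \is k.-homog
    & ~ inJ t (star D tau) d.+1 (xv K v * xv K u * c)].
Proof.
move=> vS vt tD lt; case: (pD) => _ D0 cD leD rD.
have [F [FD tF cF]] := cD _ tD.
have [|Q QF cQ] := @exists_subset _ (F :\: tau) (d - k.+2.*2 - #|tau|).
  by rewrite cardsD (setIidPr tF) cF leq_sub2r // leq_subr.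
move: QF; rewrite subsetD => /andP[QF dQ].
pose tau' := Q :|: tau.
have t'D : tau' \in D by apply: dD FD _; rewrite subUset QF.
have ct' : (#|tau'| + k.+2.*2)%N = d.
  rewrite cardsU_disjoint // cQ subnK ?subnK //; first exact: ltnW.
  by rewrite leq_subRL 1?addnC // ltnW.
have tt' : tau \subset tau' by apply: subsetUr.
have vt' : v \in tau' by apply: (subsetP tt').
have d'E : (d - #|tau'|)%N = k.+2.*2 by rewrite -ct' addKn.
have pL := link_pseudo pD t'D; rewrite d'E in pL; case: (pL) => dL L0 cL leL rL.
have fL := link_flagp dD fD t'D.
have [u [c [uL hc nJ]]] : exists u c, [/\ [set u] \in link D tau', c \is k.-homog
    & ~ inJ t (star D tau') d.+1 (xv K v * xv K u * c)].
  apply: (@key_lemma K0 K i T t0 t D tau' v d k.+2.*2 k) => //.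
  - move=> w; rewrite in_linkd // => /andP[wD dw]; apply: tE; apply/negP => wS.
    have vw : w != v.
      by apply: contraTneq dw => ->; rewrite disjoints1 negbK.
    case/negP: (Sind wS vS vw); apply: dD wD _.
    by rewrite subUset !sub1set !inE eqxx /= ; move: vt'; rewrite !inE => ->; rewrite orbT.
  - exact: tv.
  - by move=> s sL cs; rewrite rL.
  have [G [GL _ cG]] := cL _ L0; by exists G.
move: uL; rewrite in_linkd // disjoints1 => /andP[uD ut'].
exists u, c; split=> //.
- by apply: contra ut'; apply: (subsetP tt').
- by apply: dD uD _; apply: setUS.
by move=> J; apply: nJ; apply: inJ_sub J; apply: star_sub.
Qed.

(* By [key_face] some multiple of xv v * xv u lies outside the ideal of the star of
   tau, but inside the one of the star of w |: tau for a nonneighbour w of u; so the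
   intersection grows strictly along a chain of faces containing v. *)
Lemma chain_bound v X n (tau : {set T}) J : v \in S -> vs_spec (Xpred v) X -> v \in tau -> tau \in D ->
  (#|tau| + n + k.+2.*2)%N = d -> vs_spec (Jpred (star D tau)) J ->
  (\dim (X :&: J) + n.+1 <= \dim X)%N.
Proof.
move=> vS XP; elim: n tau J => [|n IH] tau J vt tD ct JP.
all: have [|u [c [ut uD hc nJ]]] := key_face vS vt tD.
  by rewrite -ct addn0.
2: by rewrite -ct leq_add2r leq_addr.
all: have hq : xv K u * c \is k.+1.-homog by apply: (@dhomogM _ _ _ 1); rewrite ?xv_homog.
all: have hf : xv K v * xv K u * c \is k.+2.-homog
       by rewrite -mulrA; apply: (@dhomogM _ _ _ 1); rewrite ?xv_homog.
all: pose e := tproj k.+3 (xv K v * xv K u * c).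
all: have eX : e \in X by apply/XP; exists (xv K u * c); rewrite // tproj_homogK // mulrA.
all: have eJ : e \notin J by apply/negP => /JP[_]; rewrite tproj_homogK.
  rewrite addn1 ltnNge; apply: contra eJ => le.
  have /eqP e' : (X :&: J == X)%VS by rewrite eqEdim capvSl.
  by move: eX; rewrite -e' memv_cap => /andP[].
have [w [wt wD uw]] := nonadjacent_exists pD fD ut uD.
have [J' J'P] := Jspace (star D (w |: tau)).
have := IH (w |: tau) J' _ wD _ J'P; rewrite !inE vt orbT cardsU1 wt => /(_ isT).
rewrite add1n addSnnS => /(_ ct); apply: leq_trans; rewrite addnS -addSn leq_add2r.
have sJ : (X :&: J <= X :&: J')%VS.
  apply: capvS => //; apply/subvP => x /JP[hx Jx]; apply/J'P; split=> //.
  by apply: inJ_sub Jx; apply: star_sub; apply: subsetUr.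
rewrite ltnNge; apply: contra eJ => le.
have /eqP e' : (X :&: J == X :&: J')%VS by rewrite eqEdim sJ.
suff : e \in (X :&: J)%VS by rewrite memv_cap => /andP[].
rewrite e' memv_cap eX; apply/J'P; rewrite /Jpred tproj_homogK //; split=> //.
by apply: inJ0; rewrite -mulrA mulrCA; apply: (@eqD_star_nonadj _ u w) => //; rewrite setU11.
Qed.

(* The multiples of xv v vanish on the star of any other vertex of S, hence the
   contributions of the vertices of S add up. *)
Lemma lower_bound (W J : {vspace E}) : vs_spec (fun e => temb e \is k.+2.-homog) W ->
  vs_spec (Jpred D) J -> (\dim J + (d - k.+2.*2) * #|S| <= \dim W)%N.
Proof.
move=> WP JP.
have [r rE] : exists r, (d - k.+2.*2)%N = r.+1.
  by exists (d - k.+2.*2).-1; rewrite prednK // subn_gt0.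
(* The last clause keeps Y in the ideal of the star of each vertex still to come, so that adding X
   for such a vertex gains at least the codimension of [X :&: Jv] in X. *)
suff H (s : seq T) : uniq s -> {subset s <= S} -> exists Y : {vspace E},
   [/\ (Y <= W)%VS, (\dim J + (d - k.+2.*2) * size s <= \dim Y)%N &
    forall v, v \in S -> v \notin s -> forall e, e \in Y -> Jpred (star D [set v]) e].
  have [||Y [YW dY _]] := H (enum S); first exact: enum_uniq.
    by move=> x; rewrite mem_enum.
  by rewrite cardE; apply: leq_trans dY _; apply: dimvS.
elim: s => [_ _|v s IH /= /andP[vs us] sS].
  exists J; split; first by apply/subvP => e /JP[he _]; apply/WP.
    by rewrite muln0 addn0.
  move=> v vS _ e /JP[he Je]; split=> //; apply: inJ_sub Je.
  by apply/subsetP => F; rewrite inE => /andP[].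
have [|Y [YW dY YJ]] := IH us; first by move=> x xs; apply: sS; rewrite inE xs orbT.
have vS : v \in S by apply: sS; rewrite inE eqxx.
have [X XP] := Xspace v; have [Jv JvP] := Jspace (star D [set v]).
exists (Y + X)%VS; split.
- rewrite subv_add YW; apply/subvP => e /XP[q hq qE]; apply/WP; rewrite qE.
  by apply: (@dhomogM _ _ _ 1); rewrite ?xv_homog.
- have cv : (#|[set v]| + r + k.+2.*2)%N = d.
    by rewrite cards1 add1n -rE subnK // ltnW.
  have := chain_bound vS XP (set11 v) (SV vS) cv JvP.
  rewrite -rE => dX; have := dimv_sum_cap Y X => dYX.
  have YX : (\dim (Y :&: X) <= \dim (X :&: Jv))%N.
    apply: dimvS; rewrite capvC; apply: capvS => //; apply/subvP => e eY.
    by apply/JvP; apply: YJ.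
  rewrite mulnS addnCA addnC -(leq_add2r (\dim (Y :&: X))) dYX -addnA.
  apply: leq_add dY _; rewrite addnC; apply: leq_trans dX; by rewrite leq_add2r.
move=> w wS; rewrite inE negb_or => /andP[wv ws] e /memv_addP[y yY [x xX ->]].
have [hy Jy] := YJ w wS ws y yY; have /XP[q hq qE] := xX.
rewrite /Jpred linearD /= qE; split.
  by rewrite rpredD //; apply: (@dhomogM _ _ _ 1); rewrite ?xv_homog.
apply: inJD => //; apply: inJ0; apply: (@eqD_star_nonadj _ v w); rewrite ?set11 //.
by apply: Sind => //; rewrite eq_sym.
Qed.

End LowerBound.

(** * Hilbert functions and the upper bound *)

(** Multiplication of the generating series by 1 - t. *)
Definition nabla (f : nat -> int) (n : nat) : int := if n is n'.+1 then f n - f n' else f 0%N.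

Lemma nabla_ext f g : f =1 g -> nabla f =1 nabla g.
Proof. by move=> e [|n] /=; rewrite !e. Qed.

Lemma iter_nabla_ext r f g : f =1 g -> iter r nabla f =1 iter r nabla g.
Proof. by move=> e; elim: r => //= r IH; apply: nabla_ext. Qed.

Lemma iter_nabla_sum (I : finType) (A : pred I) r (f : I -> nat -> int) n :
  iter r nabla (fun n => \sum_(j | A j) f j n) n = \sum_(j | A j) iter r nabla (f j) n.
Proof.
elim: r n => //= r IH n; rewrite (nabla_ext IH); case: n => [|n] //=.
by rewrite -sumrB.
Qed.

(* [comps k n] counts the compositions of n into k positive parts. *)
Fixpoint comps (k n : nat) : nat :=
  match k, n with
  | 0, _ => (n == 0%N)
  | k'.+1, 0 => 0
  | k'.+1, n'.+1 => comps k' n' + comps k n'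
  end.

Lemma nabla_comps k n : nabla (fun n => (comps k.+1 n)%:Z) n.+1 = (comps k n)%:Z.
Proof. by rewrite /= PoszD addrK. Qed.

Definition delta (k n : nat) : int := (n == k)%:Z.

Definition shift (f : nat -> int) (n : nat) : int := if n is n'.+1 then f n' else 0.

Lemma nabla_shift f : nabla (shift f) =1 shift (nabla f).
Proof. by case=> [|[|n]] //=; rewrite subr0. Qed.

(** The generating series of [comps k] is (t / (1 - t))^k. *)
Lemma iter_nabla_comps k : iter k nabla (fun n => (comps k n)%:Z) =1 delta k.
Proof.
elim: k => [|k IH] n /=; first by rewrite /delta; case: n.
rewrite -iterS iterSr.
have e : nabla (fun n => (comps k.+1 n)%:Z) =1 shift (fun n => (comps k n)%:Z).
  by case=> [//|m]; rewrite nabla_comps.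
rewrite (iter_nabla_ext k e).
have sh r f : iter r nabla (shift f) =1 shift (iter r nabla f).
  by elim: r => //= r IHr m; rewrite (nabla_ext IHr) nabla_shift.
by rewrite sh; case: n => [//|n] /=; rewrite IH.
Qed.

(** These are the coefficients of t^k (1 - t)^e, that is, those of (X - 1)^e in reversed order. *)
Lemma iter_nabla_delta e k n :
  iter e nabla (delta k) n = if (n <= k + e)%N then (('X - 1) ^+ e : {poly int})`_(k + e - n) else 0.
Proof.
have szq e' : (size (('X - 1) ^+ e' : {poly int}) <= e'.+1)%N.
  by rewrite -polyC1 size_exp_XsubC.
elim: e n => [|e IH] n /=.
  rewrite expr0 coef1 addn0 /delta; case: (ltngtP n k) => [lt|lt|->].
  - by rewrite -[_ == _](subn_eq0 k n) ?[(k - n == 0)%N]eqn0Ngt ?subn_gt0 ?lt.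
  - by [].
  - by rewrite subnn.
rewrite (nabla_ext IH) exprS mulrBl mul1r.
case: n => [|n] /=.
  by rewrite !subn0 addnS coefB coefXM /= [_`_(k + e).+1]nth_default ?subr0 // (leq_trans (szq e)) // ltnS leq_addl.
rewrite !addnS ltnS subSS coefB coefXM.
have [le|lt] := leqP n.+1 (k + e).
  by rewrite ltnW // -[(k + e - n)%N]prednK ?subn_gt0 //= subnS.
rewrite ltnS leq_eqVlt in lt; case: eqP lt => [->|ne /= lt].
  by rewrite leqnn subnn /= !sub0r.
by rewrite leqNgt lt subr0.
Qed.

Section Counting.
Variables (T : finType) (N : nat).

(** Dividing a monomial by a fixed variable of its support either keeps the support or removes that
    variable from it, which is the recursion of [comps]. *)
Lemma card_msup (s : {set T}) n : (n < N)%N ->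
  #|[set m : 'X_{1..#|T| < N} | (msup m == s) && (mdeg m == n)]| = comps #|s| n.
Proof.
elim: n s => [|n IH] s nN.
  have [->|[v vs]] := set_0Vmem s.
    rewrite cards0 /=; have lt0 : (mdeg (0%MM : 'X_{1..#|T|}) < N)%N by rewrite mdeg0.
    rewrite -(cards1 (BMultinom lt0)).
    apply: eq_card => m; rewrite !inE bmeqP /= mdeg_eq0.
    case: ((m : 'X_{1..#|T|}) =P 0%MM) => [->|]; last by rewrite andbF.
    rewrite andbT; apply/eqP/setP => v; rewrite !inE /mexp mnm0E //.
  have -> : comps #|s| 0 = 0%N by rewrite (cardsD1 v) vs.
  apply/eqP; rewrite cards_eq0; apply/eqP/setP => m; rewrite !inE mdeg_eq0.
  apply/negbTE/negP => /andP[/eqP ms /eqP m0]; move: vs.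
  by rewrite -ms inE /mexp m0 mnm0E.
have [->|[v vs]] := set_0Vmem s.
  rewrite cards0 /=; apply/eqP; rewrite cards_eq0; apply/eqP/setP => m; rewrite !inE.
  apply/negbTE/negP => /andP[/eqP ms /eqP dm].
  by have [u [m' [+ _ _]]] := msup_exists dm; rewrite ms inE.
have nN' : (n < N)%N by apply: ltnW.
pose s' := s :\ v; have sE : s = v |: s' by rewrite setD1K.
have cs : #|s| = #|s'|.+1 by rewrite (cardsD1 v) vs.
rewrite cs /= -cs -!IH //.
pose f (m : 'X_{1..#|T| < N}) := insubd m (U_(enum_rank v) + m)%MM.
have fE (m : 'X_{1..#|T| < N}) : mdeg m = n -> f m = (U_(enum_rank v) + m)%MM :> 'X_{1..#|T|}.
  move=> dm; rewrite /f /insubd insubT //= mdegD mdeg1 dm add1n //.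
rewrite -[RHS]cardsUI [X in (_ + X)%N](_ : _ = 0%N); last first.
  apply/eqP; rewrite cards_eq0; apply/eqP/setP => m; rewrite !inE.
  apply/negbTE/negP => /andP[/andP[/eqP ms _] /andP[/eqP ms' _]].
  by move: vs; rewrite -ms' ms !inE eqxx.
rewrite addn0 -[RHS](card_in_imset (f := f)); last first.
  have dn (m : 'X_{1..#|T| < N}) : m \in [set m0 : 'X_{1..#|T| < N} | (msup m0 == s') && (mdeg m0 == n)]
     :|: [set m0 : 'X_{1..#|T| < N} | (msup m0 == s) && (mdeg m0 == n)] -> mdeg m = n.
    by rewrite !inE => /orP[] /andP[_ /eqP].
  move=> m m' /dn dm /dn dm' e; apply/eqP; rewrite bmeqP.
  by rewrite -(eqm_add2l U_(enum_rank v)) -!fE // e.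
apply: eq_card => m; rewrite inE; apply/andP/imsetP => [[/eqP ms /eqP dm]|[m' + ->]].
  have vm : (U_(enum_rank v) <= m)%MM.
    by move: vs; rewrite -ms inE lep1mP.
  have mE : (m : 'X_{1..#|T|}) = (U_(enum_rank v) + (m - U_(enum_rank v)))%MM by rewrite addmC submK.
  have dm' : mdeg (m - U_(enum_rank v)) = n.
    by move: dm; rewrite [in X in X -> _]mE mdegD mdeg1 add1n => -[].
  have lt : (mdeg (m - U_(enum_rank v)) < N)%N by rewrite dm'.
  exists (BMultinom lt); last first.
    by apply/eqP; rewrite bmeqP fE //= -mE.
  rewrite !inE /= dm' eqxx !andbT.
  have := msup_add v (m - U_(enum_rank v)); rewrite -mE ms => sE'.
  have [vm'|vm'] := boolP (v \in msup (m - U_(enum_rank v))).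
    by apply/orP; right; rewrite sE' eq_sym; apply/eqP/setUidPr; rewrite sub1set.
  by apply/orP; left; rewrite /s' sE' setU1K // eqxx.
rewrite !inE => /orP[] /andP[/eqP ms /eqP dm]; rewrite fE // msup_add ms mdegD mdeg1 dm add1n.
  by rewrite -sE !eqxx.
by rewrite eqxx; split=> //; apply/eqP/setUidPr; rewrite sub1set.
Qed.

End Counting.

Lemma dim_support (K : fieldType) (I : finType) (B : {set I}) (U : {vspace {ffun I -> K^o}}) :
  (forall e : {ffun I -> K^o}, e \in U <-> forall m, m \notin B -> e m = 0) -> \dim U = #|B|.
Proof.
elim/setU1_ind: B U => [|x B xB IH] U UP.
  rewrite cards0; apply/eqP; rewrite dimv_eq0; apply/eqP/vspaceP => e; rewrite memv0.
  apply/idP/eqP => [eU|->]; last exact: mem0v.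
  by apply/ffunP => m; rewrite ffunE; move/UP: eU => -> //; rewrite inE.
have [U' U'P] : exists U' : {vspace {ffun I -> K^o}}, forall e, e \in U' <-> forall m, m \notin B -> e m = 0.
  apply: (@subspace_exists _ _ (fun e : {ffun I -> K^o} => forall m, m \notin B -> e m = 0)).
    by move=> m _; rewrite ffunE.
  by move=> a u v hu hv m mB; rewrite !ffunE hu // hv // scaler0 addr0.
pose dx : {ffun I -> K^o} := [ffun m => (m == x)%:R].
have dx0 : dx != 0.
  by apply/eqP => /ffunP/(_ x); rewrite !ffunE eqxx => /eqP; rewrite oner_eq0.
have cap0 : (U' :&: <[dx]> = 0)%VS.
  apply/eqP; rewrite -subv0; apply/subvP => e; rewrite memv_cap memv0 => /andP[/U'P eU /vlineP[a e']].
  have a0 : a = 0 by have := eU x xB; rewrite e' !ffunE eqxx /GRing.scale /= mulr1.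
  by rewrite e' a0 scale0r.
have -> : U = (U' + <[dx]>)%VS.
  apply/vspaceP => e; apply/idP/memv_addP => [/UP eU|[u /U'P uU [_ /vlineP[a ->] ->]]].
    exists (e - e x *: dx); last first.
      by exists (e x *: dx); [apply: memvZ; apply: memv_line|rewrite subrK].
    apply/U'P => m mB; rewrite !ffunE; have [->|mx] := eqVneq m x.
      by rewrite /GRing.scale /= mulr1 subrr.
    by rewrite scaler0 subr0 eU // !inE negb_or mx.
  apply/UP => m; rewrite !inE negb_or => /andP[mx mB]; rewrite !ffunE uU // (negPf mx).
  by rewrite scaler0 addr0.
by rewrite dimv_disjoint_sum // (IH U' U'P) dim_vline dx0 cardsU1 xB addnC.
Qed.

(** The Hilbert series of the face ring is the sum of (t / (1 - t))^|s| over the faces s;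
    multiplying by (1 - t)^d gives the h-numbers, and the last factor takes their differences. *)
Lemma gnum_nabla (T : finType) (D : {set {set T}}) d i :
  (forall F, F \in D -> (#|F| <= d)%N) -> (0 < i <= d)%N ->
  gnum d D i = iter d.+1 nabla (fun n => \sum_(s in D) (comps #|s| n)%:Z) i.
Proof.
move=> leD /andP[i0 id].
have H n : (n <= d)%N -> iter d nabla (fun n => \sum_(s in D) (comps #|s| n)%:Z) n = hnum d D n.
  move=> nd; rewrite iter_nabla_sum /hnum /hpoly coef_sum.
  have e (s : {set T}) : s \in D -> iter d nabla (fun n => (comps #|s| n)%:Z) n =
      (('X - 1) ^+ (d - #|s|) : {poly int})`_(d - n).
    move=> sD; have sd := leD _ sD.
    rewrite -[d in iter d](subnK sd) iterD (iter_nabla_ext _ (iter_nabla_comps _)).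
    by rewrite iter_nabla_delta subnKC // nd.
  rewrite (eq_bigr _ e) (partition_big (fun s : {set T} => inord #|s| : 'I_d.+1) predT) //=.
  apply: eq_bigr => k _; rewrite coefZ /fnum.
  rewrite (eq_bigr (fun _ => (('X - 1) ^+ (d - k) : {poly int})`_(d - n))); last first.
    by move=> s /andP[sD /eqP <-]; rewrite inordK // ltnS leD.
  rewrite sumr_const -[LHS]mulr_natl; congr (_%:R * _).
  apply: eq_card => s; rewrite !inE; apply: andb_id2l => sD.
  by rewrite -(inj_eq val_inj) /= inordK // ltnS leD.
case: i i0 id => // i _ id; rewrite /= !H //; exact: ltnW.
Qed.

Section UpperBound.
Variables (K : fieldType) (T : finType) (t : T -> K).
Variables (D : {set {set T}}) (d i : nat).
Local Notation P := {mpoly K[#|T|]}.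
Local Notation E := (trunc K #|T| i.+1).
Local Notation theta := (theta t).
Hypotheses (dD : downset D) (D0 : set0 \in D) (Dle : forall F, F \in D -> (#|F| <= d)%N).

(** theta_d is asked to be injective only from degree i - 1 to degree i, the one step in which
    [dim_upper] multiplies by it. *)
Definition regular_upto : Prop := forall r n (y : P), (n < i)%N ->
  (r < d \/ r = d /\ n.+1 = i)%N -> y \is n.-homog ->
  inJ t D r (theta r * y) -> inJ t D r y.

Definition Wpred n (e : E) : Prop := temb e \is n.-homog.
Definition Jrpred r n (e : E) : Prop := temb e \is n.-homog /\ inJ t D r (temb e).

Lemma Wspace_exists n : exists U : {vspace E}, forall e, e \in U <-> Wpred n e.
Proof.
apply: subspace_exists; first by rewrite /Wpred linear0 rpred0.
by move=> a u v hu hv; rewrite /Wpred linearP rpredD // rpredZ.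
Qed.

Lemma Jrspace_exists rn : exists U : {vspace E}, forall e, e \in U <-> Jrpred rn.1 rn.2 e.
Proof.
apply: subspace_exists; first by rewrite /Jrpred linear0; split; [exact: rpred0|exact: inJ0].
move=> a u v [hu Ju] [hv Jv]; rewrite /Jrpred linearP; split.
  by rewrite rpredD // rpredZ.
by apply: inJD => //; apply: inJZ.
Qed.

Definition theta_fun r (e : E) : E := tproj i.+1 (theta r * temb e).

Fact theta_fun_linear r : linear (theta_fun r).
Proof.
by move=> a u v; rewrite /theta_fun linearP /= mulrDr -scalerAr linearP.
Qed.
HB.instance Definition _ r := GRing.isLinear.Build K E E *:%R (theta_fun r) (theta_fun_linear r).

Lemma temb_theta r n e : (n < i)%N -> temb e \is n.-homog -> temb (theta_fun r e) = theta r * temb e.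
Proof.
move=> ni he; apply: tprojK; apply: (@leq_trans n.+2) => //; apply: homog_msize_le.
by apply: (@dhomogM _ _ _ 1); rewrite ?theta_homog.
Qed.

Lemma theta_homogM r n (q : P) : q \is n.-homog -> theta r * q \is n.+1.-homog.
Proof. by move=> hq; apply: (@dhomogM _ _ _ 1); rewrite ?theta_homog. Qed.

(** J3 is J2 plus the image of W; by regularity this image meets J2 in the image of J1, and the
    kernel on W lies in J1. The rest is rank-nullity. *)
Lemma dim_step r n (W J1 J2 J3 : {vspace E}) : (n < i)%N ->
  (forall y : P, y \is n.-homog -> inJ t D r (theta r * y) -> inJ t D r y) ->
  (forall e, e \in W <-> Wpred n e) -> (forall e, e \in J1 <-> Jrpred r n e) ->
  (forall e, e \in J2 <-> Jrpred r n.+1 e) -> (forall e, e \in J3 <-> Jrpred r.+1 n.+1 e) ->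
  (\dim J3 + \dim J1 = \dim J2 + \dim W)%N.
Proof.
move=> ni reg WP J1P J2P J3P; pose f : 'End(E) := linfun (theta_fun r).
have fE e : f e = theta_fun r e by rewrite lfunE.
have -> : J3 = (J2 + f @: W)%VS.
  apply/vspaceP => e; apply/idP/memv_addP => [/J3P[he Je]|[u /J2P[hu Ju] [_ /memv_imgP[w /WP hw ->] ->]]].
    have [g [hg eg]] := inJ_homog he Je.
    have gr : temb (tproj i.+1 (g r)) = g r.
      apply: tprojK; apply: (@leq_trans n.+1); last exact: ltnW.
      exact: homog_msize_le.
    have hgr : Wpred n (tproj i.+1 (g r)) by rewrite /Wpred gr.
    exists (e - theta_fun r (tproj i.+1 (g r))); last first.
      exists (theta_fun r (tproj i.+1 (g r))); last by rewrite subrK.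
      by rewrite -fE; apply: memv_img; apply/WP.
    apply/J2P; rewrite /Jrpred linearB /= (temb_theta _ ni hgr) gr; split.
      by rewrite rpredB // theta_homogM.
    exists g => F FD; rewrite rmorphB /= eg // big_ord_recr /= rmorphD /=.
    by rewrite addrK.
  apply/J3P; rewrite /Jrpred linearD /= fE (temb_theta _ ni hw); split.
    by rewrite rpredD // theta_homogM.
  apply: inJD; last exact: inJ_theta.
  have [g eg] := Ju; exists (fun j => if j == r then 0 else g j) => F FD.
  rewrite eg // big_ord_recr /= eqxx mulr0 addr0; congr (restr F _).
  by apply: eq_bigr => j _; rewrite ltn_eqF.
have J1W : (J1 <= W)%VS by apply/subvP => e /J1P[he _]; apply/WP.
have cap : (J2 :&: f @: W = f @: J1)%VS.
  apply/vspaceP => e; rewrite memv_cap; apply/andP/memv_imgP => [[/J2P[_ Je] /memv_imgP[w /WP hw eE]]|[w /J1P[hw Jw] ->]].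
    exists w => //; apply/J1P; split=> //; apply: reg => //.
    by rewrite -(temb_theta _ ni hw) -fE -eE.
  split; last by apply: memv_img; apply/WP.
  apply/J2P; rewrite /Jrpred fE (temb_theta _ ni hw); split; first exact: theta_homogM.
  exact: inJM.
have ker : (W :&: lker f = J1 :&: lker f)%VS.
  apply/vspaceP => e; rewrite !memv_cap; apply: andb_id2r; rewrite memv_ker fE => /eqP e0.
  apply/idP/idP => [/WP he|]; last exact: (subvP J1W).
  apply/J1P; split=> //; apply: reg => //; rewrite -(temb_theta _ ni he) e0 linear0.
  exact: inJ0.
have dW := limg_ker_dim f W; have dJ := limg_ker_dim f J1.
have := dimv_sum_cap J2 (f @: W); rewrite cap => dS.
move: dW dJ dS; rewrite ker.
move: (\dim (J1 :&: lker f)) (\dim (f @: W)) (\dim W) (\dim (f @: J1)) (\dim J1) (\dim (J2 + f @: W)) (\dim J2).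
by move=> a b c e g h j; lia.
Qed.

Definition hilbert n : int := \sum_(s in D) (comps #|s| n)%:Z.

Lemma dim_base n (W J : {vspace E}) : (n <= i)%N ->
  (forall e, e \in W <-> Wpred n e) -> (forall e, e \in J <-> Jrpred 0 n e) ->
  (\dim W)%:Z - (\dim J)%:Z = hilbert n.
Proof.
move=> ni WP JP.
have dW : \dim W = #|[set m : 'X_{1..#|T| < i.+1} | mdeg m == n]|.
  apply: dim_support => e; split=> [/WP/dhomogP he m|he].
    rewrite inE => /eqP mn; apply/eqP; rewrite -coef_temb mcoeff_eq0.
    by apply/negP => /he.
  apply/WP/dhomogP => m; rewrite mcoeff_msupp /temb raddf_sum => nz.
  apply/eqP; apply: contraR nz => mn; apply/eqP/big1 => m' _.
  rewrite /= mcoeffZ mcoeffX; case: eqP => [e'|_]; last by rewrite mulr0.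
  by rewrite he ?mul0r // inE e'.
have dJ : \dim J = #|[set m : 'X_{1..#|T| < i.+1} | (mdeg m == n) && (msup m \notin D)]|.
  apply: dim_support => e; split=> [/JP[/dhomogP he [g eg]] m|he].
    rewrite inE negb_and negbK => /orP[/eqP mn|mD].
      by apply/eqP; rewrite -coef_temb mcoeff_eq0; apply/negP => /he.
    have := congr1 (mcoeff m) (eg _ mD); rewrite big_ord0 rmorph0 mcoeff0 restrE subxx.
    by rewrite coef_temb.
  apply/JP; split; last first.
    apply: inJ0 => F FD; apply/mpolyP => m; rewrite rmorph0 mcoeff0 restrE.
    case: ifP => // mF; rewrite /temb raddf_sum big1 // => m' _.
    rewrite /= mcoeffZ mcoeffX; case: eqP => [e'|_]; last by rewrite mulr0.
    by rewrite he ?mul0r // inE negb_and negbK e' (dD FD mF) orbT.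
  apply/dhomogP => m; rewrite mcoeff_msupp /temb raddf_sum => nz.
  apply/eqP; apply: contraR nz => mn; apply/eqP/big1 => m' _.
  rewrite /= mcoeffZ mcoeffX; case: eqP => [e'|_]; last by rewrite mulr0.
  by rewrite he ?mul0r // inE e' negb_and mn.
have -> : hilbert n = (#|[set m : 'X_{1..#|T| < i.+1} | (mdeg m == n) && (msup m \in D)]|)%:Z.
  rewrite /hilbert -[RHS]natz -sum1_card natr_sum.
  rewrite (partition_big (fun m : 'X_{1..#|T| < i.+1} => msup m) (fun s => s \in D)) /=; last first.
    by move=> m; rewrite inE => /andP[].
  apply: eq_bigr => s sD; rewrite -natr_sum sum1_card natz -(@card_msup T i.+1) //.
  congr Posz; apply: eq_card => m; rewrite inE unfold_in /= inE; case: (msup m =P s) => [->|_]; last by rewrite andbF.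
  by rewrite sD !andbT.
rewrite dW dJ -(cardsID [set m : 'X_{1..#|T| < i.+1} | msup m \in D] [set m : 'X_{1..#|T| < i.+1} | mdeg m == n]).
have -> : [set m : 'X_{1..#|T| < i.+1} | mdeg m == n] :&: [set m : 'X_{1..#|T| < i.+1} | msup m \in D] =
   [set m : 'X_{1..#|T| < i.+1} | (mdeg m == n) && (msup m \in D)] by apply/setP => m; rewrite !inE.
have -> : [set m : 'X_{1..#|T| < i.+1} | mdeg m == n] :\: [set m : 'X_{1..#|T| < i.+1} | msup m \in D] =
   [set m : 'X_{1..#|T| < i.+1} | (mdeg m == n) && (msup m \notin D)].
  by apply/setP => m; rewrite !inE andbC.
by rewrite PoszD addrK.
Qed.

(* Regularity makes multiplication by theta_r injective modulo theta_0, ...,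
   theta_(r-1), so each theta takes a difference of the Hilbert function. *)
Lemma dim_upper (W J : {vspace E}) : regular_upto -> (0 < i <= d)%N ->
  (forall e, e \in W <-> Wpred i e) -> (forall e, e \in J <-> Jrpred d.+1 i e) ->
  (\dim W)%:Z - (\dim J)%:Z = gnum d D i.
Proof.
move=> reg id WP JP; rewrite (gnum_nabla Dle id).
have [Wf WfP] := functional_choice _ Wspace_exists.
have [Jf JfP] := functional_choice _ Jrspace_exists.
have key r n : (n <= i)%N -> (r <= d \/ r = d.+1 /\ n = i)%N ->
    (\dim (Wf n))%:Z - (\dim (Jf (r, n)))%:Z = iter r nabla hilbert n.
  elim: r n => [|r IH] n ni hr; first exact: (dim_base ni (WfP n) (JfP (0%N, n))).
  case: n ni hr => [|n] ni hr.
    have rd : (r <= d)%N by case: hr => [/ltnW//|[[->]]].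
    rewrite iterS /= -IH //; last by left.
    (* In degree 0 the thetas contribute nothing, whatever their number. *)
    congr (_ - (\dim _)%:Z); apply/vspaceP => e; apply/idP/idP => /JfP[he Je]; apply/JfP; split=> //;
      apply: inJ0; exact: (inJ_homog0 he Je).
  have rd : (r <= d)%N by case: hr => [/ltnW//|[[->]]].
  have regr y : y \is n.-homog -> inJ t D r (theta r * y) -> inJ t D r y.
    apply: reg => //; case: hr => [rd'|[[->] ->]]; last by right.
    by left.
  have st := dim_step ni regr (WfP n) (JfP (r, n)) (JfP (r, n.+1)) (JfP (r.+1, n.+1)).
  rewrite iterS /= -!IH //; try by left.
    by move: st; rewrite /=; lia.
  exact: ltnW.
have eW : W = Wf i by apply/vspaceP => e; apply/idP/idP => [/WP|/WfP]; [move/WfP|move/WP].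
have eJ : J = Jf (d.+1, i) by apply/vspaceP => e; apply/idP/idP => [/JP|/JfP]; [move/(JfP (d.+1, i))|move/JP].
by rewrite eW eJ key //; right.
Qed.

End UpperBound.

(** * Regularity in degree two *)

Section OneFace.
Variables (K : fieldType) (char2 : 2%N \in [pchar K]).
Variables (T : finType) (t : T -> K) (tI : injective t).
Local Notation P := {mpoly K[#|T|]}.
Local Notation theta := (theta t).
Implicit Types (p q f g : P) (u v w : T).
Variables (G H : {set T}).
Hypothesis HG : H \subset G.

Let lu u v := lam t (u |: H) v.

(* Elimination of the variables of H by the relations theta_0, ..., theta_(|H|-1). *)
Definition elim_var v : P :=
  if v \in H then \sum_(u in G :\: H) (lu u v / lu u u) *: xv K u
  else if v \in G then xv K v else 0.

Lemma lu_neq0 u : lu u u != 0.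
Proof. by rewrite /lu /lam setU11 invr_neq0 // node_neq0. Qed.

(** The coefficient of x_u is an interpolation sum over [u |: H] divided by [lu u u]; only the top
    power j = |H| survives. *)
Lemma elim_theta j : (j <= #|H|)%N -> psubst elim_var (theta j) =
  (j == #|H|)%:R *: \sum_(u in G :\: H) (lu u u)^-1 *: xv K u.
Proof.
move=> jH; rewrite /theta rmorph_sum /=.
under eq_bigr do rewrite psubstZ psubst_xv.
have out v : v \notin G -> elim_var v = 0.
  by move=> vG; rewrite /elim_var (negPf vG) (contraNF (subsetP HG v) vG).
rewrite (bigID (mem G)) /= [X in _ + X]big1 ?addr0; last by move=> v vG; rewrite out ?scaler0.
rewrite (big_setID H) /= (setIidPr HG).
rewrite [X in X + _](eq_bigr (fun v => \sum_(u in G :\: H) (t v ^+ j * (lu u v / lu u u)) *: xv K u)); last first.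
  by move=> v vH; rewrite /elim_var vH scaler_sumr; apply: eq_bigr => u _; rewrite scalerA.
rewrite exchange_big /= -big_split scaler_sumr; apply: eq_bigr => u /= uGH.
have [uH uG] : u \notin H /\ u \in G by move: uGH; rewrite inE => /andP[].
rewrite /elim_var (negPf uH) uG -scaler_suml -scalerDl scalerA; congr (_ *: _).
have cu : #|u |: H| = #|H|.+1 by rewrite cardsU1 uH.
have := @lagrangeX _ char2 _ t tI (u |: H) j; rewrite cu ltnS => /(_ jH) <-.
rewrite big_setU1 //= mulrDl -/(lu u u) mulfK ?lu_neq0 // addrC mulr_suml.
by congr (_ + _); apply: eq_bigr => v _; rewrite mulrA.
Qed.

Lemma inJ1P r p : inJ t [set G] r p <->
  exists g : nat -> P, restr G p = restr G (\sum_(j < r) theta j * g j).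
Proof.
split=> [[g e]|[g e]]; exists g; first by apply: e; rewrite inE.
by move=> F; rewrite inE => /eqP->.
Qed.

Lemma elim_restr p : psubst elim_var (restr G p) = psubst elim_var p.
Proof.
rewrite /restr psubst_comp; apply: psubst_ext => v; case: ifP => vG.
  by rewrite psubst_xv.
by rewrite rmorph0 /elim_var vG (contraFF (subsetP HG v) vG).
Qed.

Lemma elim_var_inJ v : inJ t [set G] #|H| (xv K v - elim_var v).
Proof.
rewrite /elim_var; case: ifP => vH; last first.
  case: ifP => vG; first by rewrite subrr; apply: inJ0.
  apply: inJ0 => F; rewrite inE => /eqP->.
  by rewrite subr0 restr_xv vG rmorph0.
(* The Lagrange basis polynomial of v on H: modulo nonfaces, the thetas weighted by its coefficients
   add up to x_v plus multiples of variables outside H. *)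
pose L : {poly K} := (node t H v)^-1 *: rootpoly t (H :\ v).
have szL : (size L <= #|H|)%N.
  by apply: leq_trans (size_scale_leq _ _) _; rewrite size_rootpoly (cardsD1 v H) vH.
have LE x : L.[t x] = (node t H v)^-1 * \prod_(u in H :\ v) (t x + t u).
  by rewrite hornerZ horner_rootpoly.
apply/inJ1P; exists (fun j => (L`_j)%:MP).
have -> : \sum_(j < #|H|) theta j * (L`_j)%:MP = \sum_w L.[t w] *: xv K w.
  rewrite (eq_bigr (fun j : 'I_#|H| => \sum_w (L`_j * t w ^+ j) *: xv K w)); last first.
    by move=> j _; rewrite mulrC mul_mpolyC scaler_sumr; apply: eq_bigr => w _; rewrite scalerA.
  rewrite exchange_big; apply: eq_bigr => w _ /=.
  by rewrite -scaler_suml -(horner_coef_wide _ szL).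
have -> : restr G (\sum_w L.[t w] *: xv K w) = restr G (\sum_(w in G) L.[t w] *: xv K w).
  rewrite (bigID (mem G)) /= rmorphD /= [X in _ + X = _](_ : _ = 0) ?addr0 //.
  by rewrite rmorph_sum big1 // => w wG /=; rewrite restrZ restr_xv (negPf wG) scaler0.
rewrite [in RHS](big_setID H) /= (setIidPr HG); congr (restr G _); congr (_ + _).
  rewrite (bigD1 v vH) /= big1 ?addr0 => [|w /andP[wH wv]].
    by rewrite LE mulVf ?scale1r // node_neq0.
  have z : \prod_(u in H :\ v) (t w + t u) = 0.
    by rewrite (big_setD1 w) /= ?addrr_pchar2 ?mul0r // !inE wv.
  by rewrite LE z mulr0 scale0r.
rewrite -sumrN; apply: eq_bigr => u; rewrite inE => /andP[uH uG].
rewrite -scaleNr oppr_pchar2 //; congr (_ *: _).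
have uv : u != v by apply: contraNneq uH => ->.
rewrite LE /lu /lam setU11 !inE vH orbT invrK /node setU1K //.
have -> : (u |: H) :\ v = u |: (H :\ v).
  by apply/setP => x; rewrite !inE; case: (eqVneq x u) => [->|]; rewrite ?uv.
rewrite big_setU1 /=; last by rewrite !inE negb_and uH orbT.
rewrite (bigD1 v vH) /= invfM.
have -> : \prod_(w in H | w != v) (t u + t w) = \prod_(w in H :\ v) (t u + t w).
  by apply: eq_bigl => w; rewrite !inE andbC.
have ? : t u + t v != 0 by rewrite (dt_neq0 char2 tI).
have ? := node_neq0 char2 tI H v; rewrite -/(node t H v).
by rewrite [t v + _]addrC; field; apply/andP.
Qed.

Lemma elim_inJ p : inJ t [set G] #|H| (p - psubst elim_var p).
Proof.
have mulc a b : inJ t [set G] #|H| (a - psubst elim_var a) -> inJ t [set G] #|H| (b - psubst elim_var b) ->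
    inJ t [set G] #|H| (a * b - psubst elim_var (a * b)).
  move=> ha hb; rewrite rmorphM /=.
  have -> : a * b - psubst elim_var a * psubst elim_var b =
     b * (a - psubst elim_var a) + psubst elim_var a * (b - psubst elim_var b) by ring.
  by apply: inJD; apply: inJM.
have c1 : inJ t [set G] #|H| (1 - psubst elim_var 1) by rewrite rmorph1 subrr; apply: inJ0.
apply: (@mpoly_lin_ind _ _ (fun p => inJ t [set G] #|H| (p - psubst elim_var p))).
- move=> a b ha hb; rewrite rmorphD /= opprD addrACA; exact: inJD.
- by move=> c a ha; rewrite psubstZ -scalerBr; apply: inJZ.
- by rewrite rmorph0 subrr; apply: inJ0.
move=> m _; rewrite mpolyX_xv; apply: (big_ind (fun p => inJ t [set G] #|H| (p - psubst elim_var p))) => //.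
move=> v _; elim: (mexp m v) => [|e IH]; first by rewrite expr0.
rewrite exprS; apply: mulc => //; rewrite psubst_xv; exact: elim_var_inJ.
Qed.

Lemma elim_inJP p : inJ t [set G] #|H| p <-> psubst elim_var p = 0.
Proof.
split=> [/inJ1P[g e]|e]; last by have := elim_inJ p; rewrite e subr0.
rewrite -elim_restr e elim_restr rmorph_sum big1 //= => j _.
by rewrite rmorphM /= elim_theta 1?ltnW // ltn_eqF // scale0r mul0r.
Qed.

(** The quotient of K[G] by the first |H| thetas is a polynomial ring in the variables of [G :\: H],
    hence a domain, and theta_|H| is a nonzero linear form in it. *)
Lemma face_regular y : (#|H| < #|G|)%N ->
  inJ t [set G] #|H| (theta #|H| * y) -> inJ t [set G] #|H| y.
Proof.
move=> lt /elim_inJP; rewrite rmorphM /= elim_theta // eqxx scale1r => /eqP.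
rewrite mulf_eq0 => /orP[/eqP e|/eqP e]; last by apply/elim_inJP.
have /subsetPn[u uG uH] : ~~ (G \subset H).
  by apply/negP => /subset_leq_card; rewrite leqNgt lt.
have := congr1 (mcoeff U_(enum_rank u)%MM) e; rewrite raddf_sum mcoeff0 (bigD1 u) /=; last by rewrite inE uH.
rewrite big1 ?addr0 => [|w /andP[_ wu]].
  rewrite mcoeffZ mcoeffXU eqxx mulr1 => /eqP.
  by rewrite invr_eq0 (negPf (lu_neq0 u)).
by rewrite mcoeffZ mcoeffXU (inj_eq enum_rank_inj) (negPf wu) mulr0.
Qed.

End OneFace.

Section OneFace2.
Variables (K : fieldType) (char2 : 2%N \in [pchar K]).
Variables (T : finType) (t : T -> K) (tI : injective t).
Local Notation P := {mpoly K[#|T|]}.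
Local Notation theta := (theta t).
Implicit Types (p q f g y : P) (u v w : T) (G : {set T}).

Lemma one_face_regular G r y : (r < #|G|)%N ->
  inJ t [set G] r (theta r * y) -> inJ t [set G] r y.
Proof.
move=> rG; have [H HG cH] := exists_subset (ltnW rG).
by rewrite -cH; apply: face_regular; rewrite ?cH.
Qed.

(** With H = G no variable survives the elimination. *)
Lemma one_face_full G n y : y \is n.+1.-homog -> inJ t [set G] #|G| y.
Proof.
move=> hy; apply/(elim_inJP char2 tI (subxx G)).
apply: (@homog_ind _ _ _ (fun y => psubst (elim_var t G G) y = 0)) hy.
- by move=> a b ea eb; rewrite rmorphD /= ea eb addr0.
- by move=> c a ea; rewrite psubstZ ea scaler0.
- exact: rmorph0.
move=> m dm; have [u [m' [um _ _]]] := msup_exists dm.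
rewrite psubst_X (bigD1 u) //= /elim_var; move: um; rewrite inE => um.
case: ifP => uG; first by rewrite setDv big_set0 expr0n (negPf um) mul0r.
by rewrite ?uG expr0n (negPf um) mul0r.
Qed.

End OneFace2.

Section StronglyConnected.
Variables (T : finType) (d : nat) (D : {set {set T}}).
Implicit Types (s F : {set T}).
Hypotheses (pD : pseudo d D)
  (cD : forall s, s \in D -> (#|s|.+2 <= d)%N -> connected_complex (link D s)).

(** Strong connectivity, as an invariant A carried across ridges. Follow a path in the graph of the
    link: consecutive vertices lie in a common facet, and the facets over one vertex are connected
    by induction, s having grown. *)
Lemma facet_connected s (A : {set T} -> Prop) F0 : s \in D ->
  F0 \in D -> #|F0| = d -> s \subset F0 -> A F0 ->
  (forall F F', F \in D -> #|F| = d -> s \subset F -> F' \in D -> #|F'| = d -> s \subset F' ->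
     (d <= #|F :&: F'|.+1)%N -> A F -> A F') ->
  forall F, F \in D -> #|F| = d -> s \subset F -> A F.
Proof.
case: pD => dD D0 coverD leD rD.
have [n] := ubnP (d - #|s|); elim: n s F0 => // n IH s F0 ltn sD F0D cF0 sF0 A0 step F FD cF sF.
have [le|lt] := leqP d #|s|.+1.
  apply: (step F0) => //; apply: leq_trans le _; rewrite ltnS subset_leq_card //.
  by rewrite subsetI sF0.
have pick_vertex G : G \in D -> #|G| = d -> s \subset G ->
    exists v, [/\ v \in G, v \notin s & v \in vertices (link D s)].
  move=> GD cG sG; have /subsetPn[v vG vs] : ~~ (G \subset s).
    by apply/negP => /subset_leq_card; rewrite cG leqNgt (ltn_trans _ lt).
  exists v; split=> //; rewrite inE in_linkd // disjoints1 vs andbT.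
  by apply: dD GD _; rewrite subUset sub1set vG.
have [v0 [v0F v0s v0L]] := pick_vertex _ F0D cF0 sF0.
have [v [vF vs vL]] := pick_vertex _ FD cF sF.
have sv u : u \in vertices (link D s) -> u \notin s /\ u |: s \in D.
  by rewrite inE in_linkd // disjoints1 => /andP[].
pose B u := forall F, F \in D -> #|F| = d -> u |: s \subset F -> A F.
have IHu u F1 : u \in vertices (link D s) -> F1 \in D -> #|F1| = d -> u |: s \subset F1 ->
    A F1 -> B u.
  move=> /sv[us uD] F1D cF1 uF1 A1; apply: (IH _ F1) => //.
    rewrite cardsU1 us add1n -ltnS; apply: leq_trans ltn; rewrite ltnS ltn_sub2l //.
    exact: ltn_trans lt.
  move=> F2 F3 F2D cF2 uF2 F3D cF3 uF3; apply: step => //.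
    exact: subset_trans (subsetUr _ _) uF2.
  exact: subset_trans (subsetUr _ _) uF3.
have B0 : B v0 by apply: (IHu v0 F0) => //; rewrite subUset sub1set v0F.
have /connectP[p] := cD sD lt v0L vL.
suff : forall u, u \in vertices (link D s) -> B u -> forall p, path (adjacent (link D s)) u p -> B (last u p).
  move=> H pp vE; apply: (H v0 v0L B0 p pp) => //.
  by rewrite -vE subUset sub1set vF.
move=> u + + q; elim: q u => //= w q IHq u uL Bu /andP[/andP[uw uwL] pq].
have wL : w \in vertices (link D s).
  rewrite inE; have [dL _ _ _ _] := link_pseudo pD sD.
  by apply: dL uwL _; rewrite sub1set set22.
apply: IHq => //.
move: uwL; rewrite in_linkd // => /andP[uwD _].
have [F1 [F1D uwF1 cF1]] := coverD _ uwD.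
apply: (IHu w F1) => //.
  apply: subset_trans uwF1; apply: setSU; by rewrite sub1set set22.
apply: Bu => //; apply: subset_trans uwF1; apply: setSU; by rewrite sub1set set21.
Qed.

Lemma ridge_facets (G G' : {set T}) : G \in D -> #|G| = d -> G' \in D -> #|G'| = d -> G != G' ->
  (d <= #|G :&: G'|.+1)%N ->
  #|G :&: G'|.+1 = d /\ [set F in D | (#|F| == d) && (G :&: G' \subset F)] = [set G; G'].
Proof.
case: (pD) => dD _ _ _ rD GD cG G'D cG' GG' adj.
have cR : #|G :&: G'|.+1 = d.
  apply/eqP; rewrite eqn_leq adj andbT -cG ltnNge; apply/negP => le.
  have /eqP RG : G :&: G' == G by rewrite eqEcard subsetIl.
  have GsG' : G \subset G' by rewrite -RG subsetIr.
  by case/eqP: GG'; apply/eqP; rewrite eqEcard GsG' cG cG' leqnn.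
split=> //; apply/esym/eqP; rewrite eqEcard cards2 GG'.
rewrite (rD _ (dD _ _ GD (subsetIl _ _)) cR) leqnn andbT.
by rewrite subUset !sub1set !inE GD G'D cG cG' eqxx subsetIl subsetIr.
Qed.

End StronglyConnected.

Section DegreeTwo.
Variables (K : fieldType) (char2 : 2%N \in [pchar K]).
Variables (T : finType) (t : T -> K) (t2 : ind2 t).
Variables (d : nat) (D : {set {set T}}).
Local Notation P := {mpoly K[#|T|]}.
Local Notation theta := (theta t).
Implicit Types (p q y : P) (F G R s : {set T}).
Hypotheses (pD : pseudo d D) (d2 : (2 < d)%N)
  (cD : forall s, s \in D -> (#|s|.+2 <= d)%N -> connected_complex (link D s)).

Let tI : injective t := ind2_inj char2 t2.

Lemma homog0_const p : p \is 0.-homog -> p = (p@_0)%:MP.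
Proof. by move=> hp; apply: msize1_polyC; apply: homog_msize_le. Qed.

Lemma homog1_form p : p \is 1.-homog -> p = \sum_u p@_(U_(enum_rank u))%MM *: xv K u.
Proof.
move=> hp; apply/mpolyP => m; rewrite raddf_sum /=.
have [/mdeg1P[i /eqP mE]|dm] := boolP (mdeg m == 1%N).
  rewrite mE (bigD1 (enum_val i)) //= enum_valK big1 ?addr0 => [|u ui].
    by rewrite mcoeffZ mcoeffXU enum_valK eqxx mulr1.
  rewrite mcoeffZ mcoeffXU -[i in _ == i]enum_valK (inj_eq enum_rank_inj) (negPf ui).
  by rewrite mulr0.
rewrite (dhomog_nemf_coeff hp dm) big1 // => u _.
by rewrite mcoeffZ (dhomog_nemf_coeff (xv_homog K u) dm) mulr0.
Qed.

Lemma mcoeff_theta j u : (theta j)@_(U_(enum_rank u))%MM = t u ^+ j.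
Proof.
rewrite /theta raddf_sum (bigD1 u) //= big1 ?addr0 => [|w wu].
  by rewrite mcoeffZ mcoeffXU eqxx mulr1.
by rewrite mcoeffZ mcoeffXU (inj_eq enum_rank_inj) (negPf wu) mulr0.
Qed.

Lemma msupU u : msup U_(enum_rank u)%MM = [set u] :> {set T}.
Proof.
apply/setP => v; rewrite !inE /mexp mnm1E (inj_eq enum_rank_inj) (eq_sym v).
by case: (u == v) => /=.
Qed.

(** The a j are the coefficients of a polynomial of degree below r that vanishes at the |R| nodes of
    R. *)
Lemma theta_indep R r (a : nat -> K) : (r <= #|R|)%N ->
  restr R (\sum_(j < r) a j *: theta j) = 0 -> forall j, (j < r)%N -> a j = 0.
Proof.
move=> rR e; pose p : {poly K} := \poly_(j < r) a j.
have p0 : p = 0.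
  apply: (@roots_geq_poly_eq0 _ _ [seq t v | v <- enum R]).
  - apply/allP => _ /mapP[v vR ->]; rewrite mem_enum in vR; rewrite rootE horner_poly.
    have := congr1 (mcoeff U_(enum_rank v)%MM) e; rewrite restrE msupU sub1set vR mcoeff0.
    rewrite raddf_sum /= => e'; apply/eqP; rewrite -[RHS]e'.
    by apply: eq_bigr => j _; rewrite mcoeffZ mcoeff_theta.
  - by rewrite map_inj_uniq ?enum_uniq.
  by rewrite size_map -cardE (leq_trans (size_poly _ _)).
by move=> j jr; have := congr1 (fun p : {poly K} => p`_j) p0; rewrite coef_poly jr coef0.
Qed.

Lemma face_linear F r y : y \is 1.-homog -> inJ t [set F] r y ->
  exists c : nat -> K, restr F y = restr F (\sum_(j < r) c j *: theta j).
Proof.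
move=> hy /(inJ_homog hy)[g [hg eg]]; exists (fun j => (g j)@_0).
rewrite eg ?inE //; congr (restr F _); apply: eq_bigr => j _.
by rewrite {1}(homog0_const (hg j)) mulrC mul_mpolyC.
Qed.

Lemma inJ_face r y F : F \in D -> inJ t D r y -> inJ t [set F] r y.
Proof. by move=> FD; apply: inJ_sub; rewrite sub1set. Qed.

Lemma inJ_scale r (c : nat -> K) y :
  (forall F, F \in D -> #|F| = d -> restr F y = restr F (\sum_(j < r) c j *: theta j)) ->
  inJ t D r y.
Proof.
move=> H; exists (fun j => (c j)%:MP) => F FD.
case: pD => _ _ coverD _ _; have [G [GD FG cG]] := coverD _ FD.
apply: (restr_eq_sub FG); rewrite H //; congr (restr G _); apply: eq_bigr => j _.
by rewrite mulrC mul_mpolyC.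
Qed.

(** On each facet y is a combination of the thetas with constant coefficients. A ridge has d - 1 >=
    r vertices, so its restriction determines them, and they agree on neighbouring facets. *)
Lemma regular_linear r y : (r < d)%N -> y \is 1.-homog ->
  inJ t D r (theta r * y) -> inJ t D r y.
Proof.
move=> rd hy Jy; case: (pD) => dD D0 coverD leD rD.
have [F0 [F0D _ cF0]] := coverD _ D0.
have cF F : F \in D -> #|F| = d -> exists c : nat -> K, restr F y = restr F (\sum_(j < r) c j *: theta j).
  move=> FD cF; apply: (@face_linear F r y hy); apply: (one_face_regular char2 tI); first by rewrite cF.
  exact: inJ_face Jy.
have [c yE] := cF _ F0D cF0; apply: (@inJ_scale _ c).
move=> F FD cdF; apply: (@facet_connected _ d D pD cD set0 (fun F => restr F y = restr F (\sum_(j < r) c j *: theta j)) F0) => //; rewrite ?sub0set //.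
move=> G G' GD cG _ G'D cG' _ adj yG.
have [c' yG'] := cF _ G'D cG'.
rewrite yG'; congr (restr _ _); apply: eq_bigr => j _; congr (_ *: _).
apply/eqP; rewrite -subr_eq0; apply/eqP.
apply: (@theta_indep (G :&: G') r (fun j => c' j - c j)) => //.
  by rewrite -ltnS (leq_trans rd).
rewrite (eq_bigr (fun j : 'I_r => c' j *: theta j - c j *: theta j)); last first.
  by move=> k _; rewrite scalerBl.
rewrite sumrB rmorphB /=; apply/eqP; rewrite subr_eq0; apply/eqP.
rewrite -(restr_eq_sub (subsetIr G G') yG').
exact: (restr_eq_sub (subsetIl G G') yG).
Qed.

(** Evaluate at [lam t G] for a face G of size r + 1: there theta_r is 1 and the lower thetas
    vanish. *)
Lemma regular_const r y : (r < d)%N -> y \is 0.-homog ->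
  inJ t D r (theta r * y) -> inJ t D r y.
Proof.
move=> rd hy [g eg]; case: (pD) => dD D0 coverD leD rD.
have [F [FD _ cF]] := coverD _ D0.
have [|G GF cG] := @exists_subset _ F r.+1; first by rewrite cF.
have := congr1 (peval (lam t G)) (eg _ (dD _ _ FD GF)).
rewrite !(peval_restr _ (@lam_out _ _ t G)) rmorphM /= (theta_lam char2 tI) cG // eqxx mul1r.
rewrite rmorph_sum big1 => [|j _]; last first.
  have jr : (j < r.+1)%N by rewrite ltnS ltnW.
  by rewrite rmorphM /= (theta_lam char2 tI) cG // ltn_eqF ?mul0r.
rewrite (homog0_const hy) /peval mevalC => ->; rewrite mpolyC0.
exact: inJ0.
Qed.

(** A ridge no longer determines the coefficients of d thetas. Subtract a combination matching y on
    one facet; across a ridge R, the degree of the difference times x_R sees only the new vertex, so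
    the vanishing spreads. *)
Lemma socle_linear y : y \is 1.-homog ->
  (forall G, (#|G| + 1)%N = d -> dg t D d (fun _ => y * xset K G) = 0) -> inJ t D d y.
Proof.
move=> hy Hy; case: (pD) => dD D0 coverD leD rD.
have [F0 [F0D _ cF0]] := coverD _ D0.
have eD : even_ridges d D by move=> s sD cs; rewrite rD.
have [c yE] : exists c : nat -> K, restr F0 y = restr F0 (\sum_(j < d) c j *: theta j).
  by apply: (@face_linear F0 d y hy); rewrite -cF0; apply: (@one_face_full _ char2 _ _ tI F0 0%N y hy).
apply: (@inJ_scale _ c) => F FD cF; apply/eqP; rewrite -subr_eq0 -rmorphB; apply/eqP.
pose z := y - \sum_(j < d) c j *: theta j.
have hz : z \is 1.-homog by rewrite rpredB // rpred_sum // => j _; rewrite rpredZ // theta_homog.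
have Hz G : (#|G| + 1)%N = d -> dg t D d (fun _ => z * xset K G) = 0.
  move=> cG; rewrite mulrBl -scaleN1r dgD dgZ Hy // add0r mulr_suml.
  rewrite deg_sum big1 ?mulr0 // => j _; rewrite -scalerAl degZ dg_theta ?mulr0 //.
  by rewrite -cG addn1; apply: xset_homog.
apply: (@facet_connected _ d D pD cD set0 (fun F => restr F z = 0) F0) => //; rewrite ?sub0set //.
  by rewrite /z rmorphB /= yE subrr.
move=> G G' GD cG _ G'D cG' _ adj zG.
have [<-//|GG'] := eqVneq G G'.
pose R := G :&: G'.
have [cR setE] := ridge_facets pD GD cG G'D cG' GG' adj.
have {}cR : #|R|.+1 = d := cR.
have RD : R \in D by apply: dD GD (subsetIl _ _).
have := Hz R; rewrite addn1 => /(_ cR); rewrite dg_xset //.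
rewrite (eq_bigl (fun F => F \in [set G; G'])); last by move=> F'; rewrite -setE inE.
rewrite big_setU1 ?inE // big_set1 /=.
have -> : peval (lam t G) z = 0.
  by rewrite -(@peval_restr _ _ G) ?zG ?rmorph0 // => v vG; rewrite lam_out.
rewrite mulr0 add0r => /eqP; rewrite !mulf_eq0 invr_eq0 !(negPf (vand_neq0 char2 tI _)) /=.
rewrite (homog1_form hz) rmorph_sum /=.
have [w wE] : exists w, G' :\: R = [set w].
  apply/cards1P; rewrite cardsD (setIidPr (subsetIr _ _)) cG' -cR.
  by rewrite subSn // subnn.
have wG' : w \in G' by have := set11 w; rewrite -wE inE => /andP[].
have zR u : u \in R -> z@_(U_(enum_rank u))%MM = 0.
  move=> uR; have := congr1 (mcoeff U_(enum_rank u)%MM) (restr_eq_sub (subsetIl G G') (etrans zG (esym (rmorph0 _)))).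
  by rewrite rmorph0 restrE msupU sub1set uR mcoeff0.
have out u : u \in G' -> u != w -> u \in R.
  move=> uG' uw; apply/negPn/negP => uR.
  by have : u \in G' :\: R by [rewrite inE uR]; rewrite wE inE (negPf uw).
rewrite (bigD1 w) //= big1 ?addr0 => [|u uw]; last first.
  rewrite pevalZ peval_xv; have [uG'|uG'] := boolP (u \in G'); last by rewrite lam_out ?mulr0.
  by rewrite zR ?mul0r // out.
rewrite pevalZ peval_xv mulf_eq0 /lam wG' invr_eq0 (negPf (node_neq0 char2 tI _ _)) orbF => /eqP zw.
rewrite rmorph_sum big1 // => u _ /=; rewrite restrZ restr_xv; case: ifP => uG'; last by rewrite scaler0.
have [->|uw] := eqVneq u w; first by rewrite zw scale0r.
by rewrite zR ?scale0r // out.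
Qed.

(** If theta_d y lies in the ideal it is null, so y is null by the Lefschetz property, and
    [socle_linear] puts y into the ideal. *)
Lemma regular_two : regular_upto t D d 2.
Proof.
move=> r n y n2 hr hy Jy; case: n n2 hr hy Jy => [|[|//]] _ hr hy Jy.
  by case: hr => [rd|[_ //]]; apply: regular_const.
case: hr => [rd|[rd _]]; first exact: regular_linear.
rewrite rd in Jy *; case: (pD) => dD D0 coverD leD rD.
have eD : even_ridges d D by move=> s sD cs; rewrite rD.
have hy2 : theta d * y \is 2.-homog by apply: (@dhomogM _ _ _ 1); rewrite ?theta_homog.
have [g [hg eg]] := inJ_homog hy2 Jy.
have ny : nul t d D 1 y.
  apply: (nul_theta_inj char2 t2) => //; apply: (nul_eqD eg).
  by apply: nul_sum => j _; apply: nul_theta => //; apply: ltnW.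
apply: socle_linear => // G cG; apply: ny; rewrite -cG addn1 subn1 /=.
exact: xset_homog.
Qed.

End DegreeTwo.

(** * Regularity for homology spheres *)

Lemma card_between (T : finType) (A C : {set T}) : A \subset C -> #|C| = #|A|.+2 ->
  #|[set B : {set T} | [&& A \subset B, B \subset C & #|B| == #|A|.+1]]| = 2%N.
Proof.
move=> sAC cC.
have -> : [set B : {set T} | [&& A \subset B, B \subset C & #|B| == #|A|.+1]] =
    (fun x => x |: A) @: (C :\: A).
  apply/setP => B; rewrite inE; apply/and3P/imsetP => [[AB BC /eqP cB]|[x]].
    have /cards1P[x Bx] : #|B :\: A| == 1%N.
      by rewrite cardsD (setIidPr AB) cB subSn // subnn.
    exists x; last by rewrite -Bx setDUsub.
    have : x \in B :\: A by rewrite Bx set11.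
    by rewrite !inE => /andP[-> /(subsetP BC)].
  rewrite inE => /andP[xA xC] ->; rewrite subsetUr subUset sub1set xC sAC.
  by rewrite cardsU1 xA.
rewrite card_in_imset => [|x y]; last first.
  move=> /setDP[_ xA] _ e; have : x \in y |: A by rewrite -e setU11.
  by rewrite !inE (negPf xA) orbF => /eqP.
by rewrite cardsD (setIidPr sAC) cC -addn2 addnC addnK.
Qed.

Lemma sum_between (T : finType) (V : zmodType) (V2 : forall z : V, z + z = 0)
    (A C : {set T}) (z : V) : A \subset C -> #|C| = #|A|.+2 ->
  \sum_(B : {set T} | [&& A \subset B, B \subset C & #|B| == #|A|.+1]) z = 0.
Proof.
move=> sAC cC; rewrite sumr_const.
rewrite (eq_card (B := [set B : {set T} | [&& A \subset B, B \subset C & #|B| == #|A|.+1]])) => [|B]; last by rewrite inE.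
by rewrite card_between // mulr2n.
Qed.

(** * Exactness over ['F_2] and over its extensions *)

Section F2Homology.
Variables (T : finType) (L : {set {set T}}).
Hypothesis dL : downset L.
Local Notation chain := {ffun {set T} -> ('F_2)^o}.
Implicit Types (c : chain) (s G F : {set T}).

Lemma boundaryE c s : boundary T c s = \sum_(F : {set T} | (s \subset F) && (#|F| == #|s|.+1)) c F.
Proof. by rewrite /boundary lfunE /= ffunE. Qed.

Lemma chainsP k c : reflect (forall s, c s != 0 -> s \in L /\ #|s| = k) (c \in chains L k).
Proof.
apply: (iffP idP) => [cC s|H].
  rewrite (coord_span (X := in_tuple _) cC) sum_ffunE.
  have [/andP[-> /eqP ->]|nz] := boolP ((s \in L) && (#|s| == k)); first by [].
  rewrite big1 ?eqxx // => i _; rewrite !ffunE.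
  have : (in_tuple [seq face_chain s | s <- enum L & #|s| == k])`_i \in [seq face_chain s | s <- enum L & #|s| == k].
    by apply: mem_nth; apply: ltn_ord.
  case/mapP => G; rewrite mem_filter mem_enum => /andP[cG GL] ->; rewrite ffunE.
  by case: (eqVneq s G) => [e|_]; [rewrite e GL cG in nz|rewrite scaler0].
rewrite (_ : c = \sum_(s | (s \in L) && (#|s| == k)) c s *: face_chain s).
  apply: rpred_sum => s /andP[sL cs]; rewrite rpredZ //; apply: memv_span.
  by apply/mapP; exists s; rewrite // mem_filter cs mem_enum.
apply/ffunP => s; rewrite sum_ffunE.
have [sk|sk] := boolP ((s \in L) && (#|s| == k)).
  rewrite (bigD1 s) //= big1 ?addr0 => [|G /andP[_ Gs]]; rewrite !ffunE.
    by rewrite eqxx; apply/esym; apply: mulr1.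
  by rewrite eq_sym (negPf Gs) scaler0.
rewrite big1 => [|G Gk]; last first.
  by rewrite !ffunE; case: (eqVneq s G) => [e|_]; [rewrite e Gk in sk|rewrite scaler0].
by apply/eqP; apply: contraNT sk => /H[-> ->]; rewrite eqxx.
Qed.

Lemma F2_add2 (z : ('F_2)^o) : z + z = 0.
Proof. by rewrite -mulr2n -mulr_natr pchar_Zp ?mulr0. Qed.

Lemma boundary_chains k c : c \in chains L k.+1 -> boundary T c \in chains L k.
Proof.
move=> /chainsP H; apply/chainsP => s; rewrite boundaryE.
have [[F /andP[sF /eqP cF] nz]|no] := (classic (exists2 F : {set T}, (s \subset F) && (#|F| == #|s|.+1) & c F != 0)).
  have [FL ck] := H _ nz; rewrite (dL FL sF) //; split=> //.
  by move: cF; rewrite ck => -[].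
rewrite big1 ?eqxx // => F sF; apply/eqP/negPn/negP => nz; apply: no; by exists F.
Qed.

Lemma boundary_boundary c : boundary T (boundary T c) = 0.
Proof.
apply/ffunP => s; rewrite boundaryE ffunE.
under eq_bigr do rewrite boundaryE.
rewrite (exchange_big_dep xpredT) //= big1 // => F _.
have [/andP[sF /eqP cF]|no] := boolP ((s \subset F) && (#|F| == #|s|.+2)).
  rewrite -[RHS](sum_between F2_add2 (c F) sF cF); apply: eq_bigl => B.
  rewrite cF; apply/andP/and3P => [[/andP[-> /eqP cB] /andP[-> _]]|[-> -> /eqP cB]].
    by rewrite cB.
  by rewrite cB !eqxx.
rewrite big_pred0 // => B; apply: contraNF no => /andP[/andP[sB /eqP cB] /andP[BF /eqP cF]].
by rewrite (subset_trans sB BF) cF cB eqxx.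
Qed.

Lemma F2_exact k c : betti L k = 0%N -> c \in chains L k -> boundary T c = 0 ->
  exists2 b, b \in chains L k.+1 & c = boundary T b.
Proof.
move=> /eqP b0 cC cZ; have le : (boundaries L k <= cycles L k)%VS.
  apply/subvP => _ /memv_imgP[b bC ->]; rewrite memv_cap boundary_chains //.
  by rewrite memv_ker boundary_boundary eqxx.
have e : boundaries L k = cycles L k by apply/eqP; rewrite eqEdim le -subn_eq0.
have : c \in boundaries L k by rewrite e memv_cap cC memv_ker cZ eqxx.
by case/memv_imgP => b bC ->; exists b.
Qed.

End F2Homology.

Section ScalarExtension.
Variables (K : fieldType) (f : {rmorphism 'F_2 -> K}).
Variables (T : finType) (L : {set {set T}}).
Hypothesis dL : downset L.
Implicit Types (s G F : {set T}).

(** Exactness is an inclusion of row spaces of matrices over ['F_2], which persists over K. *)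
Lemma betti_exact k (a : {set T} -> K) : betti L k = 0%N ->
  (forall G, ~~ ((G \in L) && (#|G| == k)) -> a G = 0) ->
  (forall s, \sum_(F : {set T} | (s \subset F) && (#|F| == #|s|.+1)) a F = 0) ->
  exists b : {set T} -> K, forall G, a G =
    \sum_(F in L | (#|F| == k.+1) && (G \subset F) && (#|F| == #|G|.+1)) b F.
Proof.
move=> b0 aS aZ; pose N := #|{set T}|; pose r (i : 'I_N) : {set T} := enum_val i.
pose M := \matrix_(i < N, j < N) (((r j \subset r i) && (#|r i| == #|r j|.+1))%:R : 'F_2).
pose E k := \matrix_(i < N, j < N) (((i == j) && ((r i \in L) && (#|r i| == k)))%:R : 'F_2).
have mulE (F : fieldType) (h : {rmorphism 'F_2 -> F}) (v : 'rV[F]_N) k' j :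
    (v *m map_mx h (E k')) 0 j = if (r j \in L) && (#|r j| == k') then v 0 j else 0.
  rewrite mxE (bigD1 j) //= big1 ?addr0 => [|i ij]; rewrite !mxE ?eqxx.
    by case: ifP; rewrite ?rmorph1 ?rmorph0 ?mulr1 ?mulr0.
  by rewrite (negPf ij) rmorph0 mulr0.
have mulM (F : fieldType) (h : {rmorphism 'F_2 -> F}) (v : 'rV[F]_N) j :
    (v *m map_mx h M) 0 j = \sum_(G : {set T} | (r j \subset G) && (#|G| == #|r j|.+1)) v 0 (enum_rank G).
  rewrite mxE (reindex (@enum_rank {set T})) /=; last first.
    by exists enum_val => i _; rewrite ?enum_rankK ?enum_valK.
  rewrite [RHS]big_mkcond; apply: eq_bigr => G _; rewrite !mxE /r enum_rankK.
  by case: ifP; rewrite ?rmorph1 ?rmorph0 ?mulr1 ?mulr0.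
have idM n (A : 'M['F_2]_n) : map_mx (idfun : {rmorphism 'F_2 -> 'F_2}) A = A by apply/matrixP => i j; rewrite mxE.
(* The block [1%:M - E k] restricts the kernel to combinations of faces of size k. *)
have sub : (kermx (row_mx M (1%:M - E k)) <= E k.+1 *m M)%MS.
  apply/row_subP => i; set v := row i _.
  have : v *m row_mx M (1%:M - E k) = 0 by rewrite -row_mul mulmx_ker row0.
  rewrite mul_mx_row => /eqP; rewrite row_mx_eq0 mulmxBr mulmx1 subr_eq0 => /andP[/eqP vM /eqP vE].
  pose c : {ffun {set T} -> ('F_2)^o} := [ffun G => v 0 (enum_rank G)].
  have cC : c \in chains L k.
    apply/chainsP => s; rewrite ffunE vE -[E k]idM mulE /r enum_rankK.
    by case: ifP => [/andP[-> /eqP]|]; rewrite ?eqxx.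
  have cZ : boundary T c = 0.
    apply/ffunP => s; rewrite boundaryE ffunE; under eq_bigr do rewrite ffunE.
    have := congr1 (fun A : 'rV_N => A 0 (enum_rank s)) vM.
    by rewrite -[M]idM mulM mxE /r enum_rankK.
  have [b /chainsP bC cb] := F2_exact dL b0 cC cZ.
  apply/submxP; exists (\row_i b (r i)); rewrite mulmxA; apply/rowP => j.
  rewrite -[M]idM mulM -[E _]idM.
  have := congr1 (fun c : {ffun _ -> _} => c (r j)) cb; rewrite boundaryE ffunE /r enum_valK => ->.
  apply: eq_bigr => G _; rewrite mulE mxE /r enum_rankK; case: ifP => //.
  by move=> no; apply/eqP; apply: contraFT no => /bC[-> ->]; rewrite eqxx.
have := sub; rewrite -(map_submx f) map_kermx map_row_mx map_mxB map_mx1 map_mxM => subK.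
pose v : 'rV[K]_N := \row_i a (r i).
have vS : (v <= map_mx f (E k.+1) *m map_mx f M)%MS.
  apply: submx_trans subK; apply/sub_kermxP; rewrite mul_mx_row mulmxBr mulmx1.
  have -> : v *m map_mx f M = 0.
    apply/rowP => j; rewrite mulM mxE -[RHS](aZ (r j)); apply: eq_bigr => G _.
    by rewrite mxE /r enum_rankK.
  have -> : v *m map_mx f (E k) = v.
    by apply/rowP => j; rewrite mulE; case: ifP => // no; rewrite mxE aS ?no.
  by rewrite subrr row_mx0.
have [w vE] := submxP vS; exists (fun F => w 0 (enum_rank F)) => G.
have := congr1 (fun A : 'rV_N => A 0 (enum_rank G)) vE.
rewrite mulmxA mulM mxE /r enum_rankK => ->.
under eq_bigr do rewrite mulE /r enum_rankK.
rewrite -big_mkcondr /=; apply: eq_bigl => F.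
by case: (_ \subset _); case: (F \in L); case: (_ == k.+1); rewrite ?andbF ?andbT.
Qed.

End ScalarExtension.

Section LinkExactness.
Variables (K : fieldType) (f : {rmorphism 'F_2 -> K}).
Variables (T : finType) (d : nat) (D : {set {set T}}).
Hypothesis dD : downset D.
Implicit Types (s G F : {set T}).

Lemma link_sum (tau : {set T}) k s (g : {set T} -> K) : s \in link D tau ->
  \sum_(F in link D tau | (#|F| == k) && (s \subset F)) g (F :|: tau) =
  \sum_(G in D | (#|G| == (k + #|tau|)%N) && (s :|: tau \subset G)) g G.
Proof.
rewrite in_linkd // => /andP[sD ds].
rewrite [RHS](reindex_onto (fun F => F :|: tau) (fun G => G :\: tau)) /=; last first.
  by move=> G /and3P[_ _]; rewrite subUset => /andP[_ /setDUsub].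
apply: eq_bigl => F; rewrite in_linkd //.
have [dF|nd] := boolP [disjoint F & tau].
  rewrite setUDK // eqxx cardsU_disjoint // eqn_add2r !andbT; congr (_ && (_ && _)).
  apply/idP/idP => [/setSU->//|]; rewrite subUset => /andP[sF _].
  by move/(setSD tau): sF; rewrite setUDK // (setDidPl ds).
rewrite andbF; apply/esym/negP => /andP[_ /eqP e]; case/negP: nd.
by rewrite -e disjoint_sym disjointDs.
Qed.

(** The strand of the complex of face rings at a monomial with support tau, which only the faces
    containing tau carry. *)
Definition exact_at : Prop := forall (tau : {set T}) (s : nat) (a : {set T} -> K), tau \in D -> (s < d)%N ->
  (forall G', G' \in D -> tau \subset G' -> #|G'|.+1 = s ->
     \sum_(G in D | (#|G| == s) && (G' \subset G)) a G = 0) ->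
  exists b : {set T} -> K, forall G, G \in D -> tau \subset G -> #|G| = s ->
    a G = \sum_(F in D | (#|F| == s.+1) && (G \subset F)) b F.

Lemma sphere_exact :
  (forall s, s \in D -> sphere_homology (d - #|s|) (link D s)) -> exact_at.
Proof.
move=> hD tau s a tD sd aZ.
have [ls|ts] := ltnP s #|tau|.
  exists (fun _ => 0) => G _ /subset_leq_card + cG.
  by rewrite cG leqNgt ls.
pose k := (s - #|tau|)%N; have kE : (k + #|tau|)%N = s by rewrite subnK.
pose L := link D tau.
have dL : downset L.
  move=> F G; rewrite !in_linkd // => /andP[FD dF] GF; rewrite (disjointWl GF) // andbT.
  by apply: dD FD _; apply: setSU.
have b0 : betti L k = 0%N.
  by rewrite hD // ltn_eqF // ltn_sub2r // (leq_ltn_trans ts).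
pose a' F := if (F \in L) && (#|F| == k) then a (F :|: tau) else 0.
have [||b bE] := @betti_exact K f T L dL k a' b0.
- by move=> G; rewrite /a' => /negPf->.
- move=> s'.
  have [/andP[sL /eqP cs]|no] := boolP ((s' \in L) && (#|s'|.+1 == k)); last first.
    rewrite big1 // => F /andP[sF /eqP cF]; rewrite /a'; case: ifP => // /andP[FL /eqP ck].
    by case/negP: no; rewrite (dL _ _ FL sF) -ck cF eqxx.
  transitivity (\sum_(F in L | (#|F| == k) && (s' \subset F)) a (F :|: tau)).
    rewrite /a' -big_mkcondr /=; apply: eq_bigl => F; rewrite cs.
    by case: (_ \subset _); case: (_ == k); rewrite ?andbF ?andbT.
  rewrite link_sum // kE; move: sL; rewrite in_linkd // => /andP[sD ds].
  by apply: aZ => //; [apply: subsetUr|rewrite cardsU_disjoint // -addSn cs].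
exists (fun F => b (F :\: tau)) => G GD tG cG.
have GL : G :\: tau \in L by rewrite in_linkd // setDUsub // GD disjoint_sym disjointDs.
have ck : #|G :\: tau| = k by rewrite cardsD (setIidPr tG) cG.
transitivity (a' (G :\: tau)); first by rewrite /a' GL ck eqxx setDUsub.
rewrite bE -[s]kE -addSn -[in RHS](setDUsub tG) -(link_sum k.+1 (fun F => b (F :\: tau)) GL).
apply: eq_big => [F|F /andP[]]; first by rewrite ck -andbA; case: (_ == k.+1); rewrite ?andbT ?andbF.
by rewrite in_linkd // => /andP[_ dF] _; rewrite setUDK.
Qed.

End LinkExactness.

(** * Cycles with coefficients in the face rings *)

Section Chains.
Variables (K : fieldType) (char2 : 2%N \in [pchar K]).
Variables (T : finType) (t : T -> K) (tI : injective t).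
Variables (d : nat) (D : {set {set T}}).
Local Notation P := {mpoly K[#|T|]}.
Local Notation theta := (theta t).
Implicit Types (p q y : P) (F G R : {set T}) (c e : {set T} -> P) (s r n : nat).
Hypotheses (dD : downset D) (exD : exact_at K d D).

(* Equality and cycles in the complex of face rings of single faces of size s, where a
   chain matters only through the restriction of c G to G. *)
Definition ceq s c e := forall G, G \in D -> #|G| = s -> restr G (c G) = restr G (e G).
Definition cyc s c := forall G, G \in D -> #|G|.+1 = s -> restr G (bd D s c G) = 0.

Lemma bdD s c e G : bd D s (fun F => c F + e F) G = bd D s c G + bd D s e G.
Proof. by rewrite /bd big_split. Qed.

Lemma bd_sum s (I : finType) (c : I -> {set T} -> P) G :
  bd D s (fun F => \sum_i c i F) G = \sum_i bd D s (c i) G.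
Proof. by rewrite /bd exchange_big. Qed.

Lemma bdM s c q G : bd D s (fun F => q * c F) G = q * bd D s c G.
Proof. by rewrite /bd big_distrr. Qed.

Lemma bd_ceq s c e : ceq s c e ->
  forall G, G \in D -> #|G|.+1 = s -> restr G (bd D s c G) = restr G (bd D s e G).
Proof.
move=> h G GD cG; rewrite /bd !rmorph_sum /=; apply: eq_bigr => F /and3P[FD /eqP cF GF].
exact: (restr_eq_sub GF (h _ FD cF)).
Qed.

Lemma cyc_ceq s c e : ceq s c e -> cyc s c -> cyc s e.
Proof. by move=> h cc G GD cG; rewrite -(bd_ceq h) // cc. Qed.

Lemma cycD s c e : cyc s c -> cyc s e -> cyc s (fun F => c F + e F).
Proof. by move=> hc he G GD cG; rewrite bdD rmorphD /= hc // he // addr0. Qed.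

Lemma cycM s q c : cyc s c -> cyc s (fun F => q * c F).
Proof. by move=> hc G GD cG; rewrite bdM rmorphM /= hc // mulr0. Qed.

Lemma addpp_char2 (p : P) : p + p = 0.
Proof. by rewrite addrr_pchar2 // pchar_lalg. Qed.

Lemma cyc_bd s c : cyc s (bd D s.+1 c).
Proof.
move=> G GD cG; rewrite /bd (exchange_big_dep (fun F => (F \in D) && (#|F| == s.+1))) /=; last first.
  by move=> B F _ /and3P[-> ->].
rewrite big1 ?rmorph0 // => F /andP[FD /eqP cF].
have [GF|GF] := boolP (G \subset F); last first.
  rewrite big_pred0 // => B; apply: contraNF GF => /andP[/and3P[_ _ GB] /and3P[_ _ BF]].
  exact: subset_trans BF.
rewrite -[RHS](sum_between addpp_char2 (c F) GF); last by rewrite cF cG.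
apply: eq_bigl => B; rewrite FD cF cG eqxx /=; apply/andP/and3P => [[/and3P[_ -> ->] ->]//|[GB BF cB]].
by rewrite cB GB BF (dD FD BF).
Qed.

Lemma mcoeff_choice (A : Type) (ms : seq 'X_{1..#|T|}) (b : 'X_{1..#|T|} -> A -> K) :
  exists y : A -> P, forall a m, (y a)@_m = if m \in ms then b m a else 0.
Proof.
exists (fun a => \sum_(m <- undup ms) b m a *: 'X_[m]) => a m.
rewrite raddf_sum /= -mem_undup; case: ifP => mm.
  rewrite (bigD1_seq m) ?undup_uniq //= big1 ?addr0 => [|m' m'm]; rewrite mcoeffZ mcoeffX.
    by rewrite eqxx mulr1.
  by rewrite (negPf m'm) mulr0.
rewrite big_seq big1 // => m' m'm; rewrite mcoeffZ mcoeffX.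
by case: (eqVneq m' m) m'm => [->|_ _]; rewrite ?mm ?mulr0.
Qed.

Lemma family_supp c : exists ms : seq 'X_{1..#|T|}, forall G m, m \notin ms -> (c G)@_m = 0.
Proof.
exists (flatten [seq msupp (c G) | G <- enum {set T}]) => G m mm.
apply: memN_msupp_eq0; apply: contra mm => mG; apply/flattenP; exists (msupp (c G)) => //.
by apply: map_f; rewrite mem_enum.
Qed.

(** Monomial by monomial this is [exact_at] with tau the support; a common finite list of monomials
    lets the chosen coefficients be reassembled into polynomials. *)
Lemma cyc_exact s c : (s < d)%N -> cyc s c -> exists e, ceq s c (bd D s.+1 e).
Proof.
move=> sd cc; have [ms msE] := family_supp c.
have /(@functional_choice _ _)[b bE] : forall m, exists b : {set T} -> K,
    forall G, G \in D -> msup m \subset G -> #|G| = s ->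
      (c G)@_m = \sum_(F in D | (#|F| == s.+1) && (G \subset F)) b F.
  move=> m; have [mD|mD] := boolP (msup m \in D); last first.
    by exists (fun _ => 0) => G GD mG; rewrite (dD GD mG) in mD.
  apply: (exD mD sd) => G' G'D mG' cG'.
  have := congr1 (mcoeff m) (cc _ G'D cG'); rewrite restrE mG' mcoeff0 => {2}<-.
  by rewrite /bd raddf_sum /=.
have [y yE] := mcoeff_choice ms b; exists y => G GD cG; apply/mpolyP => m.
rewrite !restrE; case: ifP => // mG; rewrite /bd raddf_sum /=.
have [mm|mm] := boolP (m \in ms).
  by rewrite bE //; apply: eq_bigr => F _; rewrite yE mm.
by rewrite msE // big1 // => F _; rewrite yE (negPf mm).
Qed.

(** If e_j has boundary m_j, then theta_r theta_j e_j can be added to both theta_r c_r and theta_j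
    c_j, cancelling in characteristic 2; this turns the coefficient of theta_r into a cycle. *)
Lemma cyc_correct r s (c m : nat -> {set T} -> P) : (s < d)%N -> (forall j, cyc s (m j)) ->
  ceq s (bd D s.+1 (c r)) (fun G => \sum_(j < r) theta j * m j G) ->
  exists (c' : nat -> {set T} -> P) (cr : {set T} -> P), cyc s.+1 cr /\
    forall F, \sum_(j < r.+1) theta j * c j F = \sum_(j < r) theta j * c' j F + theta r * cr F.
Proof.
move=> sd mC mE.
have /(@functional_choice _ _)[e eE] : forall j, exists e, ceq s (m j) (bd D s.+1 e).
  by move=> j; apply: cyc_exact.
exists (fun j F => c j F + theta r * e j F), (fun F => c r F + \sum_(j < r) theta j * e j F).
split=> [G GD [cG]|F].
  rewrite bdD rmorphD /= mE // bd_sum !rmorph_sum /= -big_split big1 //= => j _.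
  by rewrite bdM !rmorphM /= eE // -mulrDr addpp_char2 mulr0.
have -> : \sum_(j < r) theta j * (c j F + theta r * e j F) =
    \sum_(j < r) theta j * c j F + theta r * \sum_(j < r) theta j * e j F.
  rewrite big_distrr -big_split /=; apply: eq_bigr => j _.
  by rewrite mulrDr [theta j * (_ * _)]mulrCA.
by rewrite big_ord_recr /= mulrDr addrACA addpp_char2 addr0.
Qed.

(* The boundary of c_r is a combination of the lower theta's because theta_r is regular
   on each face of size s - 1; exactness lifts its coefficients, corrected to cycles by
   the induction hypothesis, and subtracting them from c_r makes it a cycle. *)
Lemma lift_cyc r s (c : nat -> {set T} -> P) : (r < s)%N -> (s <= d)%N ->
  cyc s (fun F => \sum_(j < r) theta j * c j F) ->
  exists g : nat -> {set T} -> P, (forall j, cyc s (g j)) /\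
    ceq s (fun F => \sum_(j < r) theta j * c j F) (fun F => \sum_(j < r) theta j * g j F).
Proof.
elim: r s c => [|r IH] s c rs sd cc.
  exists (fun _ _ => 0); split=> [j G GD cG|G _ _]; last by rewrite !big_ord0.
  by rewrite /bd big1 // rmorph0.
case: s rs sd cc => // s rs sd cc.
have [m mE] : exists m : nat -> {set T} -> P,
    ceq s (bd D s.+1 (c r)) (fun G => \sum_(j < r) theta j * m j G).
  have /(@functional_choice _ _)[m mE] : forall G, exists m : nat -> P, G \in D -> #|G| = s ->
      restr G (bd D s.+1 (c r) G) = restr G (\sum_(j < r) theta j * m j).
    move=> G; have [GD|GD] := boolP (G \in D); last by exists (fun _ => 0).
    have [cG|/eqP cG] := eqVneq #|G| s; last by exists (fun _ => 0).
    have /inJ1P[m mE] : inJ t [set G] r (bd D s.+1 (c r) G); last by exists m.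
    apply: (one_face_regular char2 tI); first by rewrite cG.
    apply/inJ1P; exists (fun j => bd D s.+1 (c j) G).
    have := cc G GD (congr1 _ cG); rewrite bd_sum rmorph_sum /= big_ord_recr /= => /eqP.
    rewrite addrC addr_eq0 oppr_pchar2 ?pchar_lalg // bdM => /eqP->.
    rewrite rmorph_sum /=; apply: eq_bigr => j _; by rewrite bdM.
  by exists (fun j G => m G j) => G; apply: mE.
have [] := IH s m rs (ltnW sd).
  exact: cyc_ceq mE (@cyc_bd _ _).
move=> m' [m'C m'E].
have m'S : ceq s (bd D s.+1 (c r)) (fun G => \sum_(j < r) theta j * m' j G).
  by move=> G GD cG; rewrite mE // m'E.
have [c' [cr [crC cE]]] := cyc_correct sd m'C m'S.
have c'C : cyc s.+1 (fun F => \sum_(j < r) theta j * c' j F).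
  apply: (@cyc_ceq _ (fun F => (\sum_(j < r.+1) theta j * c j F) + theta r * cr F)).
    by move=> G _ _; rewrite cE -addrA addpp_char2 addr0.
  by apply: cycD => //; apply: cycM.
have [g [gC gE]] := IH s.+1 c' (ltnW rs) sd c'C.
exists (fun j => if j == r then cr else g j); split=> [j|G GD cG]; first by case: eqP.
rewrite cE big_ord_recr /= eqxx !rmorphD /= gE //; congr (restr G _ + _).
by apply: eq_bigr => j _; rewrite ltn_eqF.
Qed.

Lemma cyc_regular r s c : (r < s)%N -> (s <= d)%N -> cyc s c ->
  (forall G, G \in D -> #|G| = s -> inJ t [set G] r (c G)) ->
  exists g : nat -> {set T} -> P, (forall j, cyc s (g j)) /\
    ceq s c (fun F => \sum_(j < r) theta j * g j F).
Proof.
move=> rs sd cc cJ.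
have /(@functional_choice _ _)[m mE] : forall G, exists m : nat -> P, G \in D -> #|G| = s ->
    restr G (c G) = restr G (\sum_(j < r) theta j * m j).
  move=> G; have [GD|GD] := boolP (G \in D); last by exists (fun _ => 0).
  have [cG|/eqP cG] := eqVneq #|G| s; last by exists (fun _ => 0).
  by have /inJ1P[m mE] := cJ G GD cG; exists m.
have cm : ceq s c (fun F => \sum_(j < r) theta j * m F j) by move=> G; apply: mE.
have [g [gC gE]] := lift_cyc (c := fun j F => m F j) rs sd (cyc_ceq cm cc).
by exists g; split=> // G GD cG; rewrite cm // gE.
Qed.

End Chains.

Section SphereRegular.
Variables (K : fieldType) (char2 : 2%N \in [pchar K]).
Variables (T : finType) (t : T -> K) (t2 : ind2 t).
Variables (d : nat) (D : {set {set T}}).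
Local Notation P := {mpoly K[#|T|]}.
Local Notation theta := (theta t).
Implicit Types (p q y : P) (F G R H : {set T}) (c e : {set T} -> P) (s r n : nat).
Hypotheses (pD : pseudo d D) (exD : exact_at K d D)
  (cD : forall s : {set T}, s \in D -> (#|s|.+2 <= d)%N -> connected_complex (link D s)).

Let tI : injective t := ind2_inj char2 t2.

Lemma restr_add_eq F p q : restr F (p + q) = 0 -> restr F p = restr F q.
Proof.
move/eqP; rewrite rmorphD /= addr_eq0 oppr_pchar2 ?pchar_lalg //.
exact: eqP.
Qed.

(** The coefficient of a monomial is the same on two facets through its support that share a ridge,
    hence on all such facets; p takes it from any of them. *)
Lemma cyc_top c : cyc D d c -> exists p, ceq D d c (fun _ => p).
Proof.
move=> cc; case: (pD) => dD D0 coverD leD rD.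
have [F0 _] := coverD _ D0.
pose k m := odflt F0 [pick F in D | (#|F| == d) && (msup m \subset F)].
have [ms msE] := family_supp c.
have [p pE] := mcoeff_choice (A := unit) ms (fun m _ => (c (k m))@_m).
exists (p tt) => G GD cG; apply/mpolyP => m; rewrite !restrE; case: ifP => // mG; rewrite pE.
have -> : (c (k m))@_m = (c G)@_m; last by case: (boolP (m \in ms)) => // /msE.
have [kD ck mk] : [/\ k m \in D, #|k m| = d & msup m \subset k m].
  rewrite /k; case: pickP => [F /and3P[-> /eqP -> ->]//|/(_ G)].
  by rewrite /= GD cG eqxx mG.
apply: (@facet_connected _ d D pD cD (msup m) (fun F => (c F)@_m = (c G)@_m) G) => //.
  exact: dD mG.
move=> F F' FD cF mF F'D cF' mF' adj <-.
have [->//|FF'] := eqVneq F F'.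
have [cR RE] := ridge_facets pD FD cF F'D cF' FF' adj.
have := cc _ (dD _ _ FD (subsetIl F F')) cR; rewrite /bd.
rewrite (eq_bigl (fun G => G \in [set F; F'])); last by move=> G'; rewrite -RE inE.
rewrite big_setU1 ?inE // big_set1 /= => /restr_add_eq/(congr1 (mcoeff m)).
by rewrite !restrE subsetI mF mF'.
Qed.

Lemma inJ_facets r y (g : nat -> P) :
  (forall F, F \in D -> #|F| = d -> restr F y = restr F (\sum_(j < r) theta j * g j)) ->
  inJ t D r y.
Proof.
move=> H; exists g => F FD.
case: pD => _ _ coverD _ _; have [G [GD FG cG]] := coverD _ FD.
by apply: (restr_eq_sub FG); rewrite H.
Qed.

Lemma cyc_const y : cyc D d (fun _ => y).
Proof.
case: (pD) => dD D0 coverD leD rD G GD cG; rewrite /bd sumr_const.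
rewrite (eq_card (B := [set F in D | (#|F| == d) && (G \subset F)])) => [|F]; last by rewrite inE.
by rewrite rD // mulr2n (addpp_char2 char2) rmorph0.
Qed.

Lemma cyc_inJ r y (g : nat -> {set T} -> P) : (forall j, cyc D d (g j)) ->
  ceq D d (fun _ => y) (fun F => \sum_(j < r) theta j * g j F) -> inJ t D r y.
Proof.
move=> gC yg; have /(@functional_choice _ _)[h hE] := fun j => cyc_top (gC j).
apply: (@inJ_facets _ _ h) => F FD cF; rewrite (yg F FD cF) !rmorph_sum /=.
by apply: eq_bigr => j _; rewrite !rmorphM /= hE.
Qed.

(** theta_r is regular on each facet; [cyc_regular] turns the local coefficients into cycles, and
    [cyc_top] glues these to polynomials. *)
Lemma sphere_regular_lt r y : (r < d)%N -> inJ t D r (theta r * y) -> inJ t D r y.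
Proof.
move=> rd Jy; case: (pD) => dD D0 coverD leD rD.
have [G GD cG|g [gC gE]] := cyc_regular char2 tI dD exD rd (leqnn d) (cyc_const y).
  by apply: (one_face_regular char2 tI); rewrite ?cG //; apply: inJ_face Jy.
exact: cyc_inJ gC gE.
Qed.

(* The coefficient of theta_(s-1) in c has a boundary of degree n - 1 on the faces of
   size s - 1 with the same values of [dg], which allows induction. *)
Lemma socle n s c : (n <= s)%N -> (s <= d)%N -> cyc D s c ->
  (forall F, c F \is n.-homog) ->
  (forall H, (#|H| + n)%N = s -> dg t D s (fun F => c F * xset K H) = 0) ->
  exists g : nat -> {set T} -> P, (forall j, cyc D s (g j)) /\
    ceq D s c (fun F => \sum_(j < s) theta j * g j F).
Proof.
case: (pD) => dD D0 coverD leD rD.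
elim: n s c => [|n IH] s c ns sd cc hc Hc.
  (* In degree 0 the chain is a constant on each face, and the pairing with x_G reads off the one at
     G. *)
  exists (fun _ _ => 0); split=> [j G GD _|G GD cG]; first by rewrite /bd big1 // rmorph0.
  rewrite [in RHS]big1 ?rmorph0 => [|j _]; last by rewrite mulr0.
  have := Hc G; rewrite addn0 => /(_ cG); rewrite /dg (bigD1 G) ?GD ?cG ?eqxx //=.
  rewrite big1 ?addr0 => [|F /andP[/andP[FD /eqP cF] FG]].
    rewrite rmorphM /= peval_xset => /eqP; rewrite !mulf_eq0 (negPf (vand_neq0 char2 tI _)) /=.
    have -> : (\prod_(v in G) lam t G v == 0) = false.
      apply/negbTE/prodf_neq0 => v vG; rewrite /lam vG invr_neq0 //.
      exact: node_neq0.
    rewrite orbF (homog0_const (hc G)) /peval mevalC => /eqP->.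
    by rewrite mpolyC0 rmorph0.
  have /subsetPn[v vG vF] : ~~ (G \subset F).
    by apply: contra FG => GF; rewrite eq_sym eqEcard GF cF cG leqnn.
  by rewrite rmorphM /= peval_xset (bigD1 v) //= lam_out // mul0r !mulr0.
case: s ns sd cc Hc => // s ns sd cc Hc.
have /(@functional_choice _ _)[m mP] : forall G, exists m : nat -> P,
    (forall j, m j \is n.-homog) /\ (G \in D -> #|G| = s.+1 ->
    restr G (c G) = restr G (\sum_(j < s.+1) theta j * m j)).
  move=> G; have [cG|/eqP cG] := eqVneq #|G| s.+1; last by exists (fun _ => 0); split=> [j|//]; rewrite rpred0.
  have := @one_face_full _ char2 _ _ tI G n (c G) (hc G); rewrite cG => /(inJ_homog (hc G))[m [hm mE]].
  by exists m; split=> // _ _; apply: mE; rewrite inE.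
have mE : ceq D s.+1 c (fun F => \sum_(j < s.+1) theta j * m F j).
  by move=> F FD cF; have [_ ->] := mP F.
(* At [lam t F] only theta_s survives, so its coefficient may replace c in the degree. *)
have mL F : F \in D -> #|F| = s.+1 -> peval (lam t F) (c F) = peval (lam t F) (m F s).
  move=> FD cF; rewrite -(peval_restr _ (@lam_out _ _ t F)) mE //.
  rewrite (peval_restr _ (@lam_out _ _ t F)) big_ord_recr rmorphD rmorph_sum /=.
  rewrite big1 ?add0r => [|j _]; rewrite rmorphM /= (theta_lam char2 tI) ?cF //=.
    by rewrite eqxx mul1r.
  by rewrite ltn_eqF ?mul0r.
  by rewrite ltnS ltnW.
pose c1 := bd D s.+1 (fun F => m F s).
have [|F|H cH|g [gC gE]] := IH s c1 ns (ltnW sd).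
- exact: (cyc_bd char2 dD).
- by rewrite /c1 /bd; apply: rpred_sum => G _; have [hm _] := mP G; apply: hm.
- rewrite -[RHS](Hc H); last by rewrite addnS cH.
  have -> : dg t D s.+1 (fun F => c F * xset K H) = dg t D s.+1 (fun F => m F s * xset K H).
    by apply: eq_bigr => F /andP[FD /eqP cF]; rewrite !rmorphM /= mL.
  rewrite [RHS](dg_bd char2 tI dD) //=; last first.
    move=> F _ _; have [hm _] := mP F; rewrite -cH addnC.
    by apply: dhomogM; rewrite ?hm ?xset_homog.
  by apply: eq_bigr => F _; rewrite /c1 /bd big_distrl.
have [c' [cr [crC cE]]] := cyc_correct char2 dD exD (c := fun j F => m F j) sd gC gE.
have c'C : cyc D s.+1 (fun F => \sum_(j < s) theta j * c' j F).
  apply: (@cyc_ceq _ _ _ _ (fun F => c F + theta s * cr F)).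
    by move=> G GD cG; rewrite rmorphD /= mE // -rmorphD cE -addrA addpp_char2 ?addr0.
  by apply: cycD => //; apply: cycM.
have [g' [gC' gE']] := lift_cyc char2 tI dD exD (ltnSn s) sd c'C.
exists (fun j => if j == s then cr else g' j); split=> [j|G GD cG]; first by case: eqP.
rewrite mE // cE big_ord_recr /= eqxx !rmorphD /= gE' //; congr (restr G _ + _).
by apply: eq_bigr => j _; rewrite ltn_eqF.
Qed.

Lemma sphere_regular i : (i.*2 < d)%N -> regular_upto t D d i.
Proof.
move=> id r n y ni hr hy Jy; case: (pD) => dD D0 coverD leD rD.
case: hr => [rd|[rd nE]]; first exact: sphere_regular_lt.
rewrite rd in Jy *.
have eD : even_ridges d D by move=> s sD cs; rewrite rD.
have hy2 : theta d * y \is n.+1.-homog by apply: (@dhomogM _ _ _ 1); rewrite ?theta_homog.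
have [g [hg eg]] := inJ_homog hy2 Jy.
have n2d : (n.*2 < d)%N by rewrite (leq_ltn_trans _ id) // leq_double ltnW.
have nd : (n < d)%N by apply: leq_ltn_trans n2d; rewrite -addnn leq_addr.
have ny : nul t d D n y.
  apply: (nul_theta_inj char2 t2) => //; apply: (nul_eqD eg).
  by apply: nul_sum => j _; apply: nul_theta.
have [//|H cH|g' [gC gE]] := @socle n d (fun _ => y) (ltnW nd) (leqnn d) (cyc_const y).
  by apply: ny; rewrite -[d]cH addnK; apply: xset_homog.
exact: cyc_inJ gC gE.
Qed.

End SphereRegular.

(** * Turan's theorem and the bounds on g *)

Lemma gnum_lower (T : finType) d (D : {set {set T}}) (S : {set T}) k :
  pseudo d D -> flagp D -> (k.+2.*2 < d)%N -> independent D S ->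
  (forall (K : fieldType) (f : {rmorphism 'F_2 -> K}) (t : T -> K),
     2%N \in [pchar K] -> ind2 t -> regular_upto t D d k.+2) ->
  ((d - k.+2.*2) * #|S|)%:Z <= gnum d D k.+2.
Proof.
move=> pD fD kd /andP[SV /forall_inP Sind] reg; case: (pD) => dD D0 _ leD _.
have [K0 [K [i0 [i [t0 [t [t02 t2 tE tv]]]]]]] := fields_exist S.
have c0 : 2%N \in [pchar K0] by apply: (rmorph_pchar i0); rewrite pchar_Fp.
have cK : 2%N \in [pchar K] by apply: (rmorph_pchar i).
have [W WP] := Wspace_exists K T k.+2 k.+2.
have [J JP] := Jspace t d k D.
have regK := reg K (i \o i0 : {rmorphism 'F_2 -> K}) t cK t2.
have kd' : (0 < k.+2 <= d)%N by apply: leq_trans (ltnW kd); rewrite -addnn leq_addr.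
rewrite -(dim_upper dD D0 leD regK kd' WP JP).
have : (\dim J + (d - k.+2.*2) * #|S| <= \dim W)%N.
  apply: (lower_bound c0 t02 t2 pD fD kd _ _ tE tv WP JP) => [u v uS vS uv|v vS].
    by have := forall_inP (Sind u uS) v vS; rewrite negb_and uv.
  by have := subsetP SV v vS; rewrite inE.
by lia.
Qed.

Lemma independence_attained (T : finType) (D : {set {set T}}) :
  exists2 S, independent D S & independence_number D = #|S|.
Proof.
have I0 : independent D set0.
  by rewrite /independent sub0set; apply/forall_inP => u; rewrite inE.
have [|S SI SE] := @eq_bigmax_cond _ (independent D) (fun S : {set T} => #|S|).
  by apply/card_gt0P; exists set0.
by exists S.
Qed.

Section Turan.
Variables (T : finType) (e : rel T) (R : realDomainType).
Hypothesis e_sym : ssrbool.symmetric e.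
Implicit Types (V S : {set T}).

Let nb V u := [set w in V | (w == u) || e u w].
Let Q V := (\sum_(u in V) #|nb V u|)%N.

(* Remove the closed neighbourhood of a vertex of minimal degree: its x vertices
   carry at least x^2 of Q V, and 2 c x - (c x)^2 <= 1. *)
Lemma turan (c : R) V : exists S, [/\ S \subset V,
    {in S &, forall u v, u != v -> ~~ e u v} &
    2 * c * #|V|%:R - c ^+ 2 * (Q V)%:R <= #|S|%:R].
Proof.
have [n] := ubnP #|V|; elim: n V => // n IH V ltn.
have [->|[v0 v0V]] := set_0Vmem V.
  exists set0; rewrite sub0set /Q big_set0 cards0 !mulr0 subrr; split=> // u v.
  by rewrite inE.
have [v vV minv] := @arg_minnP _ v0 (mem V) (fun u => #|nb V u|) v0V.
have {}vV : v \in V by exact: vV.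
pose N := nb V v; have vN : v \in N by rewrite inE vV eqxx.
have NV : N \subset V by apply/subsetP => u; rewrite inE => /andP[].
have [|S [SV Si Sb]] := IH (V :\: N).
  rewrite -ltnS (leq_trans _ ltn) // ltnS cardsD (setIidPr NV).
  by rewrite ltn_subrL !card_gt0; apply/andP; split; apply/set0Pn; exists v.
exists (v |: S); split.
- by rewrite subUset sub1set vV (subset_trans SV) ?subsetDl.
- have vS w : w \in S -> ~~ e v w.
    by move=> /(subsetP SV); rewrite !inE => /andP[+ wV]; rewrite wV negb_or => /andP[].
  move=> u w /setU1P[->|uS] /setU1P[->|wS] uw; rewrite ?eqxx // in uw *.
  + exact: vS.
  + by rewrite e_sym; apply: vS.
  exact: Si.
have vS : v \notin S by apply/negP => /(subsetP SV); rewrite inE vN.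
have cV : #|V| = (#|V :\: N| + #|N|)%N by rewrite cardsD (setIidPr NV) subnK // subset_leq_card.
have QV : (Q (V :\: N) + #|N| ^ 2 <= Q V)%N.
  rewrite /Q (big_setID N (A := V)) /= (setIidPr NV) addnC leq_add //.
    rewrite -mulnn -sum_nat_const; apply: leq_sum => u uN; apply: minv.
    exact: (subsetP NV).
  apply: leq_sum => u _; apply: subset_leq_card; apply/subsetP => w.
  by rewrite !inE -andbA => /and3P[_ -> ->].
rewrite cardsU1 vS cV !natrD.
have : ((Q (V :\: N) + #|N| ^ 2)%:R : R) <= (Q V)%:R by rewrite ler_nat.
rewrite natrD natrX => QV'.
have := ler_wpM2l (sqr_ge0 c) QV'.
have := sqr_ge0 (c * #|N|%:R - 1); move: Sb.
move: (Q _)%:R (Q V)%:R (#|N|%:R) (#|S|%:R) (#|V :\: N|%:R) => q q' x s y.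
by rewrite /=; nra.
Qed.

End Turan.

Section Counting.
Variables (T : finType) (D : {set {set T}}).
Hypothesis dD : downset D.

Lemma card_vertices : #|vertices D| = fnum D 1.
Proof.
rewrite /fnum -(card_imset _ (@set1_inj T)); apply: eq_card => s; rewrite inE.
apply/imsetP/andP => [[v + ->]|[sD /cards1P[v sE]]]; first by rewrite inE cards1.
by exists v; rewrite // inE -sE.
Qed.

Lemma handshake :
  (\sum_(u in vertices D) #|[set w in vertices D | (w == u) || adjacent D u w]| = fnum D 1 + 2 * fnum D 2)%N.
Proof.
have e2 : (\sum_(u in vertices D) #|[set s in D | (#|s| == 2) && (u \in s)]| = 2 * fnum D 2)%N.
  under eq_bigr do rewrite -sum1_card.
  rewrite (exchange_big_dep (fun s => s \in [set s in D | #|s| == 2])) /=; last first.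
    by move=> u s _; rewrite !inE => /and3P[-> ->].
  rewrite mulnC -sum_nat_const; apply: eq_bigr => s; rewrite inE => /andP[sD /eqP cs].
  transitivity #|s|; last by []. rewrite -sum1_card; apply: eq_bigl => u; rewrite !inE sD cs eqxx /=.
  by apply: andb_idl => us; apply: dD sD _; rewrite sub1set.
rewrite -e2 -card_vertices -sum1_card -big_split; apply: eq_bigr => u uV /=.
have -> : [set w in vertices D | (w == u) || adjacent D u w] = u |: [set w | adjacent D u w].
  apply/setP => w; rewrite !inE; case: (eqVneq w u) => [->|wu] /=.
    by move: uV; rewrite inE => ->.
  by apply: andb_idl => /andP[_ uwD]; apply: dD uwD _; rewrite sub1set set22.
rewrite cardsU1 inE /adjacent eqxx /=; congr addn.
have inj : {in [set w | adjacent D u w] &, injective (fun w => [set u; w])}.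
  move=> w w'; rewrite !inE => /andP[uw _] _ /setP/(_ w).
  by rewrite !inE eqxx orbT eq_sym (negPf uw) => /esym/eqP.
rewrite -(card_in_imset inj); apply: eq_card => s; rewrite !inE.
apply/imsetP/and3P => [[w + ->]|[sD cs us]].
  by rewrite inE => /andP[uw uwD]; rewrite uwD cards2 uw set21.
have /cards1P[w sw] : #|s :\ u| == 1%N by have := cardsD1 u s; rewrite us (eqP cs) add1n => -[/esym/eqP].
have : w \in s :\ u by rewrite sw set11.
rewrite !inE => /andP[wu ws]; have sE : s = [set u; w] by rewrite -(setD1K us) sw.
by exists w; rewrite // inE /adjacent eq_sym wu -sE.
Qed.

Lemma coef_Xsub1 n m : (('X - 1) ^+ n : {poly int})`_m = if (m <= n)%N then (-1) ^+ (n - m) * ('C(n, m))%:R else 0.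
Proof.
elim: n m => [|n IH] m; first by rewrite expr0 coef1; case: m.
rewrite exprS mulrBl mul1r coefB coefXM !IH; case: m => [|m] /=.
  by rewrite !subn0 bin0 !mulr1 sub0r exprS mulN1r.
rewrite subSS ltnS binS; case: ltnP => mn; last first.
  rewrite subr0; case: leqP => // nm; have -> : m = n by apply/eqP; rewrite eqn_leq nm.
  by rewrite binn bin_small.
by rewrite ltnW // -[(n - m)%N]subnSK // exprS natrD; ring.
Qed.

Lemma gnum2 d : set0 \in D -> (2 <= d)%N ->
  gnum d D 2 = (fnum D 2)%:Z - (d * fnum D 1)%:Z + ('C(d.+1, 2))%:Z.
Proof.
case: d => [|[|e]] // D0 _.
have f0 : fnum D 0 = 1%N.
  rewrite /fnum -(cards1 (set0 : {set T})); apply: eq_card => s; rewrite !inE.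
  by rewrite cards_eq0 andbC; apply: andb_idr => /eqP->.
have low m : (e <= m)%N -> (hpoly e.+2 D)`_m =
    (('X - 1) ^+ e.+2 : {poly int})`_m + (fnum D 1)%:R * (('X - 1) ^+ e.+1 : {poly int})`_m
    + (fnum D 2)%:R * (('X - 1) ^+ e : {poly int})`_m.
  move=> em; rewrite /hpoly 3!big_ord_recl /= /bump /= f0 scale1r !coefD !coefZ coef_sum.
  rewrite !subSS !subn0 big1 ?addr0 ?addrA // => j _.
  rewrite coefZ coef_Xsub1 leqNgt (leq_trans _ em) ?mulr0 //=.
  by rewrite /bump /= !add1n !subSS ltn_subrL; case: j => j /= /(leq_ltn_trans _)->.
rewrite /gnum /hnum !subSS !subn0 !low // !coef_Xsub1.
have e2 : (e.+2 - e = 2)%N by rewrite -addn2 addKn.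
have c2 : 'C(e.+2, e) = 'C(e.+2, 2) by rewrite -e2 bin_sub // ltnW.
have c3 : 'C(e.+3, 2) = ('C(e.+2, 2) + e.+2)%N by rewrite binS bin1.
rewrite !ltnn !leqnn !leqnSn (leqW (leqnSn e)) !subnn !subSnn e2 !binn !binSn c2 c3.
move: 'C(e.+2, 2) => b.
rewrite !natz !PoszD !PoszM -!natz; ring.
Qed.

End Counting.

(** Let b be the nonnegative root of 2 b^2 + (2 d + 1) b = d - 4. If g < b n, the bound at c = 1 /
    (2 d + 1 + 2 b) gives a >= c n; since (d - 4) c = b, this contradicts (d - 4) a <= g. *)
Lemma sqrt_bound (R : rcfType) (d n a g : R) : 5 <= d -> 0 < n ->
  (forall c, 2 * c * n - c ^+ 2 * ((2 * d + 1) * n + 2 * g) <= a) -> (d - 4) * a <= g ->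
  (Num.sqrt (4 * d ^+ 2 + 12 * d - 31) - (2 * d + 1)) / 4 * n <= g.
Proof.
move=> d5 n0 ca ag; set r := Num.sqrt _.
have disc : 0 <= 4 * d ^+ 2 + 12 * d - 31 by nra.
have r0 : 0 <= r by apply: sqrtr_ge0.
have r2 : r ^+ 2 = 4 * d ^+ 2 + 12 * d - 31 by apply: sqr_sqrtr.
rewrite leNgt; apply/negP => gb.
pose b := (r - (2 * d + 1)) / 4; rewrite -/b in gb.
have b0 : 2 * b ^+ 2 + (2 * d + 1) * b = d - 4 by rewrite /b; field: r2.
(* The radicand is (2 d + 1)^2 + 8 (d - 4). *)
have rd : 2 * d + 1 <= r by rewrite -[leLHS]ger0_norm -?sqrtr_sqr ?ler_sqrt //; nra.
have bp : 0 <= b by rewrite /b divr_ge0 // subr_ge0.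
have z0 : 0 < 2 * d + 1 + 2 * b by lra.
have := ca (2 * d + 1 + 2 * b)^-1.
set z := _ + _ in z0 *; set c := z^-1.
have zc : z * c = 1 by rewrite divff // gt_eqF.
have c0 : 0 < c by rewrite invr_gt0.
move=> h; have : n * c <= a.
  apply: le_trans h.
  have : c ^+ 2 * ((2 * d + 1) * n + 2 * g) <= c ^+ 2 * (z * n).
    by rewrite ler_wpM2l ?sqr_ge0 // /z; lra.
  have -> : c ^+ 2 * (z * n) = (z * c) * (c * n) by ring.
  rewrite zc mul1r.
  by lra.
have bc : b = (d - 4) * c.
  have -> : d - 4 = b * z by rewrite -b0 /z; ring.
  by rewrite -mulrA zc mulr1.
have d4 : 0 <= d - 4 by lra.
move=> /(ler_wpM2l d4) na.
have bn : b * n = (d - 4) * (n * c) by rewrite bc; ring.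
by move: gb; rewrite bn; lra.
Qed.

Theorem theorem5p1 (R : rcfType) (T : finType) (d : nat) (D : {set {set T}})
    (d_ge5 : (5 <= d)%N) (flagD : flag D) (pmD : normal_pseudomanifold d D) :
  (gnum d D 2 >= (d%:Z - 4) * (independence_number D)%:Z
   /\ (gnum d D 2)%:~R >=
      (Num.sqrt (4 * d%:R ^+ 2 + 12 * d%:R - 31) - (2 * d%:R + 1)) / 4
        * (fnum D 1)%:R :> R)
  /\ (sphere_class 1 d D ->
      forall i : nat, (2 <= i)%N -> (2 * i <= d - 1)%N ->
        gnum d D i >= (d%:Z - 2 * i%:Z) * (independence_number D)%:Z).
Proof.
have pD := npm_pseudo pmD; case: (pD) => dD D0 coverD leD _.
have cD : forall s : {set T}, s \in D -> (#|s|.+2 <= d)%N -> connected_complex (link D s).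
  by case: pmD.
have fD := flag_flagp D0 flagD.
have [S SI SE] := independence_attained D.
have d2 : (2 < d)%N by apply: leq_trans d_ge5.
have g2 : (d%:Z - 4) * (independence_number D)%:Z <= gnum d D 2.
  (* [d_ge5] is the condition 2i < d for i = 2. *)
  have := @gnum_lower _ _ _ _ 0%N pD fD d_ge5 SI (fun K f t c2 t2 => regular_two c2 t2 pD d2 cD).
  have -> : d%:Z - 4 = (d - 0.+2.*2)%N%:Z by rewrite -subzn //; exact: ltnW.
  by rewrite SE PoszM.
split; [split=> //|move=> [[_ _ hD] _] [|[|k]] // _ kd].
- apply: (@sqrt_bound _ _ _ (independence_number D)%:R).
  + by rewrite ler_nat.
  + rewrite ltr0n -card_vertices //; have [F [FD _ cF]] := coverD _ D0.
    have /subset_leq_card : F \subset vertices D.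
      by apply/subsetP => v vF; rewrite inE; apply: dD FD _; rewrite sub1set.
    by rewrite cF; apply: leq_trans; apply: leq_trans d_ge5.
  + move=> c; have adj_sym : ssrbool.symmetric (adjacent D).
      by move=> u v; rewrite /adjacent eq_sym setUC.
    have [S' [S'V S'i]] := turan adj_sym c (vertices D); rewrite handshake // card_vertices // => Sb.
    have le : (#|S'| <= independence_number D)%N.
      apply: (@leq_bigmax_cond _ (independent D) (fun S : {set T} => #|S|)).
      rewrite /independent S'V; apply/forall_inP => u uS; apply/forall_inP => v vS.
      by case: (eqVneq u v) => [->|uv]; [rewrite /adjacent eqxx|apply: S'i].
    rewrite -(ler_nat R) in le; apply: le_trans le; apply: le_trans Sb.
    rewrite lerD2l lerN2 ler_wpM2l ?sqr_ge0 // gnum2 //; last exact: ltnW.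
    have -> : ((fnum D 2)%:Z - (d * fnum D 1)%:Z + ('C(d.+1, 2))%:Z)%:~R =
      (fnum D 2)%:R - d%:R * (fnum D 1)%:R + ('C(d.+1, 2))%:R :> R.
      by rewrite rmorphD rmorphB /= -!pmulrn natrM.
    (* Dropping the binomial coefficient bounds f_0 + 2 f_1 by (2 d + 1) f_0 + 2 g_2. *)
    have := ler0n R 'C(d.+1, 2); rewrite natrD natrM; lra.
  have := g2; rewrite -(ler_int R) rmorphM rmorphB /= -!pmulrn.
  by [].
have kd' : (k.+2.*2 < d)%N by move: kd; lia.
have := @gnum_lower _ _ _ _ k pD fD kd' SI (fun K f t c2 t2 =>
  sphere_regular c2 t2 pD (sphere_exact f dD hD) cD kd').
have -> : d%:Z - 2 * k.+2%:Z = (d - k.+2.*2)%N%:Z.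
  by rewrite -subzn ?(ltnW kd') // -mul2n PoszM.
by rewrite SE PoszM.
Qed.
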